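(* Let $G$ be a group admitting a proper cobounded isometric action on an injective metric space $X$. Assume further that $G$ is not virtually cyclic and that it contains a Morse ray. If $H<G$ is an infinite-index quasi-convex subgroup of $G$, then the growth rate in $X$ of $H$ is strictly smaller than the growth rate in $X$ of $G$.
   Context: A metric space $X$ is injective if for any families $\{x_i\}$ in $X$ and $\{r_i\}$ in $[0,\infty)$ with $d(x_i,x_j)\le r_i+r_j$ for all $i\ne j$, the closed balls satisfy $\bigcap_i B(x_i,r_i)\neq\emptyset$. Injective spaces are geodesic. An isometric action of $G$ on $X$ is cobounded if there are $p\in X$ and $C$ such that every $x\in X$ satisfies $d(x,gp)\le C$ for some $g\in G$; it is proper if for every ball $B\subseteq X$ the set $\{g\in G: B\cap gB\ne\emptyset\}$ is finite. A group $G$ as in the statement is finitely generated. $G$ contains a Morse ray if some (equivalently, any) Cayley graph of $G$ with respect to a finite generating set contains a Morse geodesic ray. A $(\lambda,\epsilon)$-quasi-geodesic is a map $\beta$ from an interval $I\subseteq\mathbb{R}$ with $\frac1\lambda|s-t|-\epsilon\le d(\beta(s),\beta(t))\le\lambda|s-t|+\epsilon$ for all $s,t\in I$. A subset $Y$ (for instance a geodesic ray) of a metric space is Morse if there is $M:\mathbb{R}^+\times\mathbb{R}^+\to\mathbb{R}^+$ such that every $(\lambda,\epsilon)$-quasi-geodesic with endpoints on $Y$ is contained in the $M(\lambda,\epsilon)$-neighborhood of $Y$; here $\mathbb{R}^+=[0,\infty)$. The growth rate in $X$ of a subset $A\subseteq G$ is $\limsup_{r\to\infty}\frac1r\log|\{a\in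 A: d(o,ao)\le r\}|$ for a basepoint $o\in X$ (independent of $o$ for subgroups). A subgroup $H<G$ is quasi-convex (with respect to the action on $X$) if there are a non-empty $H$-invariant subset $Y\subseteq X$ on which $H$ acts coboundedly and a constant $\eta\ge 0$ such that every geodesic of $X$ joining two points of $Y$ is contained in the $\eta$-neighborhood of $Y$. *)

(* Defs.v *)
From HB Require Import structures.
From mathcomp Require Import all_boot all_order all_algebra.
From mathcomp Require Import finmap all_classical all_reals all_analysis.

Set Implicit Arguments.
Unset Strict Implicit.
Unset Printing Implicit Defensive.

Import Order.TTheory GRing.Theory Num.Theory.
Import numFieldNormedType.Exports.

Local Open Scope classical_set_scope.
Local Open Scope ring_scope.

(* The next notions are stated for an arbitrary distance function
   [d : T -> T -> R], because they are used both for a [metricType] and for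
   Cayley graphs, where [d] is only a pseudometric (see [cayley_point]).
   A map defined on an interval is given as a total map of which only the values
   on the interval matter. *)
Section CoarseGeometry.
Context {R : realType} {T : Type} (d : T -> T -> R).

Definition nbhd (r : R) (Y : set T) : set T :=
  [set x | exists2 y, Y y & d x y <= r].

Definition geodesic (I : interval R) (c : R -> T) : Prop :=
  {in I &, forall s t, d (c s) (c t) = `|s - t|}.

Definition quasi_geodesic (lambda eps : R) (I : interval R) (b : R -> T) : Prop :=
  {in I &, forall s t,
    lambda^-1 * `|s - t| - eps <= d (b s) (b t) <= lambda * `|s - t| + eps}.

(* [lambda = 0] is left out, as [1 / lambda] has to make sense. *)
Definition morse (Y : set T) : Prop :=
  exists M : R -> R -> R,
    (forall lambda eps, 0 <= M lambda eps) /\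
    forall (lambda eps : R), 0 < lambda -> 0 <= eps ->
    forall (a b : R) (beta : R -> T), a <= b ->
      quasi_geodesic lambda eps `[a, b] beta -> Y (beta a) -> Y (beta b) ->
      beta @` `[a, b] `<=` nbhd (M lambda eps) Y.

Definition has_morse_ray : Prop :=
  exists2 c : R -> T, geodesic `[0, +oo[ c & morse (c @` `[0, +oo[).

End CoarseGeometry.

Section Groups.
Context {G : groupType}.

Definition finite_index (H : set G) : Prop :=
  finite_set (range (fun x : G => [set (x * h)%g | h in H])).

Definition cyclic_subgroup (g : G) : set G :=
  range (fun n : nat => (g ^+ n)%g) `|` range (fun n : nat => (g ^- n)%g).

Definition words (S : set G) (g : G) : set (seq G) :=
  [set w | (forall s, s \in w -> S s \/ S (s^-1)%g) /\ (\prod_(s <- w) s)%g = g].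

Definition generates (S : set G) : Prop := forall g, words S g !=set0.

End Groups.

Definition virtually_cyclic (G : groupType) : Prop :=
  exists g : G, finite_index (cyclic_subgroup g).

Section CayleyGraph.
Context (R : realType) {G : groupType} (S : set G).

Definition word_dist (x y : G) : R :=
  inf [set (size w)%:R | w in words S (x^-1 * y)%g].

(* The geometric realization of the Cayley graph of [G] with respect to [S], in
   which every [g : G] and [s] in [S] give an edge of length 1 from [g] to
   [g * s].  A point is given by an edge and a position along it; the points
   that are glued together at the vertices are at [cayley_dist] 0 rather than
   equal. *)
Record cayley_point := CayleyPoint {
  cp_src : G;
  cp_label : G;
  cp_pos : R;
  cp_labelP : S cp_label;
  cp_posP : 0 <= cp_pos <= 1 }.

(* The two endpoints of the edge of [p], each with its distance to [p] along
   that edge. *)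
Definition cp_ends (p : cayley_point) : set (G * R) :=
  [set (cp_src p, cp_pos p); ((cp_src p * cp_label p)%g, 1 - cp_pos p)].

(* The path metric: a shortest path either leaves the edge of [p] and enters
   that of [q] through endpoints, or stays inside their common edge. *)
Definition cayley_dist (p q : cayley_point) : R :=
  inf ([set u.2 + word_dist u.1 v.1 + v.2 | u in cp_ends p & v in cp_ends q]
       `|` [set l | [/\ cp_src p = cp_src q, cp_label p = cp_label q
                      & l = `|cp_pos p - cp_pos q|]]).

End CayleyGraph.

Definition contains_morse_ray (R : realType) (G : groupType) : Prop :=
  exists S : set G,
    [/\ finite_set S, generates S & has_morse_ray (@cayley_dist R G S)].

Section MetricSpaces.
Context {R : realType}.

(* The library's [closed_ball] is the closure of the open ball, which in a
   general metric space is not the set below. *)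
Definition cball (X : metricType R) (x : X) (r : R) : set X :=
  [set y | mdist x y <= r].

Definition injective_space (X : metricType R) : Prop :=
  forall (I : Type) (x : I -> X) (r : I -> R),
    (forall i, 0 <= r i) ->
    (forall i j, i <> j -> mdist (x i) (x j) <= r i + r j) ->
    \bigcap_i cball (x i) (r i) !=set0.

Section Actions.
Context {G : groupType} {X : metricType R} (act : G -> X -> X).

Definition isometric_action : Prop :=
  [/\ forall x, act 1%g x = x,
      forall g h x, act (g * h)%g x = act g (act h x)
    & forall g x y, mdist (act g x) (act g y) = mdist x y].

Definition cobounded_on (H : set G) (Y : set X) : Prop :=
  exists2 p, Y p &
  exists C : R, forall y, Y y -> exists2 h, H h & mdist y (act h p) <= C.

Definition cobounded_action : Prop := cobounded_on setT setT.

Definition proper_action : Prop :=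
  forall (x : X) (r : R),
    finite_set [set g | cball x r `&` act g @` cball x r !=set0].

Definition quasi_convex (H : set G) : Prop :=
  exists Y : set X,
    [/\ Y !=set0,
        forall h y, H h -> Y y -> Y (act h y),
        cobounded_on H Y
      & exists2 eta : R, 0 <= eta &
          forall (a b : R) (c : R -> X), a <= b ->
            geodesic (@mdist R X) `[a, b] c -> Y (c a) -> Y (c b) ->
            c @` `[a, b] `<=` nbhd (@mdist R X) eta Y].

(* For a proper action the set that is counted is finite; [fset_set] of an
   infinite set would be empty. *)
Definition growth_rate (o : X) (A : set G) : \bar R :=
  limf_esup
    (fun r : R =>
       (r^-1 * ln (#|` fset_set [set a | A a /\ mdist o (act a o) <= r]|%:R))%:E)
    (pinfty_nbhs R).

End Actions.
End MetricSpaces.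

(* Main.v *)
Require Import Defs.
From mathcomp Require Import all_boot all_order all_algebra.
From mathcomp Require Import finmap all_classical all_reals all_analysis.
From mathcomp Require Import lra zify.

(** Why the theorem is true.

    The orbit map carries a Morse ray of the Cayley graph to a sequence of
    points [p n = act (g n) o] of [X] that still captures every quasi-geodesic
    with endpoints on it ([morse_orbit_seq]).  In an injective space this
    forces more than in a general geodesic space.  Given two points and their
    nearest points [p], [q] on the sequence, the intersection property of balls
    shrinks the whole configuration towards the sequence, down to the scale of
    [d p q], with the distance of the two points bounded as if [X] were convex
    ([contract_pair]).  If the two points are close to each other compared with
    their height and [p], [q] are far apart, the shrunken configuration contains
    a quasi-geodesic from [p] to [q] that rises to a height comparable to [d p q], which the Morse
    property forbids ([rung_bound]).  Hence balls disjoint from the sequence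
    have projections of bounded diameter ([ball_contracting]), which makes the
    sequence strongly contracting ([contracting]); the same then holds, with one
    constant, for all its finite segments ([contracting_orbit_seq]).

    Contracting segments can be handled like segments in a tree.  If in a chain
    of long segments any two neighbours project to each other near the ends
    where they meet, then a point that projects near the first end of one
    segment projects near the first end of the next ([chain_step]).  Contraction
    enters the rest of the proof in three ways.

    - By pigeonhole some [f] moves a segment of the sequence further along the
      sequence.  Its powers form a chain, so [f] has infinite order
      ([infinite_order_element]); as [G] is not virtually cyclic, the orbit has
      more points in balls than any linear function of the radius
      ([superlinear_growth]).

    - The elements of a ball of [G] that keep a given segment close to itself
      are distinguished by how far they shift it, up to boundedly many, so there
      are at most linearly many of them ([few_fellow_travellers]).  Hence some
      ball contains three elements that send the segment in three diverging
      directions ([diverging_triple_exists]), and for any two points of [X] one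
      of the three directions is such that both points project near its start
      ([diverging_triple_choice]).

    - Let [H] be quasi-convex of infinite index.  Some translate of the orbit of
      [H] is so far from [o] that it projects to a segment issuing from [o] in
      one small spot, which is the start if the direction of the segment is chosen
      well.  A ping-pong argument ([letters_free]) then shows that for fixed [c1]
      and [c2], the products of the elements [c1 * h * c2], with [h] in a sufficiently sparse subset of
      [H], are all different ([free_subgroup_family]).

    It remains to count.  Geodesics between orbit points of [H] stay near the
    orbit, so the number of elements of [H] of length at most [r] is
    submultiplicative in [r], up to shifting [r] by a constant; it is therefore at
    least [expR (del * r)] for some [del] that bounds the growth rate of [H] from
    above ([submultiplicative_rate]).  Consequently the series of the
    [expR (- (del * d o (act h o)))] diverges ([poincare_unbounded]) and keeps
    doing so on sparse subsets ([separated_series]), so that there is some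
    [s > del] and a finite sparse set for which the sum of the
    [expR (- (s * d o (act (c1 * h * c2) o)))] exceeds 1.  Expanding the n-th
    power of this sum over the distinct products of n factors shows that [G] has
    growth rate at least [s] ([free_family_growth]).  If [H] is finite, its
    growth rate is 0 and the same argument is applied to two free elements of
    [G] ([free_pair]). *)

Set Implicit Arguments.
Unset Strict Implicit.
Unset Printing Implicit Defensive.

Import Order.TTheory GRing.Theory Num.Theory.

Local Open Scope classical_set_scope.
Local Open Scope ring_scope.

(** * Balls and geodesics in injective spaces *)

Section Injective.
Context {R : realType} {X : metricType R}.
Local Notation d := (@mdist R X).

Lemma dist_triangle (y x z : X) : d x z <= d x y + d y z.
Proof. exact: metric_triangle. Qed.

Definition nearest (A : set X) (x p : X) := A p /\ forall q, A q -> d x p <= d x q.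

Context (injX : injective_space X).

(** Injectivity for four balls, the only case used besides the construction of
    geodesics.  Fewer balls are obtained by repeating one. *)
Lemma balls4_meet (x1 x2 x3 x4 : X) (r1 r2 r3 r4 : R) :
  0 <= r1 -> 0 <= r2 -> 0 <= r3 -> 0 <= r4 ->
  d x1 x2 <= r1 + r2 -> d x1 x3 <= r1 + r3 -> d x1 x4 <= r1 + r4 ->
  d x2 x3 <= r2 + r3 -> d x2 x4 <= r2 + r4 -> d x3 x4 <= r3 + r4 ->
  exists z, [/\ d x1 z <= r1, d x2 z <= r2, d x3 z <= r3 & d x4 z <= r4].
Proof.
move=> r1_0 r2_0 r3_0 r4_0 d12 d13 d14 d23 d24 d34.
pose x (i : bool * bool) := match i with
  | (true, true) => x1 | (true, false) => x2
  | (false, true) => x3 | (false, false) => x4 end.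
pose r (i : bool * bool) := match i with
  | (true, true) => r1 | (true, false) => r2
  | (false, true) => r3 | (false, false) => r4 end.
have [||z zP] := injX (x := x) (r := r).
- by move=> [[] []].
- by move=> [[] []] [[] []] //= _; rewrite // metric_sym addrC.
exists z; split; [exact: (zP (true, true))|exact: (zP (true, false))
  |exact: (zP (false, true))|exact: (zP (false, false))].
Qed.

(** A maximal partial isometry from the interval to [X], given by Zorn's lemma,
    is defined everywhere: the value at a missing time [s] has to lie in the
    balls around the existing values with radii their distances in time to [s],
    and these balls meet in pairs.  Points of the intersection are then at the
    exact distances because the two endpoints are in the domain. *)
Lemma geodesic_exists (x y : X) :
  exists c : R -> X, [/\ geodesic d `[0, d x y] c, c 0 = x & c (d x y) = y].
Proof.
set L := d x y.
have L0 : 0 <= L := mdist_ge0 x y.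
pose ext (A : set (R * X)) := A `|` [set (0, x); (L, y)].
pose P : set (set (R * X)) := [set A | forall u v, ext A u -> ext A v ->
  0 <= u.1 <= L /\ d u.2 v.2 = `|u.1 - v.1| ].
have [F FP Ftot|A [PA Amax]] := @Zorn_bigcup _ P.
  have common u v : ext (\bigcup_(X0 in F) X0) u -> ext (\bigcup_(X0 in F) X0) v ->
      (exists2 B, P B & ext B u /\ ext B v).
    have P0 : P set0.
      move=> a b [//|] [->|->] [//|] [->|->] /=; rewrite ?mdistxx ?subrr ?normr0 ?lexx ?L0 //.
        by rewrite sub0r normrN ger0_norm.
      by rewrite metric_sym subr0 ger0_norm.
    move=> [[B FB Bu]|bu] [[C FC Cv]|bv].
    - have [BC|CB] := Ftot _ _ FB FC.
      + by exists C; [exact: FP|split; left => //; exact: BC].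
      + by exists B; [exact: FP|split; left => //; exact: CB].
    - by exists B; [exact: FP|split; [left|right]].
    - by exists C; [exact: FP|split; [right|left]].
    - by exists set0 => //; split; right.
  move=> u v uF vF; have [B PB [Bu Bv]] := common _ _ uF vF; exact: PB.
have extx : ext A (0, x) by right; left.
have exty : ext A (L, y) by right; right.
have full s : 0 <= s <= L -> exists z, ext A (s, z).
  move=> sL; apply: contrapT => noz.
  have [||z zP] := injX (I := {u : R * X | ext A u}) (x := fun u => (sval u).2)
      (r := fun u => `|(sval u).1 - s|).
  - by move=> u; exact: normr_ge0.
  - move=> [u Au] [v Av] _ /=; have [_ ->] := PA _ _ Au Av.
    by rewrite (distrC v.1); exact: ler_distD.
  have zlip u : ext A u -> d u.2 z <= `|u.1 - s|.
    by move=> Au; exact: (zP (exist _ u Au) I).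
  have zeq u : ext A u -> d u.2 z = `|u.1 - s|.
    move=> Au; apply/eqP; rewrite eq_le zlip //=.
    have [u1L _] := PA _ _ Au Au.
    have [_ /= ex] := PA _ _ extx Au; have [_ /= ey] := PA _ _ Au exty.
    have := zlip _ extx; have := zlip _ exty; rewrite /= => zy zx.
    have := dist_triangle z u.2 y; have := dist_triangle z x u.2.
    rewrite ex ey (metric_sym y z) in zy *; rewrite (metric_sym z u.2).
    move: sL u1L zx zy => /andP[s0 sL] /andP[u0 uL].
    rewrite sub0r normrN (ger0_norm s0) sub0r normrN (ger0_norm u0).
    rewrite ger0_norm ?subr_ge0 // => h1 h2; rewrite ler0_norm ?subr_le0 //.
    by have [us|us] := lerP u.1 s;
      rewrite ?(ler0_norm (_ : u.1 - s <= 0)) ?(ger0_norm (_ : 0 <= u.1 - s)) ?subr_le0 ?subr_ge0 ?(ltW us) //;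
      move=> *; lra.
  have [|] := Amax (A `|` [set (s, z)]).
    split; first by move=> u; left.
    move=> AS; apply: noz; exists z; left; apply: AS; by right.
  have extE u : ext (A `|` [set (s, z)]) u -> ext A u \/ u = (s, z).
    by move=> [[|]|]; [left; left|right|left; right].
  move=> u v /extE [Au|->] /extE [Av|->].
  - exact: PA.
  - by split; [have [] := PA _ _ Au Au|exact: zeq].
  - by split => //=; rewrite metric_sym distrC; exact: zeq.
  - by rewrite mdistxx subrr normr0.
pose c s := xget x [set z | ext A (s, z)].
have cP s : 0 <= s <= L -> ext A (s, c s).
  by move=> /full [z zP]; rewrite /c; case: xgetP => [w _ //|/(_ z)]; case.
have uniqE s z : 0 <= s <= L -> ext A (s, z) -> c s = z.
  move=> sL Az; have [_ /=] := PA _ _ (cP _ sL) Az.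
  by rewrite subrr normr0; exact: mdist_positivity.
exists c; split; first last.
- by apply: uniqE => //; rewrite L0 lexx.
- by apply: uniqE => //; rewrite L0 lexx.
move=> s t; rewrite !in_itv /= => sL tL.
by have [_] := PA _ _ (cP _ sL) (cP _ tL).
Qed.

Lemma geodesic_dist (L : R) (c : R -> X) (s t : R) :
  geodesic d `[0, L] c -> 0 <= s -> s <= t -> t <= L -> d (c s) (c t) = t - s.
Proof.
move=> geo s0 st tL; rewrite geo ?in_itv /=; first by rewrite ler0_norm ?opprB ?subr_le0.
- by rewrite s0 (le_trans st).
- by rewrite tL (le_trans s0).
Qed.

(** The substitute for a convex bicombing: [x] and [y] move towards their
    projections [p] and [q] by the same fraction, and the distance of the moved
    points is bounded by convexity. *)
Lemma contract_pair (x y p q : X) (t : R) : 0 <= t <= 1 ->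
  exists x' y', [/\ d p x' <= t * d x p, d x' x <= (1 - t) * d x p,
    d q y' <= t * d y q, d y' y <= (1 - t) * d y q &
    d x' y' <= (1 - t) * d p q + t * d x y].
Proof.
move=> /andP[t0 t1].
have [dx dy dpq dxy] : [/\ 0 <= d x p, 0 <= d y q, 0 <= d p q & 0 <= d x y].
  by split; exact: mdist_ge0.
have t1' : 0 <= 1 - t by lra.
have [a0 b0 c0 e0] : [/\ 0 <= t * d x p, 0 <= (1 - t) * d x p, 0 <= t * d y q
    & 0 <= (1 - t) * d y q] by split; apply: mulr_ge0.
have [f0 g0] : 0 <= t * d x y /\ 0 <= (1 - t) * d p q by split; apply: mulr_ge0.
have conv (u a b : R) : u <= a -> u <= b -> u <= t * a + (1 - t) * b.
  move=> ua ub; have -> : u = t * u + (1 - t) * u by lra.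
  by apply: lerD; apply: ler_wpM2l.
(* [x'] must already be chosen close enough to [y] and [q] to leave room for [y'];
   the radius [rho] of that room is the distance claimed in the end. *)
set rho := (1 - t) * d p q + t * d x y.
have [||||||||||x' [px' xx' yx' qx']] := balls4_meet (x1 := p) (x2 := x) (x3 := y) (x4 := q)
  (r1 := t * d x p) (r2 := (1 - t) * d x p)
  (r3 := (1 - t) * d y q + rho) (r4 := t * d y q + rho) => //.
- by rewrite /rho; lra.
- by rewrite /rho; lra.
- by rewrite (metric_sym p x); lra.
- have := conv (d p y) (d x p + d x y) (d p q + d y q).
  have := dist_triangle x p y; have := dist_triangle q p y.
  rewrite (metric_sym p x) (metric_sym q y) => h1 h2 /(_ h2 h1).
  by rewrite !mulrDr /rho; lra.
- have := conv (d p q) (d x p + d x y + d y q) (d p q).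
  have := dist_triangle x p q; have := dist_triangle y x q.
  rewrite (metric_sym p x) => h1 h2 /(_ ltac:(lra) (lexx _)).
  by rewrite !mulrDr /rho; lra.
- have := conv (d x y) (d x y) (d x p + d p q + d y q).
  have := dist_triangle p x y; have := dist_triangle q p y.
  rewrite (metric_sym q y) => h1 h2 /(_ (lexx _) ltac:(lra)).
  by rewrite !mulrDr /rho; lra.
- have := conv (d x q) (d x y + d y q) (d x p + d p q).
  have := dist_triangle p x q; have := dist_triangle y x q => h1 h2 /(_ h1 h2).
  by rewrite !mulrDr /rho; lra.
- by rewrite /rho; lra.
have rho0 : 0 <= rho by rewrite /rho; lra.
have [||||||||||y' [qy' yy' _ x'y']] := balls4_meet (x1 := q) (x2 := y) (x3 := y) (x4 := x')
  (r1 := t * d y q) (r2 := (1 - t) * d y q) (r3 := (1 - t) * d y q) (r4 := rho) => //.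
- by rewrite metric_sym; lra.
- by rewrite metric_sym; lra.
- by rewrite mdistxx; lra.
by exists x', y'; split => //; rewrite metric_sym.
Qed.

Lemma approx_min (T : Type) (A : set T) (f : T -> R) :
  A !=set0 -> (forall u, A u -> 0 <= f u) ->
  exists2 u, A u & forall w, A w -> f u <= f w + 1.
Proof.
move=> [a Aa] f0; have hi : has_inf (f @` A).
  by split; [exists (f a), a|exists 0 => _ [u Au <-]; exact: f0].
have [_ [u Au <-] ulow] := inf_adherent ltr01 hi.
exists u => // w Aw; apply: (le_trans (ltW ulow)); rewrite lerD2r.
by apply: ge_inf; [case: hi|exists w].
Qed.

End Injective.

(** * A Morse set has contracting short steps *)

Section Hook.
Context {R : realType} {X : metricType R}.
Local Notation d := (@mdist R X).

(** The path that runs along [al], crosses over along [ze] and comes back along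
    [et] is 1-Lipschitz; so it is a quasi-geodesic as soon as points on
    different legs are at distance at least a fixed fraction of the length of
    path between them. *)
Lemma hook_quasi_geodesic (lam eps s E u : R) (al ze et : R -> X) :
  1 <= lam -> 0 <= eps -> 0 <= s -> 0 <= E -> 0 <= u ->
  geodesic d `[0, s] al -> geodesic d `[0, E] ze -> geodesic d `[0, u] et ->
  al s = ze 0 -> ze E = et u ->
  (forall v a, 0 <= v <= s -> 0 <= a <= E ->
     lam^-1 * ((s - v) + a) - eps <= d (al v) (ze a)) ->
  (forall a w, 0 <= a <= E -> 0 <= w <= u ->
     lam^-1 * ((E - a) + (u - w)) - eps <= d (ze a) (et w)) ->
  (forall v w, 0 <= v <= s -> 0 <= w <= u ->
     lam^-1 * ((s - v) + E + (u - w)) - eps <= d (al v) (et w)) ->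
  exists b : R -> X, [/\ quasi_geodesic d lam eps `[0, s + E + u] b,
    b 0 = al 0, b (s + E + u) = et 0 & b s = al s].
Proof.
move=> lam1 eps0 s0 E0 u0 gal gze get alze zeet h1 h2 h3.
pose b tau := if tau <= s then al tau else
  if tau <= s + E then ze (tau - s) else et (u - (tau - s - E)).
have bal tau : tau <= s -> b tau = al tau by rewrite /b => ->.
have bze tau : s <= tau -> tau <= s + E -> b tau = ze (tau - s).
  move=> st tE; rewrite /b tE; case: (ltgtP tau s) st => // -> _.
  by rewrite subrr.
have bet tau : s + E <= tau -> b tau = et (u - (tau - s - E)).
  rewrite /b => st; have [ts|_] := lerP tau s.
    have [-> E00] : tau = s /\ E = 0 by split; lra.
    have -> : u - (s - s - E) = u by lra.
    by rewrite alze -zeet E00.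
  have [ts|//] := lerP tau (s + E).
  have -> : tau = s + E by lra.
  have -> : s + E - s = E by lra.
  have -> : u - (E - E) = u by lra.
  by rewrite zeet.
have linv1 : lam^-1 <= 1 by rewrite invf_le1 //; lra.
have linv0 : 0 <= lam^-1 by rewrite invr_ge0; lra.
have linvM z : 0 <= z -> lam^-1 * z - eps <= z.
  by move=> z0; have := ler_wpM2r z0 linv1; rewrite mul1r; lra.
have lamM z : 0 <= z -> z <= lam * z + eps.
  by move=> z0; have := ler_wpM2r z0 lam1; rewrite mul1r; lra.
have main x y : 0 <= x -> x <= y -> y <= s + E + u ->
    lam^-1 * (y - x) - eps <= d (b x) (b y) <= y - x.
  move=> x0 xy yT.
  have yx0 : 0 <= y - x by lra.
  have := linvM _ yx0.
  have [xs|sx] := lerP x s.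
    rewrite (bal x xs); have [ys|sy] := lerP y s.
      by rewrite (bal y ys) (geodesic_dist gal) // => ->; rewrite lexx.
    have dxs : d (al x) (al s) = s - x by apply: (geodesic_dist gal).
    have [yE|Ey] := lerP y (s + E).
      rewrite bze //; last exact: ltW.
      move=> _; apply/andP; split.
        have -> : y - x = (s - x) + (y - s) by lra.
        by apply: h1; apply/andP; split; lra.
      have := dist_triangle (al s) (al x) (ze (y - s)).
      by rewrite dxs alze (geodesic_dist gze) //; lra.
    rewrite bet; last exact: ltW.
    move=> _; apply/andP; split.
      have -> : y - x = (s - x) + E + (u - (u - (y - s - E))) by lra.
      by apply: h3; apply/andP; split; lra.
    have := dist_triangle (al s) (al x) (et (u - (y - s - E))).
    have := dist_triangle (et u) (al s) (et (u - (y - s - E))).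
    rewrite dxs alze -{1}zeet (geodesic_dist gze) // (metric_sym (et u)) (geodesic_dist get); lra.
  have [xE|Ex] := lerP x (s + E).
    rewrite (bze x (ltW sx) xE).
    have [yE|Ey] := lerP y (s + E).
      rewrite bze //; last lra.
      by rewrite (geodesic_dist gze) //; lra.
    rewrite bet; last exact: ltW.
    move=> _; apply/andP; split.
      have -> : y - x = (E - (x - s)) + (u - (u - (y - s - E))) by lra.
      by apply: h2; apply/andP; split; lra.
    have := dist_triangle (et u) (ze (x - s)) (et (u - (y - s - E))).
    rewrite -{1}zeet (geodesic_dist gze) ?(metric_sym (et u)) ?(geodesic_dist get); lra.
  rewrite !bet; [|lra|lra].
  by rewrite metric_sym (geodesic_dist get); lra.
exists b; split.
- move=> x y; rewrite !in_itv /= => /andP[x0 xT] /andP[y0 yT].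
  have [xy|yx] := lerP x y.
    have /andP[-> /=] := main x y x0 xy yT.
    by move/le_trans; apply; apply: lamM; lra.
  rewrite metric_sym.
  have /andP[-> /=] := main y x y0 (ltW yx) xT.
  by move/le_trans; apply; apply: lamM; lra.
- by rewrite bal.
- rewrite bet; last lra.
  by congr et; lra.
- by rewrite bal.
Qed.

End Hook.

Section ShortSteps.
Context {R : realType} {X : metricType R}.
Local Notation d := (@mdist R X).
Context (injX : injective_space X).

(** Along a geodesic that leaves [P] at a nearest point, the distance to [P] is
    the time. *)
Lemma nearest_geodesic (P : set X) (x p : X) (c : R -> X) (s : R) :
  nearest P x p -> geodesic d `[0, d p x] c -> c 0 = p -> c (d p x) = x ->
  0 <= s <= d p x -> d (c s) p = s /\ forall q, P q -> s <= d (c s) q.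
Proof.
move=> [Pp xp] geo c0 cL /andP[s0 sL]; split.
  by rewrite metric_sym -{1}c0 (geodesic_dist geo) // subr0.
move=> q Pq; have := xp q Pq; have := dist_triangle (c s) x q.
rewrite (metric_sym x (c s)) -{2}cL (geodesic_dist geo) // (metric_sym x p); lra.
Qed.

(** If the feet [p], [q] of two geodesics [al], [et] leaving [P] are at distance
    [l], and the geodesics come close together at a height comparable to [l],
    then crossing over from [al] to [et] at the first place where their distance
    is at most a quarter of the height gives a quasi-geodesic from [p] to [q].
    That place has height at least [l / 3], and the Morse property bounds it. *)
Lemma rung_bound (P : set X) (M l r : R) (p q x y : X) :
  (forall L b, 0 <= L -> quasi_geodesic d (20 * 20) 10 `[0, L] b ->
     P (b 0) -> P (b L) -> forall t, 0 <= t <= L -> exists2 z, P z & d (b t) z <= M) ->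
  nearest P x p -> nearest P y q -> d p q = l -> d p x = r ->
  r <= 10 * l -> d x y <= r / 5 -> l <= 3 * M + 100.
Proof.
move=> morseP np nq dpq dpx rl dxy.
have [lsmall|lbig] := lerP l 100.
  have [||z Pz] := morseP 0 (fun=> p) (lexx _) _ np.1 np.1 0.
  - move=> s t; rewrite !in_itv /= mdistxx => /andP[s0 s1] /andP[t0 t1].
    have -> : s = t by lra.
    by rewrite subrr normr0 !mulr0; apply/andP; split; lra.
  - by rewrite lexx.
  - by have := mdist_ge0 p z; lra.
set ry := d q y.
have rlow : 33 <= r.
  have := dist_triangle x p q; have := dist_triangle y x q.
  have := nq.2 p np.1; have := dist_triangle x y p.
  by rewrite dpx dpq (metric_sym x p) (metric_sym y x) (metric_sym y q) -/ry; lra.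
have [al [gal al0 alr]] := geodesic_exists injX p x.
have [et [get et0 etr]] := geodesic_exists injX q y.
have hal v : 0 <= v <= r -> d (al v) p = v /\ forall z, P z -> v <= d (al v) z.
  by rewrite -dpx => vr; apply: (nearest_geodesic np).
have het w : 0 <= w <= ry -> d (et w) q = w /\ forall z, P z -> w <= d (et w) z.
  by move=> vr; apply: (nearest_geodesic nq).
have ry0 : 0 <= ry := mdist_ge0 _ _.
rewrite dpx in gal alr; rewrite -/ry in get etr.
have cross v w : 0 <= v <= r -> 0 <= w <= ry ->
    [/\ v - w <= d (al v) (et w), w - v <= d (al v) (et w) & l - v - w <= d (al v) (et w)].
  move=> vr wr; have [dv hv] := hal v vr; have [dw hw] := het w wr.
  have := hv q nq.1; have := hw p np.1.
  have := dist_triangle (et w) (al v) q; have := dist_triangle (al v) (et w) p.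
  have := dist_triangle (al v) p q.
  rewrite dv dw dpq (metric_sym (et w) (al v)) (metric_sym p (al v)) dv => *; split; lra.
(* Integral heights avoid an infimum at the price of an additive error. *)
pose close n := `[< n%:R <= r /\ exists2 u, 0 <= u <= ry & d (al n%:R) (et u) <= n%:R / 4 >].
have exn : exists n, close n.
  exists (Num.truncn r); apply/asboolP.
  have r0 : 0 <= r by lra.
  have := truncn_itv r0; rewrite -natr1; set n : R := (Num.truncn r)%:R => /andP[nr rn].
  have n0 : 0 <= n by rewrite /n ler0n.
  split=> //; exists ry; first by rewrite ry0 lexx.
  rewrite etr; have := dist_triangle x (al n) y.
  by rewrite -{1}alr (geodesic_dist gal) //; lra.
case: (ex_minnP exn) => n /asboolP [nr [u0 u0ry au0]] nmin {exn}.
set s : R := n%:R in nr au0.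
have s0 : 0 <= s by rewrite /s ler0n.
have far v w : 0 <= v <= s -> 0 <= w <= ry -> v / 4 - 2 <= d (al v) (et w).
  move=> /andP[v0 vs] wry; have d0 := mdist_ge0 (al v) (et w).
  have step (m : nat) : (m < n)%N -> m%:R <= v -> v <= m%:R + 1 ->
      v / 4 - 2 <= d (al v) (et w).
    move=> mn mv vm; have m0 : 0 <= m%:R :> R by rewrite ler0n.
    have [//|bad] := lerP (v / 4 - 2) (d (al v) (et w)).
    have /negP [] : ~~ close m by apply/negP => /nmin; rewrite leqNgt mn.
    apply/asboolP; split; first by lra.
    exists w => //; have := dist_triangle (al v) (al m%:R) (et w).
    by rewrite (geodesic_dist gal) //; lra.
  have := truncn_itv v0; rewrite -natr1 => /andP[mv vm].
  have [/step|] := ltnP (Num.truncn v) n; first by apply; lra.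
  move=> nm; have vsE : v = s.
    have : s <= (Num.truncn v)%:R by rewrite /s ler_nat.
    by lra.
  case: n @s nmin {nr au0 s0 vs nm step} vsE (step) => [|k] s _ vsE stepk.
    have v00 : v = 0 by rewrite vsE.
    by lra.
  have vk : v = k%:R + 1 by rewrite vsE /s -natr1.
  by apply: (stepk k) => //; lra.
(* An almost nearest point of [et] makes the corner there a quasi-geodesic. *)
have [||u ury umin] := @approx_min R R [set w | 0 <= w <= ry] (fun w => d (al s) (et w)).
- by exists 0; rewrite /= lexx.
- by move=> w _; exact: mdist_ge0.
move: ury umin => /= /andP[u_0 ury] umin.
set E := d (al s) (et u).
have E0 : 0 <= E by exact: mdist_ge0.
have Es : E <= s / 4 + 1 by have := umin u0 u0ry; rewrite -/E; lra.
have uE : u <= s + E by have [] := cross s u ltac:(by rewrite s0) ltac:(by rewrite u_0); rewrite -/E; lra.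
have ls : l <= 3 * s.
  have [] := cross s u0 ltac:(by rewrite s0) u0ry; lra.
have [ze [gze ze0 zeE]] := geodesic_exists injX (al s) (et u).
rewrite -/E in gze zeE.
have zeal a : 0 <= a <= E -> d (al s) (ze a) = a.
  by move=> /andP[a0 aE]; rewrite -{1}ze0 (geodesic_dist gze) // subr0.
have zeet a : 0 <= a <= E -> d (ze a) (et u) = E - a.
  by move=> /andP[a0 aE]; rewrite -{1}zeE (geodesic_dist gze).
have vr v : 0 <= v <= s -> 0 <= v <= r by move=> /andP[-> /le_trans]; apply.
have wr w : 0 <= w <= u -> 0 <= w <= ry by move=> /andP[-> /le_trans]; apply.
have gal' : geodesic d `[0, s] al.
  move=> v w; rewrite !in_itv /= => vs ws.
  by apply: gal; rewrite in_itv /=; [exact: vr|exact: vr].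
have get' : geodesic d `[0, u] et.
  move=> v w; rewrite !in_itv /= => vs ws.
  by apply: get; rewrite in_itv /=; [exact: wr|exact: wr].
have l4 : (20 * 20 : R)^-1 = 20^-1 / 20 by rewrite invfM.
have h1 v a : 0 <= v <= s -> 0 <= a <= E -> (20 * 20)^-1 * ((s - v) + a) - 10 <= d (al v) (ze a).
  move=> vs aE; have d0 := mdist_ge0 (al v) (ze a); rewrite l4.
  have := dist_triangle (ze a) (al v) (et u); have := far v u vs ltac:(by rewrite u_0).
  have := dist_triangle (ze a) (al v) (al s); rewrite (geodesic_dist gal'); [|lra..].
  by rewrite (metric_sym (ze a) (al s)) zeal // zeet //; lra.
have h2 a w : 0 <= a <= E -> 0 <= w <= u -> (20 * 20)^-1 * ((E - a) + (u - w)) - 10 <= d (ze a) (et w).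
  move=> aE wu; have d0 := mdist_ge0 (ze a) (et w); rewrite l4.
  have := dist_triangle (ze a) (al s) (et w); have := umin w (wr w wu).
  have := dist_triangle (ze a) (et w) (et u).
  rewrite (geodesic_dist get'); [|lra..].
  by rewrite -/E zeal // zeet // (metric_sym (et w) (ze a)); lra.
have h3 v w : 0 <= v <= s -> 0 <= w <= u ->
    (20 * 20)^-1 * ((s - v) + E + (u - w)) - 10 <= d (al v) (et w).
  move=> vs wu; have d0 := mdist_ge0 (al v) (et w); rewrite l4.
  have := far v w vs (wr w wu); have [] := cross v w (vr v vs) (wr w wu); lra.
have [lam1 eps10] : (1 : R) <= 20 * 20 /\ (0 : R) <= 10 by split; lra.
have [b [qgb b0 bT bs]] :=
  hook_quasi_geodesic lam1 eps10 s0 E0 u_0 gal' gze get' (esym ze0) zeE h1 h2 h3.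
have T0 : 0 <= s + E + u by rewrite !addr_ge0.
have Pb0 : P (b 0) by rewrite b0 al0; exact: np.1.
have PbT : P (b (s + E + u)) by rewrite bT et0; exact: nq.1.
have sT : 0 <= s <= s + E + u by rewrite s0 /= -addrA lerDl addr_ge0.
have [z Pz] := morseP _ b T0 qgb Pb0 PbT s sT.
rewrite bs; have [_ /(_ z Pz)] := hal s ltac:(by rewrite s0).
lra.
Qed.

(** After shrinking, points at height [r] over [P] with projections at distance
    [l] are replaced by points at height at most [10 * l], where [rung_bound]
    applies. *)
Lemma short_step_contracting (P : set X) (M : R) :
  (forall L b, 0 <= L -> quasi_geodesic d (20 * 20) 10 `[0, L] b ->
     P (b 0) -> P (b L) -> forall t, 0 <= t <= L -> exists2 z, P z & d (b t) z <= M) ->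
  forall x y p q, nearest P x p -> nearest P y q -> d x y <= d x p / 10 ->
    d p q <= 3 * M + 100.
Proof.
move=> morseP x y p q np nq dxy.
set l := d p q; set r := d x p.
have l0 : 0 <= l by exact: mdist_ge0.
have r0 : 0 <= r by exact: mdist_ge0.
have [rl|lr] := lerP r (10 * l).
  apply: (rung_bound morseP np nq) => //; first by rewrite metric_sym; exact: rl.
  by rewrite (metric_sym p) -/r; have := dxy; rewrite -/r; lra.
have rpos : 0 < r by lra.
(* The fraction that brings the height [r] down to [10 * l]. *)
pose t := 10 * l / r.
have tr : t * r = 10 * l by rewrite /t divfK //; lra.
have t01 : 0 <= t <= 1.
  apply/andP; split; first by apply: divr_ge0 => //; lra.
  by rewrite ler_pdivrMr //; lra.
have [x' [y' [px' x'x qy' y'y x'y']]] := contract_pair injX x y p q t01.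
rewrite -/r -/l tr in px' x'x x'y'.
have nscale u u' w (U : nearest P u w) : d w u' <= t * d u w -> d u' u <= (1 - t) * d u w ->
    nearest P u' w /\ d w u' = t * d u w.
  move=> h1 h2; have tri := dist_triangle u' w u; rewrite (metric_sym w u) in tri.
  have e : d w u' = t * d u w by lra.
  split=> //; split; first exact: U.1.
  move=> z Pz; have := U.2 z Pz; have := dist_triangle u' u z.
  by rewrite (metric_sym u' w) e (metric_sym u u'); lra.
have [np' dpx'] : nearest P x' p /\ d p x' = t * r by apply: nscale; rewrite // -/r tr.
have [nq' _] : nearest P y' q /\ d q y' = t * d y q by apply: nscale.
rewrite tr in dpx'.
apply: (rung_bound morseP np' nq' _ dpx') => //.
have : t * d x y <= t * (r / 10).
  by apply: ler_wpM2l => //; case/andP: t01.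
have : 0 <= t * l by apply: mulr_ge0 => //; case/andP: t01.
rewrite mulrA tr; lra.
Qed.

End ShortSteps.

(** * Strong contraction *)

Section StrongContraction.
Context {R : realType} {X : metricType R}.
Local Notation d := (@mdist R X).

(** Strong contraction in metric form: if two points have projections that are
    more than [D] apart, then the detour through the projections is a geodesic
    up to [D].  It passes to translates and to subsegments more easily than a
    bound on the projections of balls. *)
Definition contracting (D : R) (A : set X) := forall x y p q,
  nearest A x p -> nearest A y q -> D < d p q -> d x p + d p q + d q y <= d x y + D.

Lemma first_failure (Q : nat -> Prop) (n : nat) :
  (forall i, (i < n)%N -> Q i) \/
  exists k, [/\ (k < n)%N, ~ Q k & forall i, (i < k)%N -> Q i].
Proof.
have [[k kP]|none] := pselect (exists k, `[< (k < n)%N /\ ~ Q k >]); last first.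
  left=> i i_n; apply: contrapT => Qi; apply: none.
  by exists i; apply/asboolP.
right; have exk : exists k, `[< (k < n)%N /\ ~ Q k >] by exists k.
case: (ex_minnP exk) => m /asboolP[mn Qm] mmin; exists m; split=> // i im.
apply: contrapT => Qi; suff /mmin : `[< (i < n)%N /\ ~ Q i >] by rewrite leqNgt im.
by apply/asboolP; split=> //; exact: ltn_trans mn.
Qed.

Lemma natS_mulr (i : nat) (w : R) : i.+1%:R * w = i%:R * w + w.
Proof. by rewrite -natr1 mulrDl mul1r. Qed.

Lemma chain_dist (D : R) (w : nat -> X) (n : nat) :
  (forall i, (i < n)%N -> d (w i) (w i.+1) <= D) -> d (w 0%N) (w n) <= n%:R * D.
Proof.
elim: n => [|n IH] h; first by rewrite mdistxx mul0r.
have := IH (fun i i_n => h i (ltnW i_n)); have := h n (ltnSn n).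
have := dist_triangle (w n) (w 0%N) (w n.+1).
by rewrite natS_mulr; lra.
Qed.

Lemma nearest_self (P : set X) p : P p -> nearest P p p.
Proof. by move=> Pp; split=> // q _; rewrite mdistxx; exact: mdist_ge0. Qed.

Lemma geodesic_walk (L : R) (c : R -> X) (a e : R) (u v : R) :
  geodesic d `[0, L] c -> 0 <= a -> a <= e -> e <= L -> 0 <= u -> u <= v ->
  d (c (Num.min (a + u) e)) (c (Num.min (a + v) e)) <= v - u.
Proof.
move=> geo a0 ae eL u0 uv.
rewrite /Num.min; case: ltP => h1; case: ltP => h2;
  rewrite ?(geodesic_dist geo); lra.
Qed.

Context (injX : injective_space X) (P : set X).
Context (exP : forall x, exists p, nearest P x p).

(** Let [sg] be the larger of [d y q] and [d p q].  Pulling [x] towards [p], one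
    may assume that the height of [x] is at most [sg].  Walk from [x] to [y] in
    100 steps of length [sg / 100].  As long as the height is at least [sg / 10],
    each step moves the projection by at most [D].  If the walk comes below this
    height, it does so next to [p], and it has then used up almost all of its
    length, so that [y] is next to [p] too, against the choice of [sg]. *)
Lemma ball_contracting (D : R) :
  (forall x y p q, nearest P x p -> nearest P y q -> d x y <= d x p / 10 -> d p q <= D) ->
  forall x y p q, nearest P x p -> nearest P y q -> d x y <= d x p ->
    d p q <= 10 * (102 * D).
Proof.
move=> short x y p q np nq dxy.
have short0 x0 p0 q0 : nearest P x0 p0 -> nearest P x0 q0 -> d p0 q0 <= D.
  by move=> n1 n2; apply: (short _ _ _ _ n1 n2); rewrite mdistxx divr_ge0 // mdist_ge0.
have D0 : 0 <= D by have := short0 x p p np np; rewrite mdistxx.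
have [//|lbig] := lerP (d p q) (10 * (102 * D)); exfalso.
set l := d p q in lbig; set h := d y q; set sg := Num.max h l.
have [hsg lsg] : h <= sg /\ l <= sg by rewrite /sg !le_max !lexx orbT.
have sgE : sg = h \/ sg = l by rewrite /sg /Num.max; case: ifP; [right|left].
have h0 : 0 <= h by exact: mdist_ge0.
(* The point [x'] of [B(x, d x p - sg)] near both [p] and [y] is at height [sg]. *)
have [x' [np' rsg dx'y]] : exists x', [/\ nearest P x' p, d x' p <= sg & d x' y <= d x' p].
  have [rs|sr] := lerP (d x p) sg; first by exists x.
  have dpy := dist_triangle q p y; rewrite -/l (metric_sym q y) -/h in dpy.
  have [||||||||||x' [xx' px' yx' _]] := balls4_meet injX (x1 := x) (x2 := p) (x3 := y) (x4 := y)
    (r1 := d x p - sg) (r2 := sg) (r3 := sg) (r4 := sg); rewrite ?mdistxx; try lra.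
  have near z : P z -> sg <= d x' z.
    by move=> Pz; have := np.2 z Pz; have := dist_triangle x' x z; lra.
  have sgp := near p np.1; rewrite metric_sym in px'.
  exists x'; split; first split.
  - exact: np.1.
  - by move=> z /near; lra.
  - by [].
  - by rewrite (metric_sym x' y); lra.
have [c [gc c0 cT]] := geodesic_exists injX x' y.
set T := d x' y in gc cT dx'y; set r := d x' p in rsg dx'y.
have T0 : 0 <= T by exact: mdist_ge0.
have [pi piP] := choice exP.
pose z (i : nat) := c (Num.min (0 + i%:R * (sg / 100)) T).
have z0 : z 0%N = x' by rewrite /z mul0r addr0 min_l.
have zN : z 100%N = y.
  rewrite /z min_r ?cT // add0r.
  have -> : 100%:R * (sg / 100) = sg :> R by lra.
  lra.
have sg0 : 0 < sg by lra.
have stepz i : d (z i) (z i.+1) <= sg / 100.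
  have ge0 : 0 <= i%:R * (sg / 100) by rewrite mulr_ge0 // divr_ge0 // ltW.
  apply: le_trans (geodesic_walk (u := i%:R * (sg / 100)) gc (lexx 0) T0 (lexx T) ge0 _) _;
    by rewrite natS_mulr; lra.
have walk k : (forall i, (i < k)%N -> sg / 10 <= d (z i) (pi (z i))) -> (k <= 100)%N ->
    d p (pi (z k)) <= 101 * D.
  move=> high k100; have := @chain_dist D (fun i => pi (z i)) k.
  have := short0 x' p (pi x') np' (piP x').
  have k1 : k%:R * D <= 100 * D by rewrite ler_wpM2r // (ler_nat _ _ 100).
  have := dist_triangle (pi x') p (pi (z k)); rewrite -z0 => h1 h2 h3.
  have := h3 _; suff : forall i, (i < k)%N -> d (pi (z i)) (pi (z i.+1)) <= D.
    by move=> hh /(_ hh); lra.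
  move=> i ik; apply: (short (z i) (z i.+1)); [exact: piP|exact: piP|].
  have := stepz i; have := high i ik; lra.
have [high|[k [k100 low high]]] :=
    first_failure (fun i => sg / 10 <= d (z i) (pi (z i))) 100.
  have := walk 100%N high (leqnn _); rewrite zN.
  have := short0 y (pi y) q (piP y) nq; have := dist_triangle (pi y) p q.
  rewrite -/l; lra.
have {low} low : d (z k) (pi (z k)) < sg / 10 by rewrite ltNge; apply/negP.
have pzk := walk k high (ltnW k100).
have zp : d (z k) p <= sg / 5.
  have := dist_triangle (pi (z k)) (z k) p; rewrite (metric_sym (pi (z k)) p); lra.
have x'z : r - sg / 10 <= d x' (z k).
  have := np'.2 (pi (z k)) (piP (z k)).1; rewrite -/r.
  have := dist_triangle (z k) x' (pi (z k)); lra.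
have zy : d (z k) y <= sg / 10.
  have : d (z k) y = T - d x' (z k).
    rewrite /z; set m := Num.min _ _.
    have m0 : 0 <= m by rewrite /m le_min T0 andbT add0r mulr_ge0 // divr_ge0 // ltW.
    have mT : m <= T by rewrite /m ge_min lexx orbT.
    rewrite -{1}cT -{1}c0 (geodesic_dist gc) // (geodesic_dist gc) //; lra.
  lra.
have py : d p y <= 3 * sg / 10.
  by have := dist_triangle (z k) p y; rewrite (metric_sym p (z k)); lra.
have hs : h <= 3 * sg / 10 by have := nq.2 p np.1; rewrite -/h (metric_sym y p); lra.
have ls : l <= 6 * sg / 10 by have := dist_triangle y p q; rewrite -/l -/h; lra.
by case: sgE => sgE; lra.
Qed.

(** On the part of a geodesic from [x] to [y] that is more than [d x p] away from
    [x] and more than [d y q] away from [y], walk in steps of length [2 * D].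
    While the height is at least [2 * D], the projection moves at most half as
    fast as the walk, which is too slow to get from [p] to [q].  So the walk
    comes close to [P], and where it first does so, it is close to [p]. *)
Lemma contracting_half (D : R) : 0 < D ->
  (forall x y p q, nearest P x p -> nearest P y q -> d x y <= d x p -> d p q <= D) ->
  forall x y p q, nearest P x p -> nearest P y q -> 6 * D < d p q ->
    d x p + d p y <= d x y + 12 * D.
Proof.
move=> D0 ballc x y p q np nq lbig.
have [c [gc c0 cT]] := geodesic_exists injX x y.
set T := d x y in gc cT *; set l := d p q in lbig; set rx := d x p; set ry := d y q.
have T0 : 0 <= T by exact: mdist_ge0.
have rx0 : 0 <= rx by exact: mdist_ge0.
have ry0 : 0 <= ry by exact: mdist_ge0.
have [pi piP] := choice exP.
have TW : rx + ry < T.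
  rewrite ltNge; apply/negP => Tle.
  have [Try|ryT] := lerP T ry.
    have := ballc y x q p nq np; rewrite -/ry (metric_sym y x) -/T (metric_sym q p) -/l.
    by move/(_ Try); lra.
  have dxm : d x (c (T - ry)) = T - ry by rewrite -{1}c0 (geodesic_dist gc); lra.
  have dym : d y (c (T - ry)) = ry by rewrite metric_sym -{1}cT (geodesic_dist gc); lra.
  have := ballc x _ p _ np (piP (c (T - ry))); rewrite dxm => /(_ ltac:(rewrite -/rx; lra)).
  have := ballc y _ q _ nq (piP (c (T - ry))); rewrite dym => /(_ (lexx _)).
  have := dist_triangle (pi (c (T - ry))) p q.
  by rewrite (metric_sym q) -/l; lra.
have lW : T - rx - ry <= l.
  have := dist_triangle p x y; have := dist_triangle q p y.
  by rewrite -/T -/rx -/l (metric_sym q y) -/ry; lra.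
pose K := 2 * D; have K0 : 0 < K by rewrite /K; lra.
pose z (i : nat) := c (Num.min (rx + i%:R * K) (T - ry)).
have dz0 : d x (z 0%N) = rx.
  by rewrite /z mul0r addr0 min_l ?(ltW _) -?{1}c0 ?(geodesic_dist gc); lra.
have stepz i : d (z i) (z i.+1) <= K.
  have ge0 : 0 <= i%:R * K by rewrite mulr_ge0 // ltW.
  apply: le_trans (geodesic_walk (a := rx) (u := i%:R * K) gc rx0 _ _ ge0 _) _;
    by rewrite ?natS_mulr; lra.
pose n := (Num.truncn ((T - rx - ry) / K)).+1.
have /andP[] : n.-1%:R <= (T - rx - ry) / K < n%:R.
  by apply: truncn_itv; rewrite divr_ge0 //; lra.
rewrite ler_pdivlMr // ltr_pdivrMr // => nK1 nK2.
have zn : z n = c (T - ry) by rewrite /z min_r //; lra.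
have walk k : (forall i, (i < k)%N -> K <= d (z i) (pi (z i))) ->
    d p (pi (z k)) <= D + k%:R * K / 2.
  move=> high; have := @chain_dist D (fun i => pi (z i)) k.
  have := ballc x (z 0%N) p _ np (piP _); rewrite dz0 => /(_ (lexx _)).
  have := dist_triangle (pi (z 0%N)) p (pi (z k)) => h1 h2 h3.
  have /h3 : forall i, (i < k)%N -> d (pi (z i)) (pi (z i.+1)) <= D.
    move=> i ik; apply: (ballc (z i) (z i.+1)); [exact: piP|exact: piP|].
    exact: le_trans (stepz i) (high i ik).
  by rewrite /K mulrCA; lra.
have [high|[k [kn low high]]] := first_failure (fun i => K <= d (z i) (pi (z i))) n.
  have := walk n high; rewrite zn.
  have dym : d y (c (T - ry)) = ry by rewrite metric_sym -{1}cT (geodesic_dist gc); lra.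
  have := ballc y _ q _ nq (piP (c (T - ry))); rewrite dym => /(_ (lexx _)).
  have := dist_triangle (pi (c (T - ry))) p q; rewrite (metric_sym q) -/l.
  have : n%:R * K <= T - rx - ry + K by move: nK1; rewrite -[in X in _ -> X]natr1 mulrDl mul1r /=; lra.
  by rewrite /K; lra.
have {low} low : d (z k) (pi (z k)) < K by rewrite ltNge; apply/negP.
have kK : k%:R * K <= T - rx - ry.
  by apply: le_trans nK1; rewrite ler_pM2r // ler_nat.
have kK0 : 0 <= k%:R * K by rewrite mulr_ge0 // ltW.
have zkE : z k = c (rx + k%:R * K) by rewrite /z min_l //; lra.
have dxz : d x (z k) = rx + k%:R * K by rewrite zkE -{1}c0 (geodesic_dist gc); lra.
have dzy : d (z k) y = T - (rx + k%:R * K) by rewrite zkE -{1}cT (geodesic_dist gc); lra.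
have := walk k high.
have := dist_triangle (pi (z k)) x (z k); have := dist_triangle p x (pi (z k)).
rewrite dxz -/rx (metric_sym (pi (z k)) (z k)) => h1 h2 h3.
have g4 : d p (pi (z k)) <= 4 * D by rewrite /K in low *; lra.
have := dist_triangle (z k) p y; have := dist_triangle (pi (z k)) p (z k).
rewrite (metric_sym (pi (z k)) (z k)) dzy => h4 h5.
have KE : K = 2 * D by [].
by lra.
Qed.

Lemma ball_contracting_strong (D : R) : 0 < D ->
  (forall x y p q, nearest P x p -> nearest P y q -> d x y <= d x p -> d p q <= D) ->
  contracting (24 * D) P.
Proof.
move=> D0 ballc x y p q np nq lbig.
have := contracting_half D0 ballc np nq ltac:(lra).
have := contracting_half D0 ballc nq (nearest_self np.1).
rewrite (metric_sym q p) (metric_sym y p) (metric_sym y q) => /(_ ltac:(lra)); lra.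
Qed.

End StrongContraction.

(** * Finite segments of a contracting sequence *)

Section Segments.
Context {R : realType} {X : metricType R}.
Local Notation d := (@mdist R X).

Lemma argmin_itv (f : nat -> R) (s t : nat) : (s <= t)%N ->
  exists2 n, (s <= n <= t)%N & forall m, (s <= m <= t)%N -> f n <= f m.
Proof.
move=> st; rewrite -(subnKC st); elim: (t - s)%N => [|k [n nk nmin]].
  by exists s => [|m ms]; [lia|have -> : m = s by lia].
have [h|h] := lerP (f n) (f (s + k.+1)%N).
  exists n => [|m ms]; first lia.
  by have [->//|ne] := eqVneq m (s + k.+1)%N; apply: nmin; lia.
exists (s + k.+1)%N => [|m ms]; first lia.
have [->//|ne] := eqVneq m (s + k.+1)%N.
by apply: le_trans (ltW h) _; apply: nmin; lia.
Qed.

Definition seg (p : nat -> X) (s t : nat) : set X := p @` [set n | (s <= n <= t)%N].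

Lemma nearest_seg (p : nat -> X) s t x : (s <= t)%N ->
  exists2 n, (s <= n <= t)%N & nearest (seg p s t) x (p n).
Proof.
move=> st; have [n ns nmin] := argmin_itv (fun n => d x (p n)) st.
by exists n => //; split; [exists n|move=> _ [m ms <-]; exact: nmin].
Qed.

Lemma clamp_order s t m n (cl := fun m => maxn s (minn m t)) : (s <= t)%N -> cl m != cl n ->
  (m <= cl m <= cl n)%N && (cl m <= cl n <= n)%N \/
  (n <= cl n <= cl m)%N && (cl n <= cl m <= m)%N.
Proof. rewrite /cl => st ne; lia. Qed.

Context (p : nat -> X) (Lam M : R).
Context (Lam0 : 0 <= Lam) (M0 : 0 <= M).
Context (pstep : forall n, d (p n) (p n.+1) <= Lam).
Context (plow : forall m n, (m <= n)%N -> (n - m)%:R <= Lam * d (p m) (p n) + Lam).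

Lemma seq_lipschitz m n : (m <= n)%N -> d (p m) (p n) <= (n - m)%:R * Lam.
Proof.
move=> mn; have := @chain_dist _ _ Lam (fun k => p (m + k)%N) (n - m) _.
rewrite addn0 subnKC //; apply => i _; rewrite addnS; exact: pstep.
Qed.

Lemma nearest_range x : exists q, nearest (range p) x q.
Proof.
pose B := Lam * (2 * d x (p 0%N)) + Lam.
have [n _ nmin] := argmin_itv (fun n => d x (p n)) (leq0n (Num.truncn B)).
exists (p n); split; first by exists n.
move=> _ [m _ <-]; have [mB|Bm] := leqP m (Num.truncn B); first exact: nmin.
apply: le_trans (nmin 0%N _) _; first by rewrite leq0n.
rewrite leNgt; apply/negP => bad.
have h1 : d (p 0%N) (p m) <= 2 * d x (p 0%N).
  by have := dist_triangle x (p 0%N) (p m); rewrite (metric_sym (p 0%N) x); lra.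
have := plow (leq0n m); have := ler_wpM2l Lam0 h1; rewrite subn0 => h2 h3.
have B0 : 0 <= B by rewrite addr_ge0 // mulr_ge0 // mulr_ge0 // mdist_ge0.
have := truncn_itv B0 => /andP[_]; apply/negP; rewrite -leNgt.
have := ler_nat R (Num.truncn B).+1 m; rewrite Bm /B => h4.
by apply: le_trans h4 _; lra.
Qed.

Context (injX : injective_space X).
Context (pgeo : forall L c i j t, geodesic d `[0, L] c -> c 0 = p i -> c L = p j ->
  0 <= t <= L -> exists k, d (c t) (p k) <= M).

(** A geodesic from [p i] to [p j] stays near the sequence, so the indices of
    nearby points of the sequence go from [i] to [j] by bounded jumps, and the
    geodesic passes near every [p m] in between. *)
Lemma bounded_backtrack : exists2 Q, 0 <= Q & forall i m j, (i <= m <= j)%N ->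
  d (p i) (p m) + d (p m) (p j) <= d (p i) (p j) + Q.
Proof.
pose W := (Lam * (2 * M + 1) + Lam) * Lam.
have := M0 => M0_.
have M1 : 0 <= 2 * M + 1 by lra.
have W0 : 0 <= W by apply: mulr_ge0 => //; apply: addr_ge0 => //; exact: mulr_ge0.
exists (2 * (M + W)); first by lra.
move=> i m j /andP[im mj]; have [->|ne] := eqVneq i m.
  by rewrite mdistxx; lra.
have [c [gc c0 cL]] := geodesic_exists injX (p i) (p j).
set L := d (p i) (p j) in gc cL *; have L0 : 0 <= L by exact: mdist_ge0.
have [k kP] : exists k : R -> nat, forall t, 0 <= t <= L -> d (c t) (p (k t)) <= M.
  have [|k kP] := @choice _ _ (fun t k => 0 <= t <= L -> d (c t) (p k) <= M); last by exists k.
  move=> t; have [tL|tL] := pselect (0 <= t <= L).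
    by have [k kM] := pgeo gc c0 cL tL; exists k.
  by exists 0%N => /tL.
pose N := (Num.truncn L).+1; pose t (a : nat) := Num.min a%:R L.
have t0L a : 0 <= t a <= L by rewrite /t le_min ler0n L0 /= ge_min lexx orbT.
pose idx a := if a == 0%N then i else if a == N then j else k (t a).
have idxP a : d (c (t a)) (p (idx a)) <= M.
  rewrite /idx; case: eqP => [->|_]; first by rewrite /t min_l // c0 mdistxx.
  case: eqP => [->|_]; last exact: kP.
  rewrite /t min_r ?cL ?mdistxx //.
  by have /andP[_ /ltW] := truncn_itv L0.
have [all|[a [aN]]] := first_failure (fun a => (idx a < m)%N) N.+1.
  by have := all N (ltnSn _); rewrite /idx eqxx /= ltnNge mj.
move=> /negP; rewrite -leqNgt.
case: a aN => [_|b bN mb early]; first by rewrite /idx eqxx => mi; move: ne; rewrite eqn_leq im mi.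
have bm := early b (ltnSn b).
have stepb : d (c (t b)) (c (t b.+1)) <= 1.
  have := geodesic_walk (a := 0) (u := b%:R) (v := b.+1%:R) gc (lexx 0) L0 (lexx L).
  rewrite !add0r -natr1 ler0n => /(_ isT); rewrite /t -natr1; lra.
have close : d (p (idx b)) (p (idx b.+1)) <= 2 * M + 1.
  have := idxP b; have := idxP b.+1.
  have := dist_triangle (c (t b)) (p (idx b)) (p (idx b.+1)).
  have := dist_triangle (c (t b.+1)) (c (t b)) (p (idx b.+1)).
  by rewrite (metric_sym (p (idx b)) (c (t b))); lra.
have mW : d (p m) (p (idx b.+1)) <= W.
  apply: le_trans (seq_lipschitz mb) _; apply: ler_wpM2r => //.
  have := plow (ltnW (leq_trans bm mb)); have := ler_wpM2l Lam0 close.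
  have : (idx b.+1 - m)%:R <= (idx b.+1 - idx b)%:R :> R by rewrite ler_nat; lia.
  by lra.
have cm : d (c (t b.+1)) (p m) <= M + W.
  have := dist_triangle (p (idx b.+1)) (c (t b.+1)) (p m); have := idxP b.+1.
  by rewrite (metric_sym (p (idx b.+1)) (p m)); lra.
have /andP[tb0 tbL] := t0L b.+1.
have e1 : d (p i) (c (t b.+1)) = t b.+1 by rewrite -c0 (geodesic_dist gc) // subr0.
have e2 : d (c (t b.+1)) (p j) = L - t b.+1 by rewrite -cL (geodesic_dist gc).
have := dist_triangle (c (t b.+1)) (p i) (p m); have := dist_triangle (c (t b.+1)) (p m) (p j).
by rewrite e1 e2 (metric_sym (p m) (c _)); lra.
Qed.

(** The projection to a segment is the projection to the whole sequence followed
    by clamping the index between [s] and [t]. *)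
Lemma segment_contracting (D Q : R) : 0 <= D -> 0 <= Q ->
  (forall i m j, (i <= m <= j)%N -> d (p i) (p m) + d (p m) (p j) <= d (p i) (p j) + Q) ->
  contracting D (range p) ->
  forall s t, (s <= t)%N -> contracting (3 * D + 4 * Q) (seg p s t).
Proof.
move=> D0 Q0 bt ctr s t st x y p' q' [[i1 i1P <-{p'}] np] [[i2 i2P <-{q'}] nq] big.
have bt' i m j : (i <= m <= j)%N \/ (j <= m <= i)%N ->
    d (p i) (p m) + d (p m) (p j) <= d (p i) (p j) + Q.
  move=> [/bt //|/bt]; rewrite (metric_sym (p j) (p m)) (metric_sym (p m) (p i)).
  by rewrite (metric_sym (p j) (p i)); lra.
pose cl m := maxn s (minn m t).
have proj z m i : nearest (range p) z (p m) -> (s <= i <= t)%N ->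
    d z (p m) + d (p m) (p (cl m)) + d (p (cl m)) (p i) <= d z (p i) + (D + Q).
  move=> nm it.
  have := bt' m (cl m) i; rewrite /cl => /(_ ltac:(lia)) h1.
  have [small|Dbig] := lerP (d (p m) (p i)) D.
    by have := nm.2 (p i) (ex_intro2 _ _ i I erefl); lra.
  have := ctr z (p i) (p m) (p i) nm
    (nearest_self (ex_intro2 _ _ i I erefl)) Dbig.
  by rewrite mdistxx; lra.
have [_ [[m _ <-] nm]] := nearest_range x; have [_ [[n _ <-] nn]] := nearest_range y.
have {}nm : nearest (range p) x (p m) by split=> //; exists m.
have {}nn : nearest (range p) y (p n) by split=> //; exists n.
have clst k : (s <= cl k <= t)%N by rewrite /cl; lia.
have jx := np _ (ex_intro2 _ _ (cl m) (clst m) erefl).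
have jy := nq _ (ex_intro2 _ _ (cl n) (clst n) erefl).
have E1 : d (p (cl m)) (p i1) <= D + Q.
  by have := proj x m i1 nm i1P; have := dist_triangle (p m) x (p (cl m)); lra.
have E2 : d (p (cl n)) (p i2) <= D + Q.
  by have := proj y n i2 nn i2P; have := dist_triangle (p n) y (p (cl n)); lra.
have jk : d (p i1) (p i2) <= d (p (cl m)) (p (cl n)) + 2 * (D + Q).
  have := dist_triangle (p (cl m)) (p i1) (p i2).
  have := dist_triangle (p (cl n)) (p (cl m)) (p i2).
  by rewrite (metric_sym (p i1) (p (cl m))); lra.
have ord : (m <= cl m <= cl n)%N && (cl m <= cl n <= n)%N \/
           (n <= cl n <= cl m)%N && (cl n <= cl m <= m)%N.
  have ne : cl m != cl n.
    by apply/eqP => e; move: jk; rewrite e mdistxx; lra.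
  exact: clamp_order.
have mn : d (p m) (p (cl m)) + d (p (cl m)) (p (cl n)) + d (p (cl n)) (p n) <=
    d (p m) (p n) + 2 * Q.
  have h1 : d (p m) (p (cl m)) + d (p (cl m)) (p n) <= d (p m) (p n) + Q.
    apply: bt'; case: ord => /andP[/andP[a b] /andP[c e]]; [left|right]; rewrite ?a ?e ?c //=.
      exact: leq_trans e.
    by rewrite (leq_trans a).
  have h2 : d (p (cl m)) (p (cl n)) + d (p (cl n)) (p n) <= d (p (cl m)) (p n) + Q.
    by apply: bt'; case: ord => /andP[/andP[a b] /andP[c e]]; [left|right]; rewrite ?a ?b ?c ?e.
  by lra.
have d1 := mdist_ge0 (p m) (p (cl m)); have d2 := mdist_ge0 (p n) (p (cl n)).
rewrite (metric_sym (p (cl n)) (p n)) in mn.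
have := ctr x y _ _ nm nn ltac:(lra).
have := dist_triangle (p m) x (p (cl m)); have := dist_triangle (p n) y (p (cl n)).
rewrite (metric_sym (p n) y) (metric_sym (p i2) y); lra.
Qed.

End Segments.

(** * The Cayley graph and the orbit map *)

Section FiniteBounds.
Context {R : realType}.

Lemma finite_upper_bound (T : choiceType) (A : set T) (f : T -> R) :
  finite_set A -> exists2 B, 0 <= B & forall a, A a -> f a <= B.
Proof.
move=> /finite_seqP[s ->]; elim: s => [|x s [B B0 IH]]; first by exists 0.
exists (Num.max B (f x)); first by rewrite le_max B0.
move=> a; rewrite /= inE => /orP[/eqP ->|/IH]; first by rewrite le_max lexx orbT.
by rewrite le_max => ->.
Qed.

End FiniteBounds.

Section WordMetric.
Context {R : realType} {G : groupType} (S : set G).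
Local Notation wd := (word_dist R S).

Lemma word_distM (x y z : G) : wd (z * x)%g (z * y)%g = wd x y.
Proof. by rewrite /word_dist invgM -mulgA mulKg. Qed.

Lemma word_dist_le (x y : G) w : words S (x^-1 * y)%g w -> wd x y <= (size w)%:R.
Proof.
move=> wP; apply: ge_inf; last by exists w.
by exists 0 => _ [v _ <-].
Qed.

Lemma word_dist_cayley_edge (x s : G) : S s ->
  wd x (x * s)%g <= 1 /\ wd (x * s)%g x <= 1.
Proof.
move=> Ss; split.
  apply: (@word_dist_le _ _ [:: s]); rewrite mulKg; split; last by rewrite big_seq1.
  by move=> t; rewrite inE => /eqP ->; left.
apply: (@word_dist_le _ _ [:: s^-1%g]); rewrite invgM -mulgA mulVg mulg1; split; last by rewrite big_seq1.
by move=> t; rewrite inE => /eqP ->; right; rewrite invgK.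
Qed.

Lemma word_distxx x : wd x x <= 0.
Proof.
by apply: (@word_dist_le _ _ [::]); rewrite mulVg; split; rewrite ?big_nil.
Qed.

Context (genS : generates S).

Lemma word_dist_ge (x y : G) (r : R) :
  (forall w, words S (x^-1 * y)%g w -> r <= (size w)%:R) -> r <= wd x y.
Proof.
move=> h; apply: lb_le_inf => [|_ [w wP <-]]; last exact: h.
by have [w wP] := genS (x^-1 * y)%g; exists (size w)%:R, w.
Qed.

Lemma word_dist_ge0 x y : 0 <= wd x y.
Proof. by apply: word_dist_ge => w _. Qed.

Lemma word_dist_triangle (y x z : G) : wd x z <= wd x y + wd y z.
Proof.
rewrite -lerBlDr; apply: word_dist_ge => v [vS vE].
rewrite lerBlDr -lerBlDl; apply: word_dist_ge => w [wS wE].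
rewrite lerBlDr -natrD addnC -size_cat; apply: word_dist_le; split.
  by move=> s; rewrite mem_cat => /orP[/vS|/wS].
by rewrite big_cat /= vE wE -mulgA mulVKg.
Qed.

(** Only the sources of the edges matter at large scale, which removes the
    geometric realization from all later arguments. *)
Lemma cayley_dist_bounds (p q : cayley_point R S) :
  wd (cp_src p) (cp_src q) - 2 <= cayley_dist p q <= wd (cp_src p) (cp_src q) + 2.
Proof.
have ends (r : cayley_point R S) u : cp_ends r u ->
    [/\ 0 <= u.2, wd (cp_src r) u.1 <= 1 & wd u.1 (cp_src r) <= 1].
  have /andP[p0 p1] := cp_posP r.
  have [e1 e2] := word_dist_cayley_edge (cp_src r) (cp_labelP r).
  have e0 := word_distxx (cp_src r).
  by case=> -> /=; split => //; lra.
rewrite /cayley_dist; set A := (X in inf X).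
have lb : lbound A (wd (cp_src p) (cp_src q) - 2).
  move=> _ [[u up] [v vq] <-|[sE _ ->]].
    have [u0 pu _] := ends _ _ up; have [v0 _ vq'] := ends _ _ vq.
    have := word_dist_triangle u.1 (cp_src p) (cp_src q).
    have := word_dist_triangle v.1 u.1 (cp_src q); lra.
  by have := word_distxx (cp_src p); have := normr_ge0 (cp_pos p - cp_pos q); rewrite {2}sE; lra.
have A0 : A ((cp_src p, cp_pos p).2 + wd (cp_src p, cp_pos p).1 (cp_src q, cp_pos q).1
     + (cp_src q, cp_pos q).2).
  by left; exists (cp_src p, cp_pos p); [left|exists (cp_src q, cp_pos q); [left|]].
apply/andP; split.
  by apply: lb_le_inf lb; eexists; exact: A0.
apply: le_trans (ge_inf _ A0) _; first by eexists; exact: lb.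
by have /andP[_] := cp_posP p; have /andP[_] := cp_posP q; rewrite /=; lra.
Qed.

End WordMetric.

Section OrbitMap.
Context {R : realType} {G : groupType} {X : metricType R} (act : G -> X -> X).
Local Notation d := (@mdist R X).
Context (act_isom : isometric_action act).

Lemma act1 x : act 1%g x = x. Proof. by case: act_isom. Qed.
Lemma actM g h x : act (g * h)%g x = act g (act h x). Proof. by case: act_isom. Qed.
Lemma act_dist g x y : d (act g x) (act g y) = d x y. Proof. by case: act_isom. Qed.
Lemma actK g x : act g^-1%g (act g x) = x. Proof. by rewrite -actM mulVg act1. Qed.
Lemma actKV g x : act g (act g^-1%g x) = x. Proof. by rewrite -actM mulgV act1. Qed.

Lemma act_distl g x y : d (act g x) y = d x (act g^-1%g y).
Proof. by rewrite -(act_dist g^-1%g) actK. Qed.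

Lemma orbit_dist g h x : d (act g x) (act h x) = d x (act (g^-1 * h)%g x).
Proof. by rewrite act_distl actM. Qed.

Context (act_proper : proper_action act).

Lemma orbit_ball_finite (o : X) (r : R) : finite_set [set g | d o (act g o) <= r].
Proof.
have [r0|r0] := lerP 0 r; last first.
  rewrite (_ : mkset _ = set0) //; apply/seteqP; split => g //=.
  by have := mdist_ge0 o (act g o); lra.
apply: sub_finite_set (act_proper o r) => g /= gr.
exists (act g o); split; first exact: gr.
by exists o; rewrite /cball /= ?mdistxx.
Qed.

Context (act_cobounded : cobounded_action act) (o : X).

Lemma orbit_dense : exists2 C, 0 <= C & forall x, exists g, d x (act g o) <= C.
Proof.
have [p _ [C CP]] := act_cobounded.
exists (Num.max C 0 + d p o) => [|x].
  by rewrite addr_ge0 ?mdist_ge0 // le_max lexx orbT.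
have [g _ gC] := CP x I; exists g.
have := dist_triangle (act g p) x (act g o); rewrite act_dist.
have : C <= Num.max C 0 by rewrite le_max lexx.
lra.
Qed.

Context (injX : injective_space X).
Context (S : set G) (finS : finite_set S) (genS : generates S).
Local Notation wd := (word_dist R S).

Lemma orbit_word_dist_le : exists2 K, 1 <= K & forall x y, d (act x o) (act y o) <= K * wd x y.
Proof.
have [K K0 KP] := finite_upper_bound (fun s => d o (act s o)) finS.
exists (1 + K) => [|x y]; first lra.
have Kpos : 0 < 1 + K by lra.
rewrite mulrC -ler_pdivrMr //; apply: word_dist_ge => // w [wS wE].
rewrite ler_pdivrMr // orbit_dist -wE; elim: w wS {wE} => [_|s w IH wS].
  by rewrite big_nil act1 mdistxx mul0r.
rewrite big_cons actM /= natS_mulr.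
have := dist_triangle (act s o) o (act s (act (\prod_(j <- w) j)%g o)); rewrite act_dist.
have := IH (fun t tw => wS t (mem_behead (s := s :: w) tw)).
suff : d o (act s o) <= K by lra.
have [/KP //|/KP] := wS s (mem_head _ _).
by rewrite metric_sym act_distl invgK.
Qed.

(** Cut a geodesic of [X] into unit pieces and replace the cut points by nearby
    orbit points: successive group elements differ by one of the finitely many
    elements that move [o] by a bounded amount. *)
Lemma word_dist_orbit_le : exists2 K, 1 <= K &
  forall x y, wd x y <= K * d (act x o) (act y o) + K.
Proof.
have [C C0 CP] := orbit_dense.
have [K K0 KP] := finite_upper_bound (fun g => wd 1%g g) (orbit_ball_finite o (1 + 2 * C)).
exists (1 + K) => [|x y]; first lra.
have [c [gc c0 cL]] := geodesic_exists injX (act x o) (act y o).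
set L := d _ _ in gc cL *; have L0 : 0 <= L by exact: mdist_ge0.
have [f fP] := choice (fun t : R => CP (c t)).
pose N := (Num.truncn L).+1; pose t (a : nat) := Num.min a%:R L.
pose g a := if a == 0%N then x else if a == N then y else f (t a).
have /andP[NL LN] := truncn_itv L0.
have gP a : d (c (t a)) (act (g a) o) <= C.
  rewrite /g; case: eqP => [->|_]; first by rewrite /t min_l // c0 mdistxx.
  by case: eqP => [->|_] //; rewrite /t min_r ?cL ?mdistxx // ltW.
have step a : wd (g a) (g a.+1) <= K.
  rewrite -[g a](mulg1 (g a)) -(mulVKg (g a) (g a.+1)) word_distM; apply: KP => /=.
  rewrite -orbit_dist.
  have := geodesic_walk (a := 0) (u := a%:R) (v := a.+1%:R) gc (lexx 0) L0 (lexx L).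
  rewrite !add0r ler0n ler_nat leqnSn -/(t a) -/(t a.+1) => /(_ isT isT).
  rewrite -natr1.
  have := dist_triangle (c (t a)) (act (g a) o) (act (g a.+1) o).
  have := dist_triangle (c (t a.+1)) (c (t a)) (act (g a.+1) o).
  have := gP a; have := gP a.+1; rewrite (metric_sym (act (g a) o) (c _)); lra.
have chain n : wd (g 0%N) (g n) <= n%:R * K.
  elim: n => [|n IH]; first by rewrite mul0r; exact: word_distxx.
  by have := word_dist_triangle (R := R) genS (g n) (g 0%N) (g n.+1); have := step n; rewrite natS_mulr; lra.
have := chain N; rewrite {1 2}/g /= eqxx.
have : (Num.truncn L)%:R * K <= L * K by apply: ler_wpM2r.
by rewrite /N natS_mulr mulrDl mul1r (mulrC K L); lra.
Qed.

End OrbitMap.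

Section MorseOrbit.
Context {R : realType} {G : groupType} {X : metricType R} (act : G -> X -> X).
Local Notation d := (@mdist R X).
Context (act_isom : isometric_action act) (act_proper : proper_action act).
Context (act_cobounded : cobounded_action act) (injX : injective_space X).

(** A quasi-geodesic of [X] is shadowed by vertices of the Cayley graph.  The
    shadow is a quasi-geodesic because the orbit map is a quasi-isometry; its
    two endpoints are replaced by the actual points of the Morse ray. *)
Theorem morse_orbit_seq (o : X) : contains_morse_ray R G ->
  exists (g : nat -> G) (Lam : R), let p n := act (g n) o in
  [/\ 1 <= Lam, forall n, d (p n) (p n.+1) <= Lam,
      forall m n, (m <= n)%N -> (n - m)%:R <= Lam * d (p m) (p n) + Lam &
      forall lam eps, 1 <= lam -> 0 <= eps -> exists2 M, 0 <= M &
        forall L b, 0 <= L -> quasi_geodesic d lam eps `[0, L] b ->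
          range p (b 0) -> range p (b L) -> forall t, 0 <= t <= L ->
          exists2 z, range p z & d (b t) z <= M].
Proof.
move=> [S [finS genS [c cgeo [M [M0 MP]]]]].
have [K1 K1_1 K1P] := orbit_word_dist_le act_isom o finS genS.
have [K2 K2_1 K2P] := word_dist_orbit_le act_isom act_proper act_cobounded o injX genS.
have [C C0 CP] := orbit_dense act_isom act_cobounded o.
pose K := K1 + K2; have K1' : 1 <= K by rewrite /K; lra.
have KP1 x y : d (act x o) (act y o) <= K * word_dist R S x y.
  apply: le_trans (K1P x y) _; apply: ler_wpM2r; first exact: word_dist_ge0.
  by rewrite /K; lra.
have KP2 x y : word_dist R S x y <= K * d (act x o) (act y o) + K.
  apply: le_trans (K2P x y) _; apply: lerD; last by rewrite /K; lra.
  by apply: ler_wpM2r; [exact: mdist_ge0|rewrite /K; lra].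
have cd s t : 0 <= s -> 0 <= t -> cayley_dist (c s) (c t) = `|s - t|.
  by move=> s0 t0; apply: cgeo; rewrite in_itv /= ?s0 ?t0.
have cb (p q : cayley_point R S) := cayley_dist_bounds genS p q.
pose g (n : nat) := cp_src (c n%:R).
have gw m n : (m <= n)%N -> (n - m)%:R - 2 <= word_dist R S (g m) (g n) <= (n - m)%:R + 2.
  move=> mn; have /andP[h1 h2] := cb (c m%:R) (c n%:R).
  rewrite cd // distrC ger0_norm ?subr_ge0 ?ler_nat // -natrB // in h1 h2.
  by rewrite /g; lra.
exists g, (3 * K); split.
- lra.
- move=> n; apply: le_trans (KP1 _ _) _; rewrite mulrC; apply: ler_wpM2r; first lra.
  by have /andP[_] := gw n n.+1 (leqnSn n); rewrite subSnn; lra.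
- move=> m n mn; have /andP[h _] := gw m n mn.
  have := KP2 (g m) (g n); have := mdist_ge0 (act (g m) o) (act (g n) o).
  move=> d0 h2; have : 0 <= K * d (act (g m) o) (act (g n) o) by rewrite mulr_ge0 //; lra.
  by lra.
move=> lam eps lam1 eps0.
pose lam' := K * lam; pose eps' := K * (eps + 2 * C) + K + 2.
have lam'0 : 0 < lam' by rewrite /lam' mulr_gt0; lra.
have E0 : 0 <= K * (eps + 2 * C) by rewrite mulr_ge0; lra.
have eps'0 : 0 <= eps' by rewrite /eps'; lra.
exists (C + K * (M lam' eps' + 5)).
  by rewrite addr_ge0 // mulr_ge0 ?addr_ge0 //; lra.
move=> L b L0 qb [m _ bm] [n _ bn] t tL.
have [f fP] := choice (fun s : R => CP (b s)).
have pos00 : 0 <= (0 : R) <= 1 by apply/andP; split; lra.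
(* A vertex is a point at position 0 on any edge; the label of [c 0] provides one. *)
pose be s := if s == 0 then c m%:R else if s == L then c n%:R else
  CayleyPoint (f s) (cp_labelP (c 0)) pos00.
have be0 : be 0 = c m%:R by rewrite /be eqxx.
have beH s : 0 <= s <= L -> d (b s) (act (cp_src (be s)) o) <= C.
  move=> sL; rewrite /be; case: eqP => [->|_]; first by rewrite -bm mdistxx.
  by case: eqP => [->|_] //; rewrite -bn mdistxx.
have Y0 k : (c @` `[0, +oo[) (c k%:R) by exists k%:R => //; rewrite /= in_itv /= ler0n.
have YL : (c @` `[0, +oo[) (be L) by rewrite /be; case: eqP => // _; rewrite eqxx.
have qbe : quasi_geodesic (@cayley_dist R G S) lam' eps' `[0, L] be.
  move=> s u sI uI; have := qb s u sI uI; rewrite !in_itv /= in sI uI => /andP[q1 q2].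
  have bs := beH s sI; have bu := beH u uI.
  have /andP[c1 c2] := cb (be s) (be u).
  have := KP1 (cp_src (be s)) (cp_src (be u)); have := KP2 (cp_src (be s)) (cp_src (be u)).
  set D := d (act _ o) (act _ o); set W := word_dist _ _ _ _ => h2 h1.
  have D1 : D <= d (b s) (b u) + 2 * C.
    have := dist_triangle (b s) (act (cp_src (be s)) o) (act (cp_src (be u)) o).
    have := dist_triangle (b u) (b s) (act (cp_src (be u)) o).
    by rewrite -/D (metric_sym (act (cp_src (be s)) o) (b s)); lra.
  have D2 : d (b s) (b u) <= D + 2 * C.
    have := dist_triangle (act (cp_src (be s)) o) (b s) (b u).
    have := dist_triangle (act (cp_src (be u)) o) (act (cp_src (be s)) o) (b u).
    by rewrite -/D (metric_sym (act (cp_src (be u)) o) (b u)); lra.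
  have Kpos : 0 < K by lra.
  have KD : K * D <= K * (lam * `|s - u| + eps + 2 * C) by rewrite ler_wpM2l //; lra.
  have WK : lam'^-1 * `|s - u| <= W + K * (eps + 2 * C).
    have -> : lam'^-1 * `|s - u| = K^-1 * (lam^-1 * `|s - u|).
      by rewrite /lam' invfM mulrA.
    rewrite mulrC ler_pdivrMr // mulrDl (mulrC W K).
    have : K * (eps + 2 * C) <= K * (eps + 2 * C) * K by rewrite ler_peMr.
    have : eps + 2 * C <= K * (eps + 2 * C) by rewrite ler_peMl //; lra.
    by lra.
  rewrite /eps' /lam' -mulrA; move: KD; rewrite mulrDr mulrDr => KD.
  by move: WK E0; rewrite !mulrDr /lam' => WK E0'; apply/andP; split; lra.
have tI : t \in `[0, L] by rewrite in_itv.
have Ybe0 : (c @` `[0, +oo[) (be 0) by rewrite be0.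
have [_ [r r0 <-] near] := MP lam' eps' lam'0 eps'0 0 L be L0 qbe Ybe0 YL (be t)
  (ex_intro2 _ _ t tI erefl).
rewrite /= in_itv /= andbT in r0.
exists (act (g (Num.truncn r)) o); first by exists (Num.truncn r).
have /andP[r1 r2] := truncn_itv r0.
have /andP[h1 _] := cb (be t) (c r); have /andP[h2 _] := cb (c r) (c (Num.truncn r)%:R).
rewrite (cd r) // ger0_norm ?subr_ge0 // in h2; rewrite -natr1 in r2.
have h3 := word_dist_triangle (R := R) genS (cp_src (c r)) (cp_src (be t)) (g (Num.truncn r)).
have h4 := KP1 (cp_src (be t)) (g (Num.truncn r)).
have h5 : K * word_dist R S (cp_src (be t)) (g (Num.truncn r)) <= K * (M lam' eps' + 5).
  by apply: ler_wpM2l; [lra|rewrite /g in h3 *; lra].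
have := dist_triangle (act (cp_src (be t)) o) (b t) (act (g (Num.truncn r)) o).
have := beH t tL; lra.
Qed.

End MorseOrbit.

(** * Projections and chains of contracting segments *)

Section Assembly.
Context {R : realType} {G : groupType} {X : metricType R} (act : G -> X -> X).
Local Notation d := (@mdist R X).

Theorem contracting_orbit_seq (o : X) :
  isometric_action act -> proper_action act -> cobounded_action act ->
  injective_space X -> contains_morse_ray R G ->
  exists (g : nat -> G) (Lam D Q : R), let p n := act (g n) o in
  [/\ [/\ 1 <= Lam, 0 <= D & 0 <= Q], forall n, d (p n) (p n.+1) <= Lam,
      forall m n, (m <= n)%N -> (n - m)%:R <= Lam * d (p m) (p n) + Lam,
      forall i m j, (i <= m <= j)%N -> d (p i) (p m) + d (p m) (p j) <= d (p i) (p j) + Q &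
      forall s t, (s <= t)%N -> contracting D (seg p s t)].
Proof.
move=> isom prop cob injX mr.
have [g [Lam /=]] := morse_orbit_seq isom prop cob injX o mr.
set p := fun n => act (g n) o => -[Lam1 pstep plow qg].
have [M1 M10 M1P] := qg (20 * 20) 10 ltac:(lra) ltac:(lra).
have [M2 M20 M2P] := qg 1 0 ltac:(lra) ltac:(lra).
have Lam0 : 0 <= Lam by lra.
have pgeo L c i j t : geodesic d `[0, L] c -> c 0 = p i -> c L = p j -> 0 <= t <= L ->
    exists k, d (c t) (p k) <= M2.
  move=> gc c0 cL tL; have [|L0] := lerP 0 L; last by case/andP: tL; lra.
  move=> L0; have [|||_ [k _ <-] dk] := M2P L c L0 _ _ _ t tL; last by exists k.
  - by move=> s u sI uI; rewrite gc // invr1 !mul1r subr0 addr0 lexx.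
  - by rewrite c0; exists i.
  - by rewrite cL; exists j.
have [Q Q0 bt] := bounded_backtrack Lam0 M20 pstep plow injX pgeo.
have exn := nearest_range Lam0 plow.
have short := short_step_contracting injX M1P.
have ballc := ball_contracting injX exn short.
have D0 : 0 < 10 * (102 * (3 * M1 + 100)) by rewrite !mulr_gt0 //; lra.
have cr := ball_contracting_strong injX exn D0 ballc.
set D := 24 * _ in cr; have {}D0 : 0 <= D by rewrite mulr_ge0 // ltW.
exists g, Lam, (3 * D + 4 * Q), Q; split => //.
- by split => //; lra.
- exact: (segment_contracting Lam0 M20 plow D0 Q0 bt cr).
Qed.

Context (act_isom : isometric_action act).

Lemma nearest_act (k : G) (A : set X) x p :
  nearest (act k @` A) (act k x) (act k p) <-> nearest A x p.
Proof.
split=> [[[q Aq qp] h]|[Ap h]].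
  have qpE : q = p by rewrite -(actK act_isom k q) qp (actK act_isom).
  split; first by rewrite -qpE.
  move=> r Ar; have := h (act k r) (ex_intro2 _ _ r Ar erefl).
  by rewrite !(act_dist act_isom).
split; first by exists p.
by move=> _ [r Ar <-]; rewrite !(act_dist act_isom); exact: h.
Qed.

Lemma contracting_act (D : R) (k : G) (A : set X) :
  contracting D A -> contracting D (act k @` A).
Proof.
move=> cA x y p q np nq.
have [[p' _ pE] _] := np; have [[q' _ qE] _] := nq.
rewrite -(actKV act_isom k x) -(actKV act_isom k y) -pE -qE in np nq *.
move/nearest_act in np; move/nearest_act in nq.
by rewrite !(act_dist act_isom k); exact: cA.
Qed.

Definition projects (A : set X) (b : X) (B : R) (x : X) :=
  forall p, nearest A x p -> d p b <= B.

Lemma projects_act (k : G) (A : set X) b B x :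
  projects (act k @` A) (act k b) B (act k x) <-> projects A b B x.
Proof.
split=> h p np.
  by have := h (act k p); rewrite (act_dist act_isom); apply; apply/nearest_act.
have [[q _ qE] _] := np; rewrite -qE in np *.
by rewrite (act_dist act_isom); move/nearest_act: np; exact: h.
Qed.

Lemma projects_le (A : set X) b B B' x : B <= B' -> projects A b B x -> projects A b B' x.
Proof. by move=> BB' h p /h /le_trans; apply. Qed.

Lemma projects_self (A : set X) x : A x -> projects A x 0 x.
Proof.
move=> Ax p [_ h]; have := h x Ax; rewrite mdistxx => h0.
by rewrite metric_sym.
Qed.

Lemma projects_self_far (A : set X) x b B : A x -> projects A b B x -> d x b <= B.
Proof. by move=> Ax; apply; exact: nearest_self. Qed.

Definition has_nearest (A : set X) := forall x, exists p, nearest A x p.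

Lemma has_nearest_act k A : has_nearest A -> has_nearest (act k @` A).
Proof.
move=> hA x; have [p np] := hA (act k^-1%g x); exists (act k p).
by rewrite -(actKV act_isom k x); apply/nearest_act.
Qed.

(** Otherwise the projection [p] of [z] to [A'] is far from [s'], and contraction
    makes the way from [z] to [s] pass near [p]; but [p] projects to [A] near the
    far end [e], so contraction of [A] makes the way from [z] to [p] pass near
    [s] first and then along all of [A].  Both cannot hold. *)
Lemma chain_step (D B : R) (A A' : set X) (s e s' z : X) : 0 <= D -> 0 <= B ->
  contracting D A -> contracting D A' -> has_nearest A -> has_nearest A' ->
  A s -> 3 * B + 4 * D < d s e ->
  (forall y, A' y -> projects A e B y) -> (forall y, A y -> projects A' s' B y) ->
  projects A s (B + D) z -> projects A' s' (B + D) z.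
Proof.
move=> D0 B0 cA cA' hA hA' As big A'A AA' zs p np.
rewrite leNgt; apply/negP => bad.
have [q nq] := hA' s; have qs := AA' s As q nq.
have pq : D < d p q by have := dist_triangle q p s'; lra.
have h1 := cA' z s p q np nq pq.
have [u nu] := hA z; have us := zs u nu.
have [w nw] := hA p; have we := A'A p np.1 w nw.
have uw : d s e <= d u w + (B + D) + B.
  have := dist_triangle u s e; have := dist_triangle w u e.
  by rewrite (metric_sym s u); lra.
have h2 := cA z p u w nu nw ltac:(lra).
have := dist_triangle u z s; have := mdist_ge0 w p; have := mdist_ge0 q s; lra.
Qed.

End Assembly.

(** * An element of infinite order and superlinear growth *)

Section Cosets.
Context {G : groupType}.

Lemma cyclic_subgroupM (f a b : G) :
  cyclic_subgroup f a -> cyclic_subgroup f b -> cyclic_subgroup f (a * b)%g.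
Proof.
have mix m n : cyclic_subgroup f (f ^+ m * f ^- n)%g.
  have [mn|nm] := leqP n m; first by left; exists (m - n)%N => //; rewrite expgnFr.
  by right; exists (n - m)%N => //; rewrite expgnFr ?(ltnW nm) // invgM invgK.
have comm m n : (f ^- n * f ^+ m)%g = (f ^+ m * f ^- n)%g.
  by apply: (mulIg (f ^+ n)%g); rewrite mulgVK -!mulgA -expgnDr addnC expgnDr mulKg.
move=> [] [m _ <-] [] [n _ <-].
- by left; exists (m + n)%N => //; rewrite expgnDr.
- exact: mix.
- by rewrite comm; exact: mix.
- by right; exists (n + m)%N => //; rewrite expgnDr invgM.
Qed.

Lemma distinct_cosets (K : set G) : ~ finite_index K -> forall m, exists x : nat -> G,
  forall i j, (i < j < m)%N -> [set (x i * h)%g | h in K] <> [set (x j * h)%g | h in K].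
Proof.
move=> infK; pose q x : set G := [set (x * h)%g | h in K].
elim=> [|m [x xP]]; first by exists (fun=> 1%g) => i j; rewrite ltn0 andbF.
have [[y yP]|none] := pselect (exists y, forall i, (i < m)%N -> q (x i) <> q y).
  exists (fun i => if (i < m)%N then x i else y) => i j /andP[ij jm].
  have [jm'|mj] := ltnP j m; first by rewrite (ltn_trans ij jm'); apply: xP; rewrite ij.
  have im : (i < m)%N by apply: leq_trans ij _.
  by rewrite im; exact: yP.
exfalso; apply: infK; rewrite /finite_index -/q.
apply: (@sub_finite_set _ _ ((fun i => q (x i)) @` `I_m)); last first.
  by apply: finite_image; exact: finite_II.
move=> _ [y _ <-]; apply: contrapT => yn; apply: none; exists y => i im e.
by apply: yn; exists i.
Qed.

End Cosets.

Section Pieces.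
Context {R : realType} {G : groupType} {X : metricType R} (act : G -> X -> X).
Local Notation d := (@mdist R X).
Context (act_isom : isometric_action act) (act_proper : proper_action act) (o : X).

Lemma word_orbit_dist (f : G) k : d o (act (f ^+ k)%g o) <= k%:R * d o (act f o).
Proof.
elim: k => [|k IH]; first by rewrite (act1 act_isom) mdistxx mul0r.
rewrite expgS (actM act_isom) natS_mulr.
have := dist_triangle (act f o) o (act f (act (f ^+ k)%g o)).
rewrite (act_dist act_isom); lra.
Qed.

Lemma exists_nat_gt (r : R) : exists2 n, (0 < n)%N & r < n%:R.
Proof.
have [r0|r0] := lerP 0 r; last by exists 1%N => //; apply: lt_trans r0 _.
by exists (Num.truncn r).+1 => //; have /andP[] := truncn_itv r0.
Qed.

(** If [G] has [m] cosets [x * <f>] with [x] in a fixed ball, the elements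
    [x * f ^+ k] are distinct and their number in a ball grows at least like [m]
    times the radius divided by [d o (act f o)]; here [m] is arbitrary. *)
Lemma superlinear_growth (f : G) : (forall n, (0 < n)%N -> (f ^+ n)%g <> 1%g) ->
  ~ virtually_cyclic G -> forall C, 0 <= C -> exists (r : R) (s : seq G),
  [/\ 0 <= r, uniq s, forall h, h \in s -> d o (act h o) <= r & C * (r + 1) < (size s)%:R].
Proof.
move=> finf nvc C C0.
have nfi : ~ finite_index (cyclic_subgroup f) by move=> fi; apply: nvc; exists f.
set df := d o (act f o); have df0 : 0 <= df by exact: mdist_ge0.
have [m _ mP] := exists_nat_gt (C * (df + 1)).
have [x xP] := distinct_cosets nfi m.
have [r0 r00 r0P] := finite_upper_bound (fun i => d o (act (x i) o)) (finite_II m).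
have [n n_pos nP] := exists_nat_gt (r0 + 1).
exists (r0 + n%:R * df), [seq (x i * f ^+ k)%g | i <- iota 0 m, k <- iota 0 n]; split.
- by rewrite addr_ge0 // mulr_ge0.
- apply: allpairs_uniq; [exact: iota_uniq|exact: iota_uniq|].
  move=> u v uI vI; case/allpairsP: uI => -[i k] /= [im kn ->]; case/allpairsP: vI => -[j l] /= [jm ln ->] e.
  rewrite !mem_iota !add0n /= in im kn jm ln.
  have sameq i1 j1 k1 l1 : (x i1 * f ^+ k1 = x j1 * f ^+ l1)%g ->
      [set (x i1 * h)%g | h in cyclic_subgroup f] `<=`
      [set (x j1 * h)%g | h in cyclic_subgroup f].
    move=> e1 _ [h hc <-]; exists (f ^+ l1 * f ^- k1 * h)%g.
      by do 2!apply: cyclic_subgroupM => //; [left; exists l1|right; exists k1].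
    by rewrite !mulgA -e1 -[(x i1 * _ * _)%g]mulgA mulgV mulg1.
  have qE : [set (x i * h)%g | h in cyclic_subgroup f] =
            [set (x j * h)%g | h in cyclic_subgroup f].
    by apply/seteqP; split; [exact: sameq e|exact: sameq (esym e)].
  have ij : i = j.
    by case: (ltngtP i j) => // ij; [have := xP i j|have := xP j i];
      rewrite ij ?im ?jm ?qE => /(_ isT).
  move: e; rewrite ij => /mulgI e; congr pair.
  have powinj a b : (a < b)%N -> (f ^+ a)%g <> (f ^+ b)%g.
    move=> ab eab; apply: (finf (b - a)%N); first by rewrite subn_gt0.
    by rewrite expgnFr ?(ltnW ab) // eab mulgV.
  by case: (ltngtP k l) => // kl; have := powinj _ _ kl; rewrite e.
- move=> h /allpairsP[[i k] /= [im kn ->]]; rewrite !mem_iota !add0n /= in im kn.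
  rewrite (actM act_isom).
  have := dist_triangle (act (x i) o) o (act (x i) (act (f ^+ k)%g o)).
  rewrite (act_dist act_isom); have := word_orbit_dist f k; have := r0P i im.
  have : k%:R * df <= n%:R * df by rewrite ler_wpM2r // ler_nat ltnW.
  by rewrite -/df; lra.
- rewrite size_allpairs !size_iota natrM.
  have n0 : 0 < n%:R :> R by rewrite ltr0n.
  have : n%:R * (C * (df + 1)) < n%:R * m%:R by rewrite ltr_pM2l.
  have : C * (r0 + 1) <= C * n%:R by rewrite ler_wpM2l // ltW.
  rewrite (mulrC m%:R) !mulrDr !mulr1 (mulrCA C n%:R) (mulrC n%:R C); lra.
Qed.

Lemma pigeonhole (F : finType) (phi : nat -> F) : exists i j, (i < j)%N /\ phi i = phi j.
Proof.
apply: contrapT => none.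
have inj : injective (fun i : 'I_(#|F|.+1) => phi i).
  move=> i j e; apply/val_inj => /=; case: (ltngtP i j) => // ij; exfalso; apply: none.
    by exists i, j.
  by exists j, i.
by have := leq_card _ inj; rewrite card_ord ltnn.
Qed.

Context (g : nat -> G) (Lam D Q : R).
Local Notation p n := (act (g n) o).

(** The finitely many words of length [l] spelled by the sequence repeat; looking
    only at multiples of [l] makes the two occurrences disjoint. *)
Lemma repeated_block (l : nat) : (forall n, d (p n) (p n.+1) <= Lam) ->
  exists (s s' : nat) (f : G), (s + l <= s')%N /\
    forall m, (m <= l)%N -> g (s' + m)%N = (f * g (s + m)%N)%g.
Proof.
move=> pstep; have /finite_seqP[B BP] := orbit_ball_finite act_proper o (l%:R * Lam).
have inB s m : (m <= l)%N -> ((g s)^-1 * g (s + m)%N)%g \in B.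
  move=> ml; suff : [set` B] ((g s)^-1 * g (s + m)%N)%g by [].
  rewrite -BP /= -(orbit_dist act_isom).
  have := @chain_dist _ _ Lam (fun k => p (s + k)%N) m.
  rewrite addn0 => /(_ _)/le_trans; apply => [i _|]; first by rewrite addnS.
  have Lam0 : 0 <= Lam by apply: le_trans (pstep 0%N); exact: mdist_ge0.
  by rewrite ler_wpM2r // ler_nat.
pose phi i := [ffun m : 'I_l.+1 =>
  inord (index ((g (i * l)%N)^-1 * g (i * l + m)%N)%g B) : 'I_(size B).+1].
have [i [j [ij phiE]]] := pigeonhole phi.
exists (i * l)%N, (j * l)%N, (g (j * l)%N * (g (i * l)%N)^-1)%g; split.
  by rewrite -mulSnr leq_mul2r ij orbT.
move=> m ml; have ml' : (m < l.+1)%N by [].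
have := congr1 (fun F : {ffun 'I_l.+1 -> 'I_(size B).+1} => val (F (Ordinal ml'))) phiE.
rewrite !ffunE /= !inordK ?ltnS ?index_size // => e.
have : ((g (i * l)%N)^-1 * g (i * l + m)%N)%g = ((g (j * l)%N)^-1 * g (j * l + m)%N)%g.
  by rewrite -(nth_index 1%g (inB (i * l)%N m ml)) e nth_index // inB.
by move=> e'; rewrite -mulgA e' mulVKg.
Qed.

Context (Q0 : 0 <= Q) (D0 : 0 <= D) (Lam0 : 0 <= Lam).
Context (pstep : forall n, d (p n) (p n.+1) <= Lam).
Context (plow : forall m n, (m <= n)%N -> (n - m)%:R <= Lam * d (p m) (p n) + Lam).
Context (bt : forall i m j, (i <= m <= j)%N ->
  d (p i) (p m) + d (p m) (p j) <= d (p i) (p j) + Q).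
Context (cs : forall s t, (s <= t)%N -> contracting D (seg (fun n => p n) s t)).

Lemma has_nearest_seg (q : nat -> X) s t : (s <= t)%N -> has_nearest (seg q s t).
Proof. by move=> st x; have [n _ nn] := nearest_seg q x st; exists (q n). Qed.

(** The element [f] that moves a long segment to a later one of the same shape
    forms, with its powers, a chain of segments.  The end of the first segment
    projects near the start of all the others; if a power of [f] were trivial,
    it would do so on the first segment itself. *)
Lemma infinite_order_element : exists f : G, forall n, (0 < n)%N -> (f ^+ n)%g <> 1%g.
Proof.
have [[Q0' D0'] L0'] := (Q0, D0, Lam0).
have [l _ lP] := exists_nat_gt (Lam * (3 * Q + 4 * D) + Lam).
have [s [s' [f [ss' fE]]]] := repeated_block l pstep.
exists f => n n0 fn1.
pose A := seg (fun n => p n) s (s + l).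
have sl : (s <= s + l)%N by exact: leq_addr.
have cA : contracting D A by exact: cs.
have hA : has_nearest A by exact: has_nearest_seg.
have fA : act f @` A = seg (fun n => p n) s' (s' + l).
  apply/seteqP; split => [_ [_ [k kP <-] <-]|_ [k kP <-]].
    exists (s' + (k - s))%N; first by rewrite /= in kP *; lia.
    by rewrite fE -?(actM act_isom) ?subnKC //; rewrite /= in kP; lia.
  exists (p (s + (k - s')%N)); first by exists (s + (k - s'))%N => //; rewrite /= in kP *; lia.
  by rewrite -(actM act_isom) -fE ?subnKC //; rewrite /= in kP; lia.
have far : 3 * Q + 4 * D < d (p s) (p (s + l)%N).
  rewrite ltNge; apply/negP => small; have := plow sl; rewrite addKn.
  have := ler_wpM2l L0' small; lra.
have A'A y : (act f @` A) y -> projects A (p (s + l)%N) Q y.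
  rewrite fA => -[i iP <-] _ [[j jP <-] njn].
  rewrite /= in iP jP.
  have := bt (i := j) (m := (s + l)%N) (j := i) ltac:(lia).
  have endA : A (p (s + l)%N) by exists (s + l)%N => //=; rewrite leqnn leq_addr.
  have := njn _ endA; have := mdist_ge0 (p j) (p (s + l)%N).
  by rewrite (metric_sym (p i) (p j)) (metric_sym (p i)); lra.
have AA' y : A y -> projects (act f @` A) (act f (p s)) Q y.
  rewrite fA => -[i iP <-] _ [[j jP <-] njn].
  have -> : act f (p s) = p s' by rewrite -(actM act_isom) -(addn0 s) -fE ?addn0.
  rewrite /= in iP jP.
  have := bt (i := i) (m := s') (j := j) ltac:(lia).
  have := njn (p s') (ex_intro2 _ _ s' _ erefl); rewrite /= leqnn leq_addr => /(_ isT).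
  by rewrite (metric_sym (p j)); lra.
have step x : projects A (p s) (Q + D) x -> projects A (p s) (Q + D) (act f^-1%g x).
  move=> near; rewrite -(projects_act act_isom f) (actKV act_isom).
  have sA : A (p s) by exists s; rewrite //= leqnn.
  exact: (chain_step D0' Q0' cA (contracting_act act_isom cA) hA (has_nearest_act act_isom f hA)
    sA far A'A AA' near).
have first : projects A (p s) (Q + D) (act f^-1%g (p (s + l)%N)).
  rewrite -(projects_act act_isom f) (actKV act_isom).
  apply: (@projects_le _ _ _ _ Q); first lra.
  by apply: AA'; exists (s + l)%N => //=; rewrite leqnn leq_addr.
have all k : projects A (p s) (Q + D) (act (f ^- k.+1)%g (p (s + l)%N)).
  elim: k => [|k IH]; first exact: first.
  by rewrite expgSr invgM (actM act_isom); exact: step.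
case: n n0 fn1 => // n _ fn1; have := all n; rewrite fn1 invg1 (act1 act_isom).
move=> /(projects_self_far (A := A)) h.
have := h _; rewrite metric_sym => h'.
have : d (p s) (p (s + l)%N) <= Q + D.
  by apply: h'; exists (s + l)%N => //=; rewrite leqnn leq_addr.
lra.
Qed.

End Pieces.

(** * Diverging translates of a segment *)

Section Divergence.
Context {R : realType} {G : groupType} {X : metricType R} (act : G -> X -> X).
Local Notation d := (@mdist R X).
Context (act_isom : isometric_action act) (act_proper : proper_action act) (o : X).

Definition pts (a : nat -> G) (n : nat) : set X := seg (fun i => act (a i) o) 0 n.

(** A segment of the sequence or of its reverse, moved to start at [o]; both
    directions are needed, and this is what they have in common. *)
Definition piece (Lam D Q : R) (a : nat -> G) (n : nat) : Prop :=
  [/\ a 0%N = 1%g,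
      forall i, (i < n)%N -> d (act (a i) o) (act (a i.+1) o) <= Lam,
      forall i j, (i <= j <= n)%N -> (j - i)%:R <= Lam * d (act (a i) o) (act (a j) o) + Lam,
      forall i m j, (i <= m <= j)%N -> (j <= n)%N ->
        d (act (a i) o) (act (a m) o) + d (act (a m) o) (act (a j) o) <=
        d (act (a i) o) (act (a j) o) + Q &
      contracting D (pts a n)].

(** The translate by [v] leaves the translate by [w] within [B] of the start. *)
Definition diverge (B : R) (a : nat -> G) (n : nat) (v w : G) : Prop :=
  forall y, (act v @` pts a n) y -> projects (act w @` pts a n) (act w o) B y.

Lemma has_nearest_pts a n : has_nearest (pts a n).
Proof. exact: has_nearest_seg. Qed.

Context (Lam D Q : R).

Section OnePiece.
Context (a : nat -> G) (n : nat) (aP : piece Lam D Q a n).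
Local Notation x_ i := (act (a i) o).

Lemma piece_start : pts a n o.
Proof. by case: aP => a0 _ _ _ _; exists 0%N; rewrite // a0 (act1 act_isom). Qed.

Lemma first_depth (r : R) : 0 <= r -> r < d o (x_ n) ->
  exists m, [/\ (m <= n)%N, r < d o (x_ m) & d o (x_ m) <= r + Lam].
Proof.
move=> r0 rn; have ex : exists m, (m <= n)%N && (r < d o (x_ m)) by exists n; rewrite leqnn.
case: aP => a0 step _ _ _.
case: (ex_minnP ex) => m /andP[mn rm] mmin; exists m; split => //.
case: m mn rm mmin => [|m] mn rm mmin.
  by move: rm; rewrite a0 (act1 act_isom) mdistxx; lra.
have : d o (x_ m) <= r.
  rewrite leNgt; apply/negP => bad; have := mmin m; rewrite (ltnW mn) bad => /(_ isT).
  by rewrite ltnn.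
by have := dist_triangle (x_ m) o (x_ m.+1); have := step m mn; lra.
Qed.

(** If a moved copy of a piece projects far along the piece, then it stays close
    to it all the way until then, except for an initial part that compensates
    the displacement of the start. *)
Lemma fellow_travel (h : G) (R0 B0 : R) (i m : nat) (q : X) :
  0 <= D -> 0 <= Q ->
  d o (act h o) <= R0 -> (i <= n)%N -> nearest (pts a n) (act h (x_ i)) q -> B0 < d q o ->
  (m <= n)%N -> R0 + 2 * D + Q < d o (x_ m) -> d o (x_ m) < B0 - 2 * R0 - 2 * D - Q ->
  exists2 j, (j <= n)%N & d (act h (x_ m)) (x_ j) <= D + Q.
Proof.
case: aP => a0 _ _ bt cA D0 Q0 hR i_n nq qB mn mlow mhigh.
have x0 : x_ 0%N = o by rewrite a0 (act1 act_isom).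
have R00 : 0 <= R0 by apply: le_trans hR; exact: mdist_ge0.
have [q0 nq0] := has_nearest_pts a n (act h o).
have [qm nqm] := has_nearest_pts a n (act h (x_ m)).
suff : d (act h (x_ m)) qm <= D + Q.
  by have [[j jn <-] _] := nqm => jE; exists j.
have h0 : d (act h o) q0 <= R0 by rewrite (le_trans (nq0.2 o piece_start)) // metric_sym.
have q0o : d q0 o <= 2 * R0.
  by have := dist_triangle (act h o) q0 o; rewrite (metric_sym q0 (act h o)) (metric_sym (act h o) o); lra.
have q0q : B0 - 2 * R0 <= d q0 q.
  by have := dist_triangle q0 q o; rewrite (metric_sym q q0); lra.
have di : d (act h o) (act h (x_ i)) = d o (x_ i) by rewrite (act_dist act_isom).
have dm : d (act h o) (act h (x_ m)) = d o (x_ m) by rewrite (act_dist act_isom).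
have hm_i := cA _ _ _ _ nqm nq; have h0_i := cA _ _ _ _ nq0 nq; have h0_m := cA _ _ _ _ nq0 nqm.
rewrite di in h0_i; rewrite dm in h0_m.
have ge1 := mdist_ge0 (act h o) q0; have ge2 := mdist_ge0 q (act h (x_ i)).
have ge3 := mdist_ge0 qm (act h (x_ m)).
have mi : (m <= i)%N.
  rewrite leqNgt; apply/negP => im; have := bt 0%N i m; rewrite (ltnW im) => /(_ isT mn).
  have := h0_i ltac:(lra); have := mdist_ge0 (x_ i) (x_ m).
  by rewrite x0; lra.
have bt' : d o (x_ m) + d (act h (x_ m)) (act h (x_ i)) <= d o (x_ i) + Q.
  by rewrite (act_dist act_isom); have := bt 0%N m i mi i_n; rewrite x0.
have up : d o (x_ i) <= R0 + d q0 q + d (act h (x_ i)) q.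
  rewrite -di; have := dist_triangle q0 (act h o) (act h (x_ i)).
  by have := dist_triangle q q0 (act h (x_ i)); rewrite (metric_sym q (act h _)); lra.
have t1 := dist_triangle qm q0 q.
rewrite (metric_sym q (act h (x_ i))) in hm_i h0_i ge2.
rewrite (metric_sym qm (act h (x_ m))) in h0_m ge3.
have [small0|big0] := lerP (d q0 qm) D.
  by have := hm_i ltac:(lra); lra.
have [small1|big1] := lerP (d qm q) D.
  by have := h0_m big0; lra.
have := hm_i big1; have := h0_m big0.
have := dist_triangle q (act h o) (act h (x_ i)); have := dist_triangle q0 (act h o) q.
by rewrite di (metric_sym q (act h (x_ i))); lra.
Qed.

(** If the copy by [w] followed the one by [v] for long, the points of the latter
    next to it would show that the copy by [v] follows the one by [w]. *)
Lemma diverge_sym (R0 B0 B1 : R) (v w : G) : 0 <= D -> 0 <= Q -> 0 <= Lam -> 0 <= B0 ->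
  d (act v o) (act w o) <= R0 ->
  B1 = B0 + 2 * (D + Q) + R0 + 2 * D + Q + Lam + 2 * R0 + 2 * D + Q + 1 ->
  B1 <= d o (x_ n) ->
  diverge B0 a n v w -> diverge B1 a n w v.
Proof.
move=> D0 Q0 Lam0 B00 vw B1E B1n dvw y [_ [i i_n <-] <-] q nq.
rewrite leNgt; apply/negP => far.
have R00 : 0 <= R0 by apply: le_trans vw; exact: mdist_ge0.
pose h := (v^-1 * w)%g.
have vh x : act v (act h x) = act w x by rewrite -(actM act_isom) mulVKg.
have hR : d o (act h o) <= R0 by rewrite -(act_dist act_isom v) vh.
have [[q' q'A q'E] _] := nq.
have nq' : nearest (pts a n) (act h (x_ i)) q'.
  by rewrite -(nearest_act act_isom v) vh q'E.
have far' : B1 < d q' o by rewrite -(act_dist act_isom v) q'E.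
have [||m [mn mlow mhigh]] := @first_depth (B0 + 2 * (D + Q) + R0 + 2 * D + Q); [lra|lra|].
have [||j jn close] := fellow_travel (m := m) D0 Q0 hR i_n nq' far' mn; [lra|lra|].
have close' : d (act w (x_ m)) (act v (x_ j)) <= D + Q.
  by rewrite -(act_dist act_isom v) vh in close.
have [u nu] := has_nearest_act act_isom w (has_nearest_pts a n) (act v (x_ j)).
have xm : (act w @` pts a n) (act w (x_ m)) by exists (x_ m) => //; exists m.
have xj : (act v @` pts a n) (act v (x_ j)) by exists (x_ j) => //; exists j.
have := nu.2 _ xm; have := dvw _ xj u nu.
have := dist_triangle u (act w o) (act w (x_ m)); have := dist_triangle (act v (x_ j)) u (act w (x_ m)).
rewrite (act_dist act_isom) (metric_sym (act w o) u) (metric_sym u (act v _)).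
rewrite (metric_sym (act v (x_ j)) (act w _)).
lra.
Qed.

End OnePiece.
End Divergence.

Lemma subn_rev (t i j : nat) : (i <= j <= t)%N -> (t - i - (t - j) = j - i)%N.
Proof. by lia. Qed.

Section Triple.
Context {R : realType} {G : groupType} {X : metricType R} (act : G -> X -> X).
Local Notation d := (@mdist R X).
Context (act_isom : isometric_action act) (act_proper : proper_action act) (o : X).
Context (Lam D Q : R).
Context (Lam0 : 0 <= Lam) (D0 : 0 <= D) (Q0 : 0 <= Q).

(** How far two copies moved by at most [rho] have to go together for
    [fellow_travel] to apply at some point of the piece. *)
Definition fork_depth (rho : R) := 3 * (2 * rho) + 4 * D + 2 * Q + Lam + 1.

(** An element [w] that fails to diverge from [v] moves a fixed point [a m] of the
    piece, up to [v], next to some [a j] whose distance to [o] differs from that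
    of [a m] by at most [2 * rho] and a constant.  There are linearly many such
    [j], and boundedly many [w] for each of them. *)
Lemma few_fellow_travellers : exists2 C1, 0 <= C1 &
  forall (rho : R) (a : nat -> G) (n : nat) (v : G) (s : seq G), 0 <= rho ->
  piece act o Lam D Q a n -> fork_depth rho <= d o (act (a n) o) ->
  d o (act v o) <= rho -> uniq s -> (forall w, w \in s -> d o (act w o) <= rho) ->
  (size [seq w <- s | `[< ~ diverge act o (fork_depth rho) a n w v >]])%:R <= C1 * (rho + 1).
Proof.
have [[L0 D0'] Q0'] := (Lam0, D0, Q0).
pose kap := D + Q.
have /finite_seqP[U UP] := orbit_ball_finite act_proper o kap.
pose C2 := Lam * (4 + 2 * kap + Q) + Lam + 1.
have C20 : 0 <= C2.
  have : 0 <= Lam * (4 + 2 * kap + Q) by rewrite mulr_ge0 // /kap; lra.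
  by rewrite /C2; lra.
exists (C2 * (size U)%:R) => [|rho a n v s rho0 pa deep vrho us srho]; first by rewrite mulr_ge0.
have [a0 _ low bt _] := pa.
have x0 : act (a 0%N) o = o by rewrite a0 (act1 act_isom).
set B0 := fork_depth rho in deep *; pose R0 := 2 * rho.
have B0E : B0 = 3 * R0 + 4 * D + 2 * Q + Lam + 1 by [].
have R00 : 0 <= R0 by rewrite /R0; lra.
have [||m [mn mlow mhigh]] := first_depth act_isom pa (r := R0 + 2 * D + Q); [lra|lra|].
pose J j := `[< (j <= n)%N /\ `|d o (act (a j) o) - d o (act (a m) o)| <= R0 + kap >].
have bad w : d o (act w o) <= rho -> ~ diverge act o B0 a n w v ->
    exists2 j, J j & d (act (v^-1 * w)%g (act (a m) o)) (act (a j) o) <= kap.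
  move=> wrho; have [//|ex] := pselect (exists2 j, J j &
    d (act (v^-1 * w)%g (act (a m) o)) (act (a j) o) <= kap).
  move=> nd; exfalso; apply: nd => y [_ [i i_n <-] <-] q nq.
  rewrite leNgt; apply/negP => far; apply: ex.
  pose h := (v^-1 * w)%g.
  have vh x : act v (act h x) = act w x by rewrite -(actM act_isom) mulVKg.
  have hR : d o (act h o) <= R0.
    rewrite -(act_dist act_isom v) vh; have := dist_triangle o (act v o) (act w o).
    by rewrite (metric_sym (act v o) o) /R0; lra.
  have [[q' q'A q'E] _] := nq.
  have nq' : nearest (pts act o a n) (act h (act (a i) o)) q'.
    by rewrite -(nearest_act act_isom v) vh q'E.
  have far' : B0 < d q' o by rewrite -(act_dist act_isom v) q'E.
  have [||j jn close] := fellow_travel act_isom pa (m := m) D0 Q0 hR i_n nq' far' mn; [lra|lra|].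
  exists j => //; apply/asboolP; split => //.
  rewrite -/h -/kap in close *.
  have := dist_triangle (act h o) o (act (a j) o).
  have := dist_triangle (act h (act (a m) o)) (act h o) (act (a j) o).
  have := dist_triangle (act h (act (a m) o)) (act h o) (act (a m) o).
  have := dist_triangle o (act h o) (act h (act (a m) o)).
  have := dist_triangle (act (a j) o) o (act h (act (a m) o)).
  rewrite (act_dist act_isom) (metric_sym (act h o) o) (metric_sym (act (a j) o) (act h _)).
  by move=> *; rewrite ler_norml; apply/andP; split; lra.
have [/existsNP [w0 /not_implyP [w0s w0bad]]|none] :=
    pselect (~ forall w, w \in s -> diverge act o B0 a n w v); last first.
  rewrite (_ : [seq _ <- _ | _] = [::]); last first.
    rewrite -(filter_pred0 s); apply: eq_in_filter => w ws /=.
    by apply/asboolP => /(_ (contrapT none w ws)).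
  by rewrite mulr_ge0 ?mulr_ge0 //; lra.
have [j1 j1J _] := bad w0 (srho _ w0s) w0bad.
have exJ : exists j, J j by exists j1.
case: (ex_minnP exJ) => j0 j0J j0min.
pose r := Lam * (2 * (R0 + kap) + Q) + Lam.
have r0 : 0 <= r by rewrite /r addr_ge0 // mulr_ge0 // /kap; lra.
have /andP[Wlow Whigh] := truncn_itv r0.
have [W WE] : exists W, W = (Num.truncn r).+1 by eexists.
suff sub : {subset [seq w <- s | `[< ~ diverge act o B0 a n w v >]] <=
    [seq (v * a j * u * (a m)^-1)%g | j <- iota j0 W, u <- U]}.
  have := uniq_leq_size (filter_uniq _ us) sub.
  rewrite size_allpairs size_iota -(ler_nat R) natrM => /le_trans; apply.
  rewrite -mulrA (mulrC (size U)%:R) mulrA; apply: ler_wpM2r => //.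
  have h1 : 0 <= Lam * (2 * kap + Q) * rho by rewrite !mulr_ge0 // /kap; lra.
  rewrite WE -natr1; apply: (le_trans (y := r + 1)); first lra.
  have h2 : 0 <= Lam * rho by rewrite mulr_ge0.
  by rewrite /r /C2 /R0; lra.
move=> w; rewrite mem_filter => /andP[/asboolP wbad ws].
have [j jJ close] := bad w (srho _ ws) wbad.
have /asboolP[jn jnear] := jJ; have /asboolP[j0n j0near] := j0J.
have j0j := j0min j jJ.
apply/allpairsP; exists (j, ((a j)^-1 * (v^-1 * w) * a m)%g); split => /=.
- rewrite mem_iota j0j /= -ltn_subLR // WE -(ltr_nat R).
  apply: le_lt_trans (low j0 j _) _; first by rewrite j0j.
  apply: le_lt_trans (_ : r < _); last by [].
  rewrite /r lerD2r ler_wpM2l //.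
  have := bt 0%N j0 j j0j jn; rewrite x0.
  move: jnear j0near; rewrite !ler_norml => /andP[? ?] /andP[? ?]; lra.
- suff : [set` U] ((a j)^-1 * (v^-1 * w) * a m)%g by [].
  rewrite -UP /= -mulgA -(orbit_dist act_isom) metric_sym.
  by rewrite (actM act_isom (v^-1 * w)%g).
- by rewrite !mulgA mulgK mulgK mulgV mul1g.
Qed.

(** Three directions, because two prescribed points may each spoil one of them. *)
Definition diverging_triple (rho B1 : R) (a : nat -> G) (n : nat) (v : nat -> G) :=
  (forall i, (i < 3)%N -> d o (act (v i) o) <= rho) /\
  (forall i j, (i < 3)%N -> (j < 3)%N -> i <> j -> diverge act o B1 a n (v i) (v j)).

(** Pick the three elements one after the other in a ball that is larger than
    twice the bound of [few_fellow_travellers]. *)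
Lemma diverging_triple_exists :
  (forall C, 0 <= C -> exists (r : R) (s : seq G),
    [/\ 0 <= r, uniq s, forall h, h \in s -> d o (act h o) <= r & C * (r + 1) < (size s)%:R]) ->
  exists rho B1, [/\ 0 <= rho, 0 <= B1 & forall a n, piece act o Lam D Q a n ->
    B1 <= d o (act (a n) o) -> exists v, diverging_triple rho B1 a n v].
Proof.
move=> growth; have [C1 C10 few] := few_fellow_travellers.
have [[L0 D0'] Q0'] := (Lam0, D0, Q0).
have [rho [s [rho0 us srho sbig]]] := growth (2 * C1) ltac:(lra).
pose B0 := fork_depth rho.
have B00 : 0 <= B0 by rewrite /B0 /fork_depth; lra.
pose B1 := B0 + 2 * (D + Q) + 2 * rho + 2 * D + Q + Lam + 2 * (2 * rho) + 2 * D + Q + 1.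
exists rho, B1; split => //; first by rewrite /B1; lra.
move=> a n pa deep.
have deep0 : fork_depth rho <= d o (act (a n) o) by rewrite -/B0; rewrite /B1 in deep; lra.
pose P v w := `[< diverge act o B0 a n w v >].
have fewP v : v \in s -> (count (fun w => ~~ P v w) s)%:R <= C1 * (rho + 1).
  move=> vs; have := few rho a n v s rho0 pa deep0 (srho _ vs) us srho.
  by rewrite size_filter; congr (_%:R <= _); apply: eq_count => w; rewrite /P asbool_neg.
have C1rho : 0 <= C1 * (rho + 1) by rewrite mulr_ge0 //; lra.
have pick v w : v \in s -> w \in s -> exists2 u, u \in s & P v u /\ P w u.
  move=> vs ws; have [/hasP[u us' /andP[h1 h2]]|/hasPn none] := boolP (has (fun u => P v u && P w u) s).
    by exists u.
  have : (size s <= count (fun u => ~~ P v u) s + count (fun u => ~~ P w u) s)%N.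
    rewrite -count_predUI -(count_predT s); apply: leq_trans (leq_addr _ _).
    rewrite (eq_in_count (a2 := predU (fun u => ~~ P v u) (fun u => ~~ P w u))) //.
    by move=> u /none /=; rewrite negb_and.
  rewrite -(ler_nat R) natrD; have := fewP v vs; have := fewP w ws.
  by rewrite -mulrA in sbig; lra.
have [v0 v0s] : exists v0, v0 \in s.
  case: (s) sbig => [|x s' _]; last by exists x; rewrite mem_head.
  by rewrite -mulrA /=; lra.
have [v1 v1s [v01 _]] := pick v0 v0 v0s v0s.
have [v2 v2s [v02 v12]] := pick v0 v1 v0s v1s.
pose v i := match i with 0 => v0 | 1 => v1 | _ => v2 end.
have vs i : v i \in s by case: i => [|[|i]].
exists v; split=> [i _|i j i3 j3 ij]; first exact: srho.
have le01 : B0 <= B1 by rewrite /B1; lra.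
have near w u : w \in s -> u \in s -> d (act w o) (act u o) <= 2 * rho.
  move=> /srho h1 /srho h2; have := dist_triangle o (act w o) (act u o).
  by rewrite (metric_sym (act w o) o); lra.
have fwd w u : P w u -> diverge act o B1 a n u w.
  by move=> /asboolP h y /h; exact: projects_le.
have bwd w u : w \in s -> u \in s -> P w u -> diverge act o B1 a n w u.
  move=> ws us' /asboolP h.
  exact: (diverge_sym act_isom pa D0 Q0 Lam0 B00 (near u w us' ws) (erefl B1) deep h).
by case: i i3 ij => [|[|[|i]]] // _; case: j j3 => [|[|[|j]]] // _ _; (exact: fwd || exact: bwd).
Qed.

Lemma piece_forward (g : nat -> G) (s n : nat) (p := fun n => act (g n) o) :
  (forall n, d (p n) (p n.+1) <= Lam) ->
  (forall m n, (m <= n)%N -> (n - m)%:R <= Lam * d (p m) (p n) + Lam) ->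
  (forall i m j, (i <= m <= j)%N -> d (p i) (p m) + d (p m) (p j) <= d (p i) (p j) + Q) ->
  (forall s t, (s <= t)%N -> contracting D (seg p s t)) ->
  piece act o Lam D Q (fun i => (g s)^-1 * g (s + i)%N)%g n.
Proof.
move=> step low bt cs.
have pE i j : d (act ((g s)^-1 * g i)%g o) (act ((g s)^-1 * g j)%g o) = d (p i) (p j).
  by rewrite !(actM act_isom) (act_dist act_isom).
split.
- by rewrite addn0 mulVg.
- by move=> i _; rewrite pE addnS.
- by move=> i j /andP[ij _]; rewrite pE -(subnDl s); apply: low; rewrite leq_add2l.
- by move=> i m j ij jn; rewrite !pE; apply: bt; rewrite !leq_add2l.
- rewrite (_ : pts _ _ _ _ = act (g s)^-1%g @` seg p s (s + n)).
    by apply: contracting_act => //; apply: cs; rewrite leq_addr.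
  apply/seteqP; split => [_ [i i_n <-]|_ [_ [i i_n <-] <-]]; rewrite /= in i_n.
    by exists (p (s + i)%N); [exists (s + i)%N; rewrite //= leq_addr leq_add2l|rewrite (actM act_isom)].
  have /andP[si isn] := i_n.
  by exists (i - s)%N; rewrite /= ?leq_subLR // subnKC // (actM act_isom).
Qed.

Lemma piece_backward (g : nat -> G) (t n : nat) (p := fun n => act (g n) o) : (n <= t)%N ->
  (forall n, d (p n) (p n.+1) <= Lam) ->
  (forall m n, (m <= n)%N -> (n - m)%:R <= Lam * d (p m) (p n) + Lam) ->
  (forall i m j, (i <= m <= j)%N -> d (p i) (p m) + d (p m) (p j) <= d (p i) (p j) + Q) ->
  (forall s t, (s <= t)%N -> contracting D (seg p s t)) ->
  piece act o Lam D Q (fun i => (g t)^-1 * g (t - i)%N)%g n.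
Proof.
move=> nt step low bt cs.
have pE i j : d (act ((g t)^-1 * g i)%g o) (act ((g t)^-1 * g j)%g o) = d (p i) (p j).
  by rewrite !(actM act_isom) (act_dist act_isom).
split.
- by rewrite subn0 mulVg.
- move=> i i_n; rewrite pE metric_sym.
  by have := step (t - i.+1)%N; rewrite -subSn ?subSS // (leq_trans i_n).
- move=> i j /andP[ij jn]; rewrite pE metric_sym.
  have := low (t - j)%N (t - i)%N (leq_sub2l t ij).
  by rewrite subn_rev // ij (leq_trans jn nt).
- move=> i m j /andP[im mj] jn; rewrite !pE.
  have := bt (t - j)%N (t - m)%N (t - i)%N; rewrite !leq_sub2l // => /(_ isT).
  rewrite (metric_sym (p (t - j)%N) (p (t - m)%N)) (metric_sym (p (t - m)%N) (p (t - i)%N)).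
  by rewrite (metric_sym (p (t - j)%N)) addrC.
- rewrite (_ : pts _ _ _ _ = act (g t)^-1%g @` seg p (t - n) t).
    by apply: contracting_act => //; apply: cs; rewrite leq_subr.
  apply/seteqP; split => [_ [i i_n <-]|_ [_ [i i_n <-] <-]]; rewrite /= in i_n.
    by exists (p (t - i)%N); [exists (t - i)%N; rewrite //= leq_subr leq_sub2l|rewrite (actM act_isom)].
  have /andP[ni it] := i_n.
  have tin : (t - i <= n)%N by rewrite leq_subLR addnC -leq_subLR.
  by exists (t - i)%N; rewrite //= subKn // (actM act_isom).
Qed.

End Triple.

(** * Ping-pong *)

Section PingPong.
Context {R : realType} {G : groupType} {X : metricType R} (act : G -> X -> X).
Local Notation d := (@mdist R X).
Context (act_isom : isometric_action act) (o : X).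
Context (Lam D Q B : R) (a : nat -> G) (n : nat) (pa : piece act o Lam D Q a n).
Context (D0 : 0 <= D) (B0 : 0 <= B).
Local Notation A := (pts act o a n).
Local Notation e := (a n).
Context (long : 3 * B + 4 * D < d o (act e o)).

Context (T : eqType) (k : T -> G) (z : G).
Local Notation incoming := (act (z^-1 * e^-1)%g @` A).

Context (out_in : forall i y, (act (k i) @` A) y -> projects incoming (act z^-1%g o) B y).
Context (in_out : forall i y, incoming y -> projects (act (k i) @` A) (act (k i) o) B y).
Context (out_out : forall i j, i != j -> forall y, (act (k i) @` A) y ->
  projects (act (k j) @` A) (act (k j) o) B y).

(** The path of a product of letters follows the translate of the piece by
    [k i], jumps by [z], and goes on with the next letter; seen from the end of a
    letter, the piece just traversed is [incoming]. *)
Definition letter i := (k i * e * z)%g.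

(** The element that moves the piece to its last occurrence along the path of
    the word [i :: w]. *)
Fixpoint last_block i (w : seq T) : G :=
  if w is j :: w' then (letter i * last_block j w')%g else k i.

Lemma prod_last_block i w : (\prod_(j <- i :: w) letter j = last_block i w * e * z)%g.
Proof.
elim: w i => [|j w IH] i; first by rewrite big_seq1.
by rewrite big_cons IH /= !mulgA.
Qed.

Let A_start : A o. Proof. exact: (piece_start act_isom pa). Qed.
Let A_end : A (act e o). Proof. by exists n; rewrite //= leqnn. Qed.
Let cA : contracting D A. Proof. by case: pa. Qed.
Let hA : has_nearest A. Proof. exact: has_nearest_pts. Qed.

Let block_step (g h : G) (s t s' x : X) : A s -> d s t = d o (act e o) ->
  (forall y, (act h @` A) y -> projects (act g @` A) (act g t) B y) ->
  (forall y, (act g @` A) y -> projects (act h @` A) s' B y) ->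
  projects (act g @` A) (act g s) (B + D) x -> projects (act h @` A) s' (B + D) x.
Proof.
move=> As st hg gh.
have far : 3 * B + 4 * D < d (act g s) (act g t) by rewrite (act_dist act_isom) st.
have gs : (act g @` A) (act g s) by exists s.
exact: (chain_step D0 B0 (contracting_act act_isom cA) (contracting_act act_isom cA)
  (has_nearest_act act_isom g hA) (has_nearest_act act_isom h hA) gs far hg gh).
Qed.

Let letter_incoming i : act (letter i) @` incoming = act (k i) @` A.
Proof.
rewrite image_comp; apply: eq_imagel => x _ /=.
by rewrite -(actM act_isom) /letter !mulgA mulgK mulgK.
Qed.

Let step_forward i j x :
  projects (act (k i) @` A) (act (k i) o) (B + D) (act (letter i) x) ->
  projects (act (k j) @` A) (act (k j) o) (B + D) x.
Proof.
rewrite -letter_incoming.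
have -> : act (k i) o = act (letter i) (act (z^-1 * e^-1)%g o).
  by rewrite -(actM act_isom) /letter !mulgA mulgK mulgK.
move/(projects_act act_isom); apply: (block_step (t := act e o)) => //.
- by move=> y yj; rewrite -(actM act_isom) mulgVK; exact: out_in yj.
- exact: in_out.
Qed.

Let step_backward i j x :
  projects (act (k j) @` A) (act (k j * e)%g o) (B + D) x ->
  projects (act (k i) @` A) (act (k i * e)%g o) (B + D) (act (letter i) x).
Proof.
move=> near; rewrite -letter_incoming.
have -> : act (k i * e)%g o = act (letter i) (act z^-1%g o).
  by rewrite -(actM act_isom) /letter mulgK.
apply/(projects_act act_isom).
move: near; rewrite (actM act_isom (k j)); apply: (block_step (t := o)) => //.
- by rewrite metric_sym.
- exact: in_out.
- exact: out_in.
Qed.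

Let turn i j x : i != j ->
  projects (act (k i) @` A) (act (k i * e)%g o) (B + D) x ->
  projects (act (k j) @` A) (act (k j) o) (B + D) x.
Proof.
move=> ij; rewrite (actM act_isom (k i)); apply: (block_step (t := o)) => //.
- by rewrite metric_sym.
- by apply: out_out; rewrite eq_sym.
- exact: out_out.
Qed.

Let to_last_block w i x : projects (act (k i) @` A) (act (k i) o) (B + D) x ->
  projects (act (last_block i w) @` A) (act (last_block i w) o) (B + D) x.
Proof.
elim: w i x => [//|j w IH] i x near /=.
have im h : act (letter i * h)%g @` A = act (letter i) @` (act h @` A).
  by rewrite image_comp; apply: eq_imagel => y _; rewrite /= (actM act_isom).
rewrite im (actM act_isom) -(actKV act_isom (letter i) x).
apply/(projects_act act_isom); apply: IH; apply: (step_forward (i := i)).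
by rewrite (actKV act_isom).
Qed.

Let from_last_block w i : projects (act (k i) @` A) (act (k i * e)%g o) (B + D)
  (act (last_block i w * e)%g o).
Proof.
elim: w i => [|j w IH] i /=; last first.
  by rewrite -mulgA (actM act_isom (letter i)); apply: step_backward (IH j).
apply: (@projects_le _ _ _ _ 0); first by rewrite addr_ge0.
by apply: projects_self; rewrite (actM act_isom); exists (act e o).
Qed.

(** Cancel the common prefix of the two words.  Follow the first word backwards
    from its endpoint to its first letter, turn, and follow the second word:
    these pieces form a chain.  So the endpoint projects near the start of the
    last piece of the second word, although it is its end. *)
Theorem letters_free (w w' : seq T) : size w = size w' ->
  (\prod_(i <- w) letter i = \prod_(i <- w') letter i)%g -> w = w'.
Proof.
elim: w w' => [|i w IH] [|j w'] //= [sw] eprod.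
have [ij|ij] := eqVneq i j.
  by move: eprod; rewrite ij !big_cons => /mulgI /(IH _ sw) ->.
exfalso; move: eprod; rewrite !prod_last_block => /mulIg lastE.
have := to_last_block (w := w') (turn ij (from_last_block (w := w) (i := i))); rewrite lastE => near.
have endA : (act (last_block j w') @` A) (act (last_block j w' * e)%g o).
  by rewrite (actM act_isom); exists (act e o).
have := projects_self_far endA near; rewrite (actM act_isom).
rewrite (act_dist act_isom) metric_sym.
have := long; have := D0; have := B0; lra.
Qed.

End PingPong.

(** * Choosing the segments *)

Section Sites.
Context {R : realType} {G : groupType} {X : metricType R} (act : G -> X -> X).
Local Notation d := (@mdist R X).
Context (act_isom : isometric_action act) (act_proper : proper_action act) (o : X).

(** A set that stays near [z] and far from [A] projects to [A] where [z] does. *)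
Lemma far_set_projects (D B r : R) (E A : set X) (b z : X) :
  contracting D A -> has_nearest A -> projects A b B z ->
  (forall x, E x -> d x z <= r) -> (forall x q, E x -> A q -> r + D < d x q) ->
  forall x, E x -> projects A b (B + D) x.
Proof.
move=> cA hA zb Er far x Ex p np; rewrite leNgt; apply/negP => bad.
have [q nq] := hA z; have qb := zb q nq.
have := cA x z p q np nq; have := dist_triangle q p b.
have := far x p Ex np.1; have := Er x Ex; have := mdist_ge0 p q; have := mdist_ge0 q z.
by move=> h1 h2 h3 h4 h5 /(_ ltac:(lra)); lra.
Qed.

(** If two points of [Y] had distant projections to [A], a geodesic between them
    would pass near [A]; but it stays near [Y], which is far from [A]. *)
Lemma quasi_convex_projects (injX : injective_space X) (D B eta : R) (A Y : set X) (b y0 : X) :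
  0 <= D -> contracting D A -> has_nearest A ->
  (forall (s t : R) (c : R -> X), s <= t -> geodesic d `[s, t] c -> Y (c s) -> Y (c t) ->
     c @` `[s, t] `<=` nbhd d eta Y) ->
  (forall x y, A x -> Y y -> 3 * D + eta < d x y) ->
  Y y0 -> projects A b B y0 -> forall y, Y y -> projects A b (B + 2 * D) y.
Proof.
move=> D0 cA hA Yqc far Yy0 y0b y Yy p np; rewrite leNgt; apply/negP => bad.
have [q nq] := hA y0; have qb := y0b q nq.
have pq : 2 * D < d p q by have := dist_triangle q p b; lra.
have h1 := cA y y0 p q np nq ltac:(lra).
have [c [gc c0 cL]] := geodesic_exists injX y y0.
have L0 := mdist_ge0 y y0; have yp0 := mdist_ge0 y p; have qy0 := mdist_ge0 q y0.
have ypL : d y p <= d y y0 by lra.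
have [y' Yy' zy'] : nbhd d eta Y (c (d y p)).
  apply: (Yqc 0 (d y y0) c L0 gc); rewrite ?c0 ?cL //.
  by exists (d y p) => //; rewrite /= in_itv /= yp0.
set z := c (d y p) in zy'.
have dyz : d y z = d y p by rewrite -{1}c0 (geodesic_dist gc) // subr0.
have dzy0 : d z y0 = d y y0 - d y p by rewrite -{1}cL (geodesic_dist gc).
have [z' nz'] := hA z.
have pz' : d p z' <= D.
  rewrite leNgt; apply/negP => big; have := cA y z p z' np nz' big.
  by have := mdist_ge0 z' z; rewrite dyz; lra.
have z'q : D < d z' q by have := dist_triangle z' p q; lra.
have h2 := cA z y0 z' q nz' nq z'q.
have := dist_triangle p y y0; have := dist_triangle q p y0 => h3 h4.
have := dist_triangle z' p z; have := dist_triangle z p y'; have := far p y' np.1 Yy'.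
have := dist_triangle z' p q.
rewrite (metric_sym z' z); lra.
Qed.

Context (Lam D Q : R).

(** If [x] projected far from the start of both copies, then each of the two
    projections would be closer to [x] than the other. *)
Lemma diverge_choice (B : R) a n v w x : piece act o Lam D Q a n ->
  diverge act o B a n v w -> diverge act o B a n w v ->
  projects (act v @` pts act o a n) (act v o) (B + D) x \/
  projects (act w @` pts act o a n) (act w o) (B + D) x.
Proof.
move=> [_ _ _ _ cA] dvw dwv; apply: contrapT => /not_orP[nv nw].
have nearer (v1 w1 : G) : diverge act o B a n w1 v1 ->
    ~ projects (act v1 @` pts act o a n) (act v1 o) (B + D) x ->
    forall q, nearest (act w1 @` pts act o a n) x q ->
    exists2 p, nearest (act v1 @` pts act o a n) x p & d x p < d x q.
  move=> dd /existsNP[p /not_implyP[np /negP]]; rewrite -ltNge => far q nq.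
  exists p => //.
  have [u nu] := has_nearest_act act_isom v1 (has_nearest_pts act o a n) q.
  have := dd q nq.1 u nu; have := dist_triangle u p (act v1 o).
  have := contracting_act act_isom cA np nu; have := mdist_ge0 u q.
  by move=> h1 h2 h3 h4; have := h2 ltac:(lra); lra.
have [q nq] := has_nearest_act act_isom w (has_nearest_pts act o a n) x.
have [p np pq] := nearer v w dwv nv q nq.
have [q' nq' q'p] := nearer w v dvw nw p np.
by have := nq.2 q' nq'.1; lra.
Qed.

(** By [diverge_choice] each of the two points excludes at most one of the three
    directions. *)
Lemma diverging_triple_choice (rho B : R) a n v x y : piece act o Lam D Q a n ->
  diverging_triple act o rho B a n v -> exists w, [/\ d o (act w o) <= rho,
    projects (act w @` pts act o a n) (act w o) (B + D) x &
    projects (act w @` pts act o a n) (act w o) (B + D) y].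
Proof.
move=> pa [vrho vdiv].
pose good i x0 := projects (act (v i) @` pts act o a n) (act (v i) o) (B + D) x0.
have pair i j x0 : (i < 3)%N -> (j < 3)%N -> i <> j -> good i x0 \/ good j x0.
  by move=> i3 j3 ij; apply: (diverge_choice x0 pa); apply: vdiv => //; exact: nesym.
suff [i [i3 gx gy]] : exists i, [/\ (i < 3)%N, good i x & good i y].
  by exists (v i); split=> //; exact: vrho.
have [g0|b0] := pselect (good 0%N x /\ good 0%N y); first by case: g0; exists 0%N.
have third x0 y0 : ~ good 0%N x0 -> exists i, [/\ (i < 3)%N, good i x0 & good i y0].
  move=> n0; have [//|g1] := pair 0%N 1%N x0 isT isT ltac:(by []).
  have [//|g2] := pair 0%N 2%N x0 isT isT ltac:(by []).
  by have [h|h] := pair 1%N 2%N y0 isT isT ltac:(by []); [exists 1%N|exists 2%N].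
move/not_andP: b0 => [b0|b0]; first exact: third.
by have [i [i3 gy gx]] := third y x b0; exists i.
Qed.

Context (D0 : 0 <= D).

(** Letters whose pieces start near the points [act (u i) y0], while the piece
    of the inverse letters starts near [act u' y0].  When these points are far
    apart, it is enough to know how they project to the pieces, since a whole
    piece projects like the point next to its start ([far_set_projects]). *)
Theorem sites_free (T : eqType) (u v : T -> G) (u' w : G) (y0 : X) (B r : R)
    (a a' : nat -> G) (n : nat) :
  0 <= B -> piece act o Lam D Q a n -> piece act o Lam D Q a' n ->
  pts act o a' n = act (a n)^-1%g @` pts act o a n ->
  3 * (B + D) + 4 * D < d o (act (a n) o) ->
  (forall i x, pts act o a n x -> d y0 (act (v i) x) <= r) ->
  (forall x, pts act o a' n x -> d y0 (act w x) <= r) ->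
  (forall i j, i != j ->
     projects (act (v j) @` pts act o a n) (act (v j) o) B (act ((u j)^-1 * u i)%g y0)) ->
  (forall i, projects (act (v i) @` pts act o a n) (act (v i) o) B (act ((u i)^-1 * u')%g y0)) ->
  (forall i, projects (act w @` pts act o a' n) (act w o) B (act (u'^-1 * u i)%g y0)) ->
  (forall i j, i != j -> 3 * r + D < d (act (u i) y0) (act (u j) y0)) ->
  (forall i, 3 * r + D < d (act (u i) y0) (act u' y0)) ->
  forall s s' : seq T, size s = size s' ->
    (\prod_(i <- s) (u i * v i * a n * w^-1 * u'^-1) =
     \prod_(i <- s') (u i * v i * a n * w^-1 * u'^-1))%g -> s = s'.
Proof.
move=> B0 pa pa' aa' long vr wr pij pi' pw farij fari' s s' ss' eprod.
have [_ _ _ _ cA] := pa; have [_ _ _ _ cA'] := pa'.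
have hA := has_nearest_pts act o a n; have hA' := has_nearest_pts act o a' n.
have far (h1 h2 v1 v2 : G) (E1 E2 : set X) : (forall x, E1 x -> d y0 (act v1 x) <= r) ->
    (forall x, E2 x -> d y0 (act v2 x) <= r) ->
    3 * r + D < d (act h1 y0) (act h2 y0) ->
    forall x q, (act (h1 * v1)%g @` E1) x -> (act (h2 * v2)%g @` E2) q -> r + D < d x q.
  move=> b1 b2 h12 _ _ [x xE <-] [q qE <-]; rewrite !(actM act_isom).
  have := b1 x xE; rewrite -(act_dist act_isom h1) => b1'.
  have := b2 q qE; rewrite -(act_dist act_isom h2) => b2'.
  have := dist_triangle (act h1 (act v1 x)) (act h1 y0) (act h2 y0).
  have := dist_triangle (act h2 (act v2 q)) (act h1 (act v1 x)) (act h2 y0).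
  by rewrite (metric_sym (act h2 (act v2 q)) (act h2 y0)); lra.
have close (h1 v1 : G) (E1 : set X) : (forall x, E1 x -> d y0 (act v1 x) <= r) ->
    forall x, (act (h1 * v1)%g @` E1) x -> d x (act h1 y0) <= r.
  move=> b1 _ [x xE <-]; rewrite (actM act_isom) metric_sym (act_dist act_isom); exact: b1.
have moved (h1 h2 v2 : G) (E2 : set X) :
    projects (act v2 @` E2) (act v2 o) B (act (h2^-1 * h1)%g y0) ->
    projects (act (h2 * v2)%g @` E2) (act (h2 * v2)%g o) B (act h1 y0).
  move=> pr; have -> : act (h2 * v2)%g @` E2 = act h2 @` (act v2 @` E2).
    by rewrite image_comp; apply: eq_imagel => x _; rewrite /= (actM act_isom).
  have -> : act h1 y0 = act h2 (act (h2^-1 * h1)%g y0) by rewrite -(actM act_isom) mulVKg.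
  by rewrite (actM act_isom h2); apply/(projects_act act_isom).
have sites (h1 h2 v1 v2 : G) (E1 E2 : set X) : contracting D E2 -> has_nearest E2 ->
    (forall x, E1 x -> d y0 (act v1 x) <= r) -> (forall x, E2 x -> d y0 (act v2 x) <= r) ->
    projects (act v2 @` E2) (act v2 o) B (act (h2^-1 * h1)%g y0) ->
    3 * r + D < d (act h1 y0) (act h2 y0) ->
    forall x, (act (h1 * v1)%g @` E1) x ->
      projects (act (h2 * v2)%g @` E2) (act (h2 * v2)%g o) (B + D) x.
  move=> c2 n2 b1 b2 pr h12.
  apply: (far_set_projects (contracting_act act_isom c2) (has_nearest_act act_isom _ n2)
    (moved h1 h2 v2 E2 pr) (close h1 v1 E1 b1)).
  exact: far h12.
have BD0 : 0 <= B + D by rewrite addr_ge0.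
pose k i := (u i * v i)%g; pose z := (w^-1 * u'^-1)%g.
have zV : (z^-1 = u' * w)%g by rewrite /z invgM !invgK.
have incE : act (z^-1 * (a n)^-1)%g @` pts act o a n = act (u' * w)%g @` pts act o a' n.
  by rewrite zV aa' image_comp; apply: eq_imagel => x _; rewrite /= -(actM act_isom).
have letE i : (u i * v i * a n * w^-1 * u'^-1)%g = letter a n k z i.
  by rewrite /letter /k /z !mulgA.
apply: (letters_free act_isom pa D0 BD0 long (k := k) (z := z)) => //.
- move=> i y yk; rewrite incE zV; apply: (sites (u i) u' (v i) w _ _ cA' hA' (vr i) wr (pw i)).
    exact: fari'.
  exact: yk.
- move=> i y; rewrite incE => yk.
  apply: (sites u' (u i) w (v i) _ _ cA hA wr (vr i) (pi' i)) yk.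
  by rewrite metric_sym.
- move=> i j ij y yk.
  exact: (sites (u i) (u j) (v i) (v j) _ _ cA hA (vr i) (vr j) (pij i j ij) (farij i j ij)) yk.
- by move: eprod; under eq_bigr => i _ do rewrite letE; under [in RHS]eq_bigr => i _ do rewrite letE.
Qed.

End Sites.

Section FreeFamilies.
Context {R : realType} {G : groupType} {X : metricType R} (act : G -> X -> X).
Local Notation d := (@mdist R X).
Context (act_isom : isometric_action act) (act_proper : proper_action act) (o : X).

(** Otherwise the orbit of [o] would be near that of [H], leaving finitely many
    cosets. *)
Lemma far_from_subgroup (H : groupClosed G) (Y : set X) (K : R) :
  ~ finite_index [set` H] -> cobounded_on act [set` H] Y ->
  exists u, forall y, Y y -> K < d (act u o) y.
Proof.
move=> infH [p0 _ [C CP]]; apply: contrapT => none; apply: infH.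
have near u : exists2 y, Y y & d (act u o) y <= K.
  apply: contrapT => no; apply: none; exists u => y Yy.
  by rewrite ltNge; apply/negP => h; apply: no; exists y.
pose F := [set g | d o (act g o) <= K + C + d p0 o].
have finF : finite_set F := orbit_ball_finite act_proper o _.
rewrite /finite_index; apply: (@sub_finite_set _ _
  ((fun g => [set (g^-1 * h)%g | h in [set` H]]) @` F)); last exact: finite_image.
move=> _ [x _ <-].
have [y Yy xy] := near x^-1%g; have [h Hh yh] := CP y Yy.
exists (h^-1 * x^-1)%g.
  rewrite /F /= -(orbit_dist act_isom) metric_sym.
  have := dist_triangle y (act x^-1%g o) (act h o); have := dist_triangle (act h p0) y (act h o).
  by rewrite (act_dist act_isom); lra.
rewrite invgM !invgK; apply/seteqP; split => [_ [h' Hh' <-]|_ [h' Hh' <-]].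
  by exists (h * h')%g; rewrite ?mulgA //=; apply: gpredM.
exists (h^-1 * h')%g; last by rewrite -mulgA mulVKg.
by rewrite /=; apply: gpredM => //; apply: gpredVr.
Qed.

Context (g : nat -> G) (Lam D Q : R).
Local Notation p := (fun n => act (g n) o).
Context (Lam1 : 1 <= Lam) (D0 : 0 <= D) (Q0 : 0 <= Q).
Context (pstep : forall n, d (p n) (p n.+1) <= Lam).
Context (plow : forall m n, (m <= n)%N -> (n - m)%:R <= Lam * d (p m) (p n) + Lam).
Context (bt : forall i m j, (i <= m <= j)%N ->
  d (p i) (p m) + d (p m) (p j) <= d (p i) (p j) + Q).
Context (cs : forall s t, (s <= t)%N -> contracting D (seg p s t)).

Let Lam0 : 0 <= Lam. Proof. by have := Lam1; lra. Qed.

Lemma far_along_seq (l : R) : exists N, forall m n, (m + N <= n)%N -> l < d (p m) (p n).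
Proof.
have [N _ NP] := exists_nat_gt (Lam * l + Lam).
exists N => m n mn; rewrite ltNge; apply/negP => small.
have := plow (leq_trans (leq_addr N m) mn); have := ler_wpM2l Lam0 small.
have : N%:R <= (n - m)%:R :> R by rewrite ler_nat leq_subRL // (leq_trans (leq_addr N m)).
lra.
Qed.

(** The same stretch of the sequence read in both directions: the reversed piece
    is what the ping-pong sees when it looks back along a letter. *)
Lemma long_pieces (l : R) : exists (a a' : nat -> G) (n : nat),
  [/\ piece act o Lam D Q a n, piece act o Lam D Q a' n,
      pts act o a' n = act (a n)^-1%g @` pts act o a n,
      l < d o (act (a n) o) & d o (act (a' n) o) = d o (act (a n) o)].
Proof.
have [n nP] := far_along_seq l.
exists (fun i => (g 0%N)^-1 * g (0 + i)%N)%g, (fun i => (g n)^-1 * g (n - i)%N)%g, n.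
split.
- exact: piece_forward.
- exact: piece_backward.
- apply/seteqP; split => [_ [i i_n <-]|_ [_ [i i_n <-] <-]]; rewrite /= in i_n.
    exists (act ((g 0%N)^-1 * g (0 + (n - i))%N)%g o); first by exists (n - i)%N; rewrite //= leq_subr.
    by rewrite -(actM act_isom) !add0n invgM invgK -mulgA mulVKg.
  exists (n - i)%N; first by rewrite /= leq_subr.
  by rewrite -(actM act_isom) subKn // add0n invgM invgK -mulgA mulVKg.
- by rewrite add0n -(orbit_dist act_isom); apply: nP.
- by rewrite add0n subnn -!(orbit_dist act_isom) metric_sym.
Qed.

Lemma pts_bounded (a : nat -> G) n : exists2 L, 0 <= L & forall x, pts act o a n x -> d o x <= L.
Proof.
have [L L0 LP] := finite_upper_bound (fun i => d o (act (a i) o)) (finite_II n.+1).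
by exists L => // _ [i i_n <-]; apply: LP; rewrite /= ltnS.
Qed.

Context (nvc : ~ virtually_cyclic G).

Lemma triples_exist : exists rho B1, [/\ 0 <= rho, 0 <= B1 & forall a n,
  piece act o Lam D Q a n -> B1 <= d o (act (a n) o) ->
  exists v, diverging_triple act o rho B1 a n v].
Proof.
have [f finf] := infinite_order_element act_isom act_proper Q0 D0 Lam0 pstep plow bt cs.
apply: diverging_triple_exists => // C C0.
exact: (superlinear_growth act_isom o finf nvc C0).
Qed.

(** Three points far apart along the sequence serve as sites: two for the first
    pieces of the two letters and one for their common incoming piece.  At each
    site the direction is chosen so that the other two sites project near the
    start of the piece. *)
Theorem free_pair : exists f : bool -> G, forall s s' : seq bool, size s = size s' ->
  (\prod_(i <- s) f i = \prod_(i <- s') f i)%g -> s = s'.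
Proof.
have D0_ := D0.
have [rho [B1 [rho0 B10 trip]]] := triples_exist.
pose B := B1 + D.
have B0 : 0 <= B by rewrite /B; lra.
have [a [a' [n [pa pa' aa' long eqlong]]]] := long_pieces (B1 + (3 * (B + D) + 4 * D)).
have [v vP] := trip a n pa ltac:(rewrite /B in long *; lra).
have [w wP] := trip a' n pa' ltac:(rewrite /B in long *; lra).
have [L1 L10 L1P] := pts_bounded a n; have [L2 L20 L2P] := pts_bounded a' n.
pose r := rho + L1 + L2.
have [N NP] := far_along_seq (3 * r + D).
pose U i := g (i * N)%N.
have farU i j : (i < j)%N -> 3 * r + D < d (act (U i) o) (act (U j) o).
  by move=> ij; apply: NP; rewrite -mulSnr leq_mul2r ij orbT.
have bound h x L : d o (act h o) <= rho -> d o x <= L -> d o (act h x) <= rho + L.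
  move=> hr xL; have := dist_triangle (act h o) o (act h x); rewrite (act_dist act_isom); lra.
have [v1 [v1r v1a v1b]] := diverging_triple_choice act_isom
  (act ((U 0%N)^-1 * U 1%N)%g o) (act ((U 0%N)^-1 * U 2%N)%g o) pa vP.
have [v2 [v2r v2a v2b]] := diverging_triple_choice act_isom
  (act ((U 1%N)^-1 * U 0%N)%g o) (act ((U 1%N)^-1 * U 2%N)%g o) pa vP.
have [w1 [w1r w1a w1b]] := diverging_triple_choice act_isom
  (act ((U 2%N)^-1 * U 0%N)%g o) (act ((U 2%N)^-1 * U 1%N)%g o) pa' wP.
pose u (b : bool) := if b then U 0%N else U 1%N; pose vb (b : bool) := if b then v1 else v2.
exists (fun b => u b * vb b * a n * w1^-1 * (U 2%N)^-1)%g.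
apply: (sites_free act_isom D0 (y0 := o) (r := r) B0 pa pa' aa').
- by lra.
- by move=> i x /L1P xL; have := bound _ _ _ v1r xL; have := bound _ _ _ v2r xL; case: i => /=; rewrite /r; lra.
- by move=> x /L2P xL; have := bound _ _ _ w1r xL; rewrite /r; lra.
- by case=> [] [] //= _.
- by case.
- by case.
- by case=> [] [] //= _; [|rewrite metric_sym]; apply: farU.
- by case; apply: farU.
Qed.

(** Conjugating [H] by [u] moves its orbit far away from [o], so that the whole
    orbit projects to the pieces at [o] near their starts once one of its points
    does.  The sites are the images of such a point under the conjugates of the
    [h i], and the incoming piece is at [o]. *)
Theorem free_subgroup_family (injX : injective_space X) (H : groupClosed G) :
  ~ finite_index [set` H] -> quasi_convex act [set` H] ->
  exists (c1 c2 : G) (rr : R), forall (T : eqType) (h : T -> G),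
    (forall i, h i \in H) -> (forall i, rr < d o (act (h i) o)) ->
    (forall i j, i != j -> rr < d (act (h i) o) (act (h j) o)) ->
    forall s s' : seq T, size s = size s' ->
    (\prod_(i <- s) (c1 * h i * c2) = \prod_(i <- s') (c1 * h i * c2))%g -> s = s'.
Proof.
move=> infH [Y [[y1 Yy1] Yinv Ycob [eta eta0 Yqc]]].
have D0_ := D0.
have [rho [B1 [rho0 B10 trip]]] := triples_exist.
pose B := B1 + D + 2 * D.
have B0 : 0 <= B by rewrite /B; lra.
have [a [a' [n [pa pa' aa' long eqlong]]]] := long_pieces (B1 + (3 * (B + D) + 4 * D)).
have [v0 vP] := trip a n pa ltac:(lra).
have [w0 wP] := trip a' n pa' ltac:(lra).
have [L1 L10 L1P] := pts_bounded a n; have [L2 L20 L2P] := pts_bounded a' n.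
pose L := L1 + L2.
have [u uP] := far_from_subgroup (rho + L + 3 * D + eta) infH Ycob.
pose Y' := act u^-1%g @` Y; pose y0 := act u^-1%g y1.
have Y'y0 : Y' y0 by exists y1.
have Y'qc (s t : R) (c : R -> X) : s <= t -> geodesic d `[s, t] c -> Y' (c s) -> Y' (c t) ->
    c @` `[s, t] `<=` nbhd d eta Y'.
  move=> st gc [y ys ysE] [y2 yt ytE] _ [tau tauI <-].
  have [|||y' Yy' close] := Yqc s t (fun x => act u (c x)) st _ _ _ (act u (c tau)) (ex_intro2 _ _ tau tauI erefl).
  - by move=> x1 x2 x1I x2I; rewrite (act_dist act_isom); exact: gc.
  - by rewrite -ysE (actKV act_isom).
  - by rewrite -ytE (actKV act_isom).
  by exists (act u^-1%g y'); [exists y'|rewrite -(act_dist act_isom u) (actKV act_isom)].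
have bound h x Lb : d o (act h o) <= rho -> d o x <= Lb -> d o (act h x) <= rho + Lb.
  move=> hr xL; have := dist_triangle (act h o) o (act h x); rewrite (act_dist act_isom); lra.
have farY x y : d o x <= rho + L -> Y' y -> 3 * D + eta < d x y.
  move=> xL [y' Yy' <-]; have := uP y' Yy'; rewrite (act_distl act_isom) => h.
  by have := dist_triangle x o (act u^-1%g y'); lra.
have [v [vr vy _]] := diverging_triple_choice act_isom y0 y0 pa vP.
have [w [wr wy _]] := diverging_triple_choice act_isom y0 y0 pa' wP.
have [_ _ _ _ cA] := pa; have [_ _ _ _ cA'] := pa'.
have vY y : Y' y -> projects (act v @` pts act o a n) (act v o) B y.
  apply: (quasi_convex_projects injX D0 (contracting_act act_isom cA)
    (has_nearest_act act_isom v (has_nearest_pts act o a n)) Y'qc _ Y'y0 vy).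
  move=> _ y2 [x xA <-] Yy; apply: farY => //.
  by have := bound v x _ vr (L1P x xA); rewrite /L; lra.
have wY y : Y' y -> projects (act w @` pts act o a' n) (act w o) B y.
  apply: (quasi_convex_projects injX D0 (contracting_act act_isom cA')
    (has_nearest_act act_isom w (has_nearest_pts act o a' n)) Y'qc _ Y'y0 wy).
  move=> _ y2 [x xA <-] Yy; apply: farY => //.
  by have := bound w x _ wr (L2P x xA); rewrite /L; lra.
pose r := d y0 o + rho + L; pose ry := d (act u y0) o.
exists u^-1%g, (u * v * a n * w^-1)%g, (3 * r + D + 2 * ry) => T h hH hfar hpair s s' ss' eprod.
pose ui i := (u^-1 * h i * u)%g.
have far_move h1 h2 : 3 * r + D + 2 * ry < d (act h1 o) (act h2 o) ->
    3 * r + D < d (act (u^-1 * h1 * u)%g y0) (act (u^-1 * h2 * u)%g y0).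
  rewrite !(actM act_isom) (act_dist act_isom) => far.
  have := dist_triangle (act h1 (act u y0)) (act h1 o) (act h2 o).
  have := dist_triangle (act h2 (act u y0)) (act h1 (act u y0)) (act h2 o).
  have e1 : d (act h1 o) (act h1 (act u y0)) = ry by rewrite (act_dist act_isom) metric_sym.
  have e2 : d (act h2 (act u y0)) (act h2 o) = ry by rewrite (act_dist act_isom).
  by rewrite e1 e2; lra.
have Y'inv h1 y : h1 \in H -> Y' y -> Y' (act (u^-1 * h1 * u)%g y).
  move=> h1H [y' Yy' <-]; exists (act h1 y'); first exact: Yinv.
  by rewrite -!(actM act_isom) mulgK.
apply: (sites_free act_isom D0 (u := ui) (v := fun=> v) (u' := 1%g) (w := w) (y0 := y0)
  (r := r) B0 pa pa' aa' _ _ _ _ _ _ _ _ ss').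
- by lra.
- move=> _ x /L1P xL; have := bound _ _ _ vr xL; have := dist_triangle o y0 (act v x).
  by rewrite /r /L; lra.
- move=> x /L2P xL; have := bound _ _ _ wr xL; have := dist_triangle o y0 (act w x).
  by rewrite /r /L; lra.
- move=> i j ij; apply: vY.
  have -> : ((ui j)^-1 * ui i = u^-1 * ((h j)^-1 * h i) * u)%g.
    by rewrite /ui !invgM invgK !mulgA mulgK.
  by apply: Y'inv => //; apply: gpredM => //; apply: gpredVr.
- move=> i; apply: vY; have -> : ((ui i)^-1 * 1 = u^-1 * (h i)^-1 * u)%g.
    by rewrite /ui !invgM invgK mulg1 mulgA.
  by apply: Y'inv => //; apply: gpredVr.
- by move=> i; apply: wY; rewrite invg1 mul1g; apply: Y'inv.
- by move=> i j ij; apply: far_move; apply: hpair.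
- move=> i; have -> : act 1%g y0 = act (u^-1 * 1 * u)%g y0 by rewrite mulg1 mulVg.
  apply: far_move.
  by rewrite (act1 act_isom) metric_sym.
- have E i : (ui i * v * a n * w^-1 * 1^-1 = u^-1 * h i * (u * v * a n * w^-1))%g.
    by rewrite /ui invg1 mulg1 !mulgA.
  by move: eprod; under eq_bigr => i _ do rewrite -E; under [in RHS]eq_bigr => i _ do rewrite -E.
Qed.

End FreeFamilies.

(** * Growth rates and free families *)

Section Growth.
Context {R : realType} {G : groupType} {X : metricType R} (act : G -> X -> X).
Local Notation d := (@mdist R X).
Context (act_isom : isometric_action act) (act_proper : proper_action act) (o : X).

Definition ball_count (A : set G) (r : R) : nat :=
  #|` fset_set [set a | A a /\ d o (act a o) <= r]|.

Lemma orbit_ball_finiteI (A : set G) (r : R) : finite_set [set a | A a /\ d o (act a o) <= r].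
Proof. by apply: sub_finite_set (orbit_ball_finite act_proper o r) => a []. Qed.

Lemma ball_count_ge (A : set G) (r : R) (s : seq G) : uniq s ->
  (forall h, h \in s -> A h /\ d o (act h o) <= r) -> (size s <= ball_count A r)%N.
Proof.
move=> us sA; apply: uniq_leq_size => // h /sA hA.
by rewrite in_fset_set ?inE //; exact: orbit_ball_finiteI.
Qed.

Lemma ball_count_le (A : set G) (r : R) (s : seq G) :
  (forall h, A h -> d o (act h o) <= r -> h \in s) -> (ball_count A r <= size s)%N.
Proof.
move=> sA; apply: uniq_leq_size => // h.
by rewrite in_fset_set ?inE; [move=> [] /sA|exact: orbit_ball_finiteI].
Qed.

Lemma growth_rate_le (A : set G) (r0 s : R) :
  (forall r, r0 < r -> r^-1 * ln (ball_count A r)%:R <= s) -> (growth_rate act o A <= s%:E)%E.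
Proof.
move=> h; apply: ereal_inf_le; eexists; first exists [set r | r0 < r]; [|reflexivity|].
  by exists r0; split; [exact: num_real|].
by apply: ge_ereal_sup => _ [r rr0 <-]; rewrite lee_fin; exact: h.
Qed.

Lemma growth_rate_lt (A : set G) (s : R) : 0 <= s -> A 1%g -> (growth_rate act o A < s%:E)%E ->
  exists2 K, 0 <= K & forall r, 0 <= r -> (ball_count A r)%:R <= K * expR (s * r).
Proof.
move=> s0 A1 /ereal_inf_lt[_ [V [r0 [_ r0V]] <-] Vs].
pose r1 := Num.max r0 0 + 1.
have r10 : 0 < r1 by rewrite /r1 ltr_wpDl // le_max lexx orbT.
have r01 : r0 < r1 by rewrite /r1 ltr_pwDr // le_max lexx.
have count1 r : 0 <= r -> 0 < (ball_count A r)%:R :> R.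
  move=> r_0; rewrite ltr0n; apply: (@ball_count_ge _ _ [:: 1%g]) => // h.
  by rewrite inE => /eqP ->; split => //; rewrite (act1 act_isom) mdistxx.
have big r : r1 <= r -> (ball_count A r)%:R <= expR (s * r).
  move=> rr; have r_0 : 0 < r by apply: lt_le_trans rr.
  have : ((r^-1 * ln (ball_count A r)%:R)%:E <= s%:E)%E.
    apply: le_trans (ltW Vs); apply: ereal_sup_ubound; exists r => //.
    by apply: r0V; apply: lt_le_trans rr.
  rewrite lee_fin mulrC ler_pdivrMr // => h.
  by rewrite -[leLHS]lnK ?posrE ?count1 ?(ltW r_0) // ler_expR.
exists (expR (s * r1)) => [|r r_0]; first exact: expR_ge0.
have mono : (ball_count A r <= ball_count A (r + r1))%N.
  apply: ball_count_ge; first exact: fset_uniq.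
  move=> h; rewrite in_fset_set ?inE; last exact: orbit_ball_finiteI.
  by move=> [Ah hr]; split=> //; lra.
rewrite -expRD -mulrDr addrC; apply: le_trans (big _ _); last by rewrite lerDr.
by rewrite ler_nat.
Qed.

Lemma bernoulli (x : R) n : 0 <= x -> 1 + n%:R * x <= (1 + x) ^+ n.
Proof.
move=> x0; elim: n => [|n IH]; first by rewrite mul0r addr0 expr0.
rewrite exprS natS_mulr; have n0 : 0 <= n%:R * x by rewrite mulr_ge0.
have := ler_wpM2l (_ : 0 <= 1 + x) IH; rewrite mulrDr mulr1 mulrDl mul1r => /(_ ltac:(lra)).
by have : 0 <= x * (n%:R * x) by [rewrite mulr_ge0]; lra.
Qed.

Lemma exponential_beats_linear (x a b : R) : 1 < x -> 0 <= a -> 0 <= b ->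
  exists n, n%:R * a + b < x ^+ n.
Proof.
move=> x1 a0 b0; pose y := x - 1; have y0 : 0 < y by rewrite /y; lra.
have y20 : 0 < y ^+ 2 by rewrite exprn_gt0.
have [k k0 kP] := exists_nat_gt ((2 * a + b) / y ^+ 2).
exists (k * 2)%N; rewrite exprM; rewrite ltr_pdivrMr // in kP.
have k1 : 1 <= k%:R :> R by rewrite ler1n.
have := bernoulli k (ltW y0); have -> : 1 + y = x by rewrite /y; lra.
move=> ber; have ky0 : 0 <= k%:R * y by rewrite mulr_ge0 // ltW.
have ber2 : (k%:R * y) ^+ 2 <= (x ^+ k) ^+ 2 by rewrite ler_sqr ?nnegrE; lra.
apply: lt_le_trans ber2; rewrite exprMn natrM.
have h1 : k%:R * (2 * a + b) < k%:R * (k%:R * y ^+ 2) by rewrite ltr_pM2l //; lra.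
have h2 : b <= k%:R * b by rewrite ler_peMl.
have -> : k%:R ^+ 2 * y ^+ 2 = k%:R * (k%:R * y ^+ 2) by rewrite expr2 mulrA.
lra.
Qed.

(** If the growth rate were smaller than [s], the number of elements of length at
    most [r] would be bounded by a multiple of [expR (s * r)].  Sorting the
    products of [n] letters by length, this bounds the sum of the
    [expR (- (s * length))] over them linearly in [n]; but it is the [n]-th power
    of a number larger than 1. *)
Theorem free_family_growth (T : finType) (f : T -> G) (s : R) : 0 <= s ->
  (forall w w' : seq T, size w = size w' ->
     (\prod_(t <- w) f t = \prod_(t <- w') f t)%g -> w = w') ->
  1 < \sum_t expR (- (s * d o (act (f t) o))) -> (s%:E <= growth_rate act o setT)%E.
Proof.
move=> s0 free S1; rewrite leNgt; apply/negP => /(growth_rate_lt s0 I)[K K0 KP].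
set S := \sum_t _ in S1.
pose l t := d o (act (f t) o); have l0 t : 0 <= l t by exact: mdist_ge0.
pose M := \sum_t l t; have M0 : 0 <= M by exact: sumr_ge0.
have lM t : l t <= M by rewrite /M (bigD1 t) //= lerDl; exact: sumr_ge0.
have [n nbig] := exponential_beats_linear (a := M * (K * expR s)) (b := K * expR s) S1
  (mulr_ge0 M0 (mulr_ge0 K0 (expR_ge0 s))) (mulr_ge0 K0 (expR_ge0 s)).
have [N NE] : exists N, N = (Num.truncn (n%:R * M)).+1 by eexists.
have /andP[N1 N2] := truncn_itv (mulr_ge0 (ler0n R n) M0).
pose wl (w : {ffun 'I_n -> T}) := \sum_(i < n) l (w i).
have wl0 w : 0 <= wl w by exact: sumr_ge0.
have wlM w : wl w <= n%:R * M.
  rewrite /wl; apply: (le_trans (y := \sum_(i < n) M)); first exact: ler_sum.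
  by rewrite sumr_const card_ord mulr_natl.
pose word (w : {ffun 'I_n -> T}) := (\prod_(t <- [seq w i | i <- enum 'I_n]) f t)%g.
have word_inj : injective word.
  move=> w w' /free; rewrite !size_map => /(_ erefl) e; apply/ffunP => i.
  by have /eq_in_map/(_ i) := e; rewrite mem_enum => /(_ isT).
have dword w : d o (act (word w) o) <= wl w.
  have -> : wl w = \sum_(t <- [seq w i | i <- enum 'I_n]) l t by rewrite big_map big_enum.
  rewrite /word; elim: [seq _ | _ <- _] => [|t q IH].
    by rewrite !big_nil (act1 act_isom) mdistxx.
  rewrite !big_cons (actM act_isom).
  have := dist_triangle (act (f t) o) o (act (f t) (act (\prod_(j <- q) f j)%g o)).
  by rewrite (act_dist act_isom) -/(l t); lra.
have p_lt w : (Num.truncn (wl w) < N)%N by rewrite NE ltnS; apply: le_truncn; exact: wlM.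
have expand : S ^+ n = \sum_(w : {ffun 'I_n -> T}) expR (- (s * wl w)).
  have -> : S ^+ n = \prod_(i < n) S by rewrite prodr_const card_ord.
  rewrite /S (bigA_distr_bigA (fun=> fun t => expR (- (s * d o (act (f t) o))))) /=.
  apply: eq_bigr => w _; rewrite -expR_sum; congr expR.
  by rewrite /wl mulr_sumr sumrN.
have upper : S ^+ n <= \sum_(m < N) K * expR s.
  rewrite expand (partition_big (fun w => Ordinal (p_lt w)) xpredT) //=.
  apply: ler_sum => m _.
  apply: (le_trans (y := \sum_(w | Ordinal (p_lt w) == m) expR (- (s * m%:R)))).
    apply: ler_sum => w /eqP wm; rewrite ler_expR lerN2 ler_wpM2l // -wm /=.
    by have /andP[] := truncn_itv (wl0 w).
  rewrite sumr_const -[leLHS]mulr_natl.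
  have cnt : (#|[pred w | Ordinal (p_lt w) == m]| <= ball_count setT (m%:R + 1))%N.
    rewrite cardE -(size_map word); apply: ball_count_ge.
      by rewrite map_inj_uniq ?enum_uniq.
    move=> h /mapP[w]; rewrite mem_enum inE => /eqP wm ->; split=> //.
    apply: le_trans (dword w) _; rewrite -wm /= natr1.
    by have /andP[_ /ltW] := truncn_itv (wl0 w).
  apply: (le_trans (y := K * expR (s * (m%:R + 1)) * expR (- (s * m%:R)))).
    apply: ler_wpM2r; first exact: expR_ge0.
    apply: le_trans (KP _ _); first by rewrite ler_nat.
    by rewrite addr_ge0.
  by rewrite -mulrA -expRD mulrDr mulr1 addrAC subrr add0r.
move: upper; rewrite sumr_const card_ord -mulr_natl leNgt => /negP; apply.
apply: le_lt_trans nbig; have NM : N%:R <= n%:R * M + 1 by rewrite NE -natr1; lra.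
have := ler_wpM2r (mulr_ge0 K0 (expR_ge0 s)) NM.
by rewrite mulrDl mul1r -(mulrA n%:R M).
Qed.

End Growth.

(** * The divergent series of a quasi-convex subgroup *)

Section Submultiplicative.
Context {R : realType}.

(** Fekete's lemma: [del] is the infimum of [ln (F r) / r]. *)
Lemma submultiplicative_rate (F : R -> nat) : (forall r : R, 0 <= r -> (0 < F r)%N) ->
  (forall r t : R, r <= t -> (F r <= F t)%N) ->
  (forall r t : R, 0 <= r -> 0 <= t -> (F (r + t)%R <= F r * F t)%N) ->
  exists2 del, 0 <= del & (forall r : R, 0 <= r -> expR (del * r) <= (F r)%:R) /\
    forall s b : R, del < s -> 0 <= b -> exists r0, forall r, r0 < r -> ln (F (r + b))%:R <= s * r.
Proof.
move=> F1 mono sub.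
have F1R r : 0 <= r -> 1 <= (F r)%:R :> R by move=> r0; rewrite ler1n F1.
have Fpos r : 0 <= r -> 0 < (F r)%:R :> R by move=> r0; rewrite ltr0n F1.
have lnF0 r : 0 <= r -> 0 <= ln (F r)%:R :> R by move=> r0; rewrite ln_ge0 // F1R.
pose E := [set q : R | exists2 r, 0 < r & q = ln (F r)%:R / r].
have E0 : lbound E 0 by move=> _ [r r0 ->]; rewrite divr_ge0 ?lnF0 ?ltW.
have hE : has_inf E by split; [exists (ln (F 1)%:R / 1), 1|exists 0].
exists (inf E); first by apply: lb_le_inf E0; case: hE.
split=> [r|s b ds b0].
  rewrite le_eqVlt => /orP[/eqP <-|r0]; first by rewrite mulr0 expR0 F1R.
  have Fr := Fpos r (ltW r0).
  rewrite -[leRHS]lnK ?posrE // ler_expR -ler_pdivlMr //.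
  by apply: ge_inf; [case: hE|exists r].
have sE : 0 < s - inf E by rewrite subr_gt0.
have [_ [r r0 ->]] := inf_adherent sE hE; rewrite addrC subrK => qs.
set q := ln (F r)%:R / r in qs.
have q0 : 0 <= q by rewrite divr_ge0 ?lnF0 ?ltW.
have Fr := Fpos r (ltW r0).
have powF n : (F (n.+1%:R * r)%R <= F r ^ n.+1)%N.
  elim: n => [|n IH]; first by rewrite mul1r expn1.
  rewrite natS_mulr expnSr; apply: leq_trans (sub _ _ (mulr_ge0 _ (ltW r0)) (ltW r0)) _; first exact: ler0n.
  by rewrite leq_mul2r IH orbT.
have lnF t : 0 <= t -> ln (F t)%:R <= q * t + ln (F r)%:R.
  move=> t0; have /andP[] := truncn_itv (divr_ge0 t0 (ltW r0)).
  set n := Num.truncn _; rewrite ler_pdivlMr // => nt /ltW tn.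
  rewrite ler_pdivrMr // in tn.
  have : ln (F t)%:R <= ln ((F r)%:R ^+ n.+1) :> R.
    have FrX : 0 < (F r)%:R ^+ n.+1 :> R by rewrite exprn_gt0.
    rewrite ler_ln ?posrE ?(Fpos t t0) //; have <- : (F r ^ n.+1)%:R = (F r)%:R ^+ n.+1 :> R by rewrite natrX.
    rewrite ler_nat.
    exact: leq_trans (mono _ _ tn) (powF n).
  rewrite lnXn // -[X in _ <= X -> _]mulr_natl natS_mulr => /le_trans; apply.
  rewrite lerD2r; have -> : ln (F r)%:R = q * r by rewrite /q divfK // gt_eqF.
  by rewrite mulrCA; apply: ler_wpM2l.
have sq : 0 < s - q by lra.
exists (Num.max 0 ((q * b + ln (F r)%:R) / (s - q))) => t; rewrite gt_max => /andP[t0 tbig].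
rewrite ltr_pdivrMr // in tbig.
by have := lnF (t + b) ltac:(lra); rewrite mulrDr; lra.
Qed.

Lemma exp_tail_sum (del x : R) N : 0 <= del -> 0 <= x ->
  \sum_(k < N | x <= k%:R) (expR (- (del * k%:R)) - expR (- (del * k.+1%:R))) <=
  expR (- (del * x)).
Proof.
move=> del0 x0; apply: (le_trans (y := Num.max 0 (expR (- (del * x)) - expR (- (del * N%:R))))); last first.
  by rewrite ge_max expR_ge0 /= lerBlDr lerDl expR_ge0.
have expmono a b : a <= b -> expR (- (del * b)) <= expR (- (del * a)).
  by move=> ab; rewrite ler_expR lerN2 ler_wpM2l.
elim: N => [|N IH]; first by rewrite big_ord0 le_max lexx.
rewrite big_mkcond big_ord_recr -big_mkcond /=.
have [xN|Nx] := lerP x N%:R.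
  rewrite max_r ?subr_ge0 ?expmono // in IH.
  by apply: le_trans (lerD IH (lexx _)) _; rewrite le_max; apply/orP; right; lra.
have m0 : Num.max 0 (expR (- (del * x)) - expR (- (del * N%:R))) = 0 :> R.
  by rewrite max_l // subr_le0; apply: expmono; exact: ltW.
rewrite m0 in IH.
by rewrite addr0; apply: le_trans IH _; rewrite le_max lexx.
Qed.

Lemma sum_seq_const (T : Type) (s : seq T) (c : R) : \sum_(x <- s) c = (size s)%:R * c.
Proof.
by elim: s => [|x s IH]; rewrite ?big_nil ?mul0r // big_cons IH natS_mulr addrC.
Qed.

Lemma ler_sum_sub (T : eqType) (s t : seq T) (w : T -> R) : uniq s -> {subset s <= t} ->
  (forall x, 0 <= w x) -> \sum_(x <- s) w x <= \sum_(x <- t) w x.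
Proof.
elim: s t => [|x s IH] t /= us st w0; first by rewrite big_nil sumr_ge0.
move/andP: us => [xs us].
rewrite big_cons (perm_big _ (perm_to_rem (st x (mem_head _ _)))) big_cons lerD2l.
apply: IH => // y ys; have := st y; rewrite inE ys orbT => /(_ isT) yt.
have xy : y != x by apply: contraNneq xs => <-.
have := perm_mem (perm_to_rem (st x (mem_head _ _))) y.
by rewrite yt inE (negbTE xy) /= => <-.
Qed.

End Submultiplicative.

Section SubgroupSeries.
Context {R : realType} {G : groupType} {X : metricType R} (act : G -> X -> X).
Local Notation d := (@mdist R X).
Context (act_isom : isometric_action act) (act_proper : proper_action act).
Context (H : groupClosed G) (p0 : X).
Local Notation b h := (d p0 (act h p0)).

Definition subgroup_ball (r : R) : seq G :=
  enum_fset (fset_set [set h | [set` H] h /\ b h <= r]).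

Lemma subgroup_ball_uniq r : uniq (subgroup_ball r).
Proof. exact: fset_uniq. Qed.

Lemma mem_subgroup_ball r h : h \in subgroup_ball r <-> h \in H /\ b h <= r.
Proof.
have fin := orbit_ball_finiteI act_proper p0 [set` H] r.
by rewrite /subgroup_ball in_fset_set ?inE.
Qed.

Local Notation F r := (size (subgroup_ball r)).

Lemma subgroup_ball_mono r t : r <= t -> (F r <= F t)%N.
Proof.
move=> rt; apply: uniq_leq_size; first exact: subgroup_ball_uniq.
by move=> h /mem_subgroup_ball[hH hr]; apply/mem_subgroup_ball; split => //; lra.
Qed.

Lemma subgroup_ball_gt0 r : 0 <= r -> (0 < F r)%N.
Proof.
move=> r0; have : 1%g \in subgroup_ball r.
  by apply/mem_subgroup_ball; rewrite (act1 act_isom) mdistxx; split => //; exact: gpred1.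
by case: (subgroup_ball r).
Qed.

(** Cut a geodesic from [p0] to [act h p0] at distance about [r] from [p0]; an
    orbit point of [H] near the cut factors [h]. *)
Lemma subgroup_ball_submult (injX : injective_space X) (Y : set X) (eta C : R) :
  0 <= eta -> 0 <= C -> (forall h, h \in H -> Y (act h p0)) ->
  (forall y, Y y -> exists2 h, h \in H & d y (act h p0) <= C) ->
  (forall (s t : R) (c : R -> X), s <= t -> geodesic d `[s, t] c -> Y (c s) -> Y (c t) ->
     c @` `[s, t] `<=` nbhd d eta Y) ->
  forall r t, 0 <= r -> 0 <= t ->
  (F (r + t + 2 * (eta + C))%R <= F (r + 2 * (eta + C))%R * F (t + 2 * (eta + C))%R)%N.
Proof.
move=> eta0 C0 YH Ycob Yqc r t r0 t0; pose e := eta + C.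
rewrite -/e -(size_allpairs (fun x y => (x * y)%g)); apply: uniq_leq_size.
  exact: subgroup_ball_uniq.
move=> h /mem_subgroup_ball[hH hr].
have e0 : 0 <= e by rewrite addr_ge0.
have [c [gc c0 cL]] := geodesic_exists injX p0 (act h p0).
set L := b h in hr gc cL; have L0 : 0 <= L by exact: mdist_ge0.
pose tau := Num.min (r + e) L.
have [tau0 tauL taur] : [/\ 0 <= tau, tau <= L & tau <= r + e].
  by rewrite /tau le_min L0 !ge_min !lexx orbT addr_ge0.
have tauLt : L - tau <= t + e.
  by rewrite /tau /Num.min; case: ifP => _; lra.
have [y Yy zy] : nbhd d eta Y (c tau).
  apply: (Yqc 0 L c L0 gc).
  - by rewrite c0 -(act1 act_isom p0); apply: YH; exact: gpred1.
  - by rewrite cL; exact: YH.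
  - by exists tau => //; rewrite /= in_itv /= tau0.
have [h' h'H yh'] := Ycob y Yy.
have zh' : d (c tau) (act h' p0) <= e.
  by have := dist_triangle y (c tau) (act h' p0); rewrite /e; lra.
have d1 : d p0 (c tau) = tau by rewrite -{1}c0 (geodesic_dist gc) // subr0.
have d2 : d (c tau) (act h p0) = L - tau by rewrite -cL (geodesic_dist gc).
apply/allpairsP; exists (h', h'^-1 * h)%g; split=> /=; last by rewrite mulVKg.
  apply/mem_subgroup_ball; split=> //.
  by have := dist_triangle (c tau) p0 (act h' p0); lra.
apply/mem_subgroup_ball; split; first by apply: gpredM => //; apply: gpredVr.
rewrite -(orbit_dist act_isom).
by have := dist_triangle (c tau) (act h' p0) (act h p0); rewrite (metric_sym _ (c tau)); lra.
Qed.

(** For [del > 0], each term is at least the sum of the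
    [expR (- (del * k)) - expR (- (del * k.+1))] over the [k >= d p0 (act h p0)];
    summing over [h] first, every [k] contributes at least a fixed constant.  For
    [del = 0] the sum counts elements of an infinite group. *)
Lemma poincare_unbounded (del a : R) : infinite_set [set` H] -> 0 <= del ->
  (forall k : nat, expR (del * (k%:R - a)) <= (F k%:R)%:R) ->
  forall V, exists n : nat, V <= \sum_(h <- subgroup_ball n%:R) expR (- (del * b h)).
Proof.
move=> infH del0 low V.
have [del_0|delpos] : del = 0 \/ 0 < del.
  by move: del0; rewrite le_eqVlt => /orP[/eqP <-|]; [left|right].
  have [N _ NV] := exists_nat_gt V.
  have [B BH NB] := infinite_set_fset N infH.
  have [M M0 MP] := finite_upper_bound (fun h => b h) (finite_fset B).
  have [n _ nM] := exists_nat_gt M.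
  exists n; rewrite (eq_bigr (fun=> 1)); last by move=> h _; rewrite del_0 mul0r oppr0 expR0.
  rewrite sum_seq_const mulr1.
  apply: le_trans (ltW NV) _; rewrite ler_nat; apply: leq_trans NB _.
  apply: uniq_leq_size; first exact: fset_uniq.
  move=> h hB; apply/mem_subgroup_ball; split; first exact: BH.
  by apply: le_trans (MP h hB) _; exact: ltW.
pose c := 1 - expR (- del).
have c0 : 0 < c by rewrite subr_gt0 -expR0 ltr_expR oppr_lt0.
pose c' := c * expR (- (del * a)).
have c'0 : 0 < c' by rewrite mulr_gt0 ?expR_gt0.
have [n _ nV] := exists_nat_gt (V / c').
rewrite ltr_pdivrMr // in nV.
exists n; apply: le_trans (ltW nV) _.
pose g (k : nat) := expR (- (del * k%:R)) - expR (- (del * k.+1%:R)).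
have gE k : g k = c * expR (- (del * k%:R)).
  by rewrite /g -natr1 mulrDr mulr1 opprD expRD /c mulrBl mul1r (mulrC (expR (- del))).
have g0 k : 0 <= g k by rewrite gE mulr_ge0 ?expR_ge0 // ltW.
apply: (le_trans (y := \sum_(h <- subgroup_ball n%:R) \sum_(k < n | b h <= k%:R) g k)); last first.
  by apply: ler_sum => h _; apply: exp_tail_sum => //; exact: mdist_ge0.
rewrite (exchange_big_dep xpredT) //=.
apply: (le_trans (y := \sum_(k < n) c')); first by rewrite sumr_const card_ord mulr_natl.
apply: ler_sum => k _; rewrite -big_filter sum_seq_const.
have cnt : (F k%:R <= size [seq h <- subgroup_ball n%:R | (b h <= k%:R)%R])%N.
  apply: uniq_leq_size; first exact: subgroup_ball_uniq.
  move=> h /mem_subgroup_ball[hH hk]; rewrite mem_filter hk /=.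
  by apply/mem_subgroup_ball; split => //; apply: le_trans hk _; rewrite ler_nat ltnW.
apply: (le_trans (y := g k * (F k%:R)%:R)); last first.
  by rewrite mulrC; apply: ler_wpM2r => //; rewrite ler_nat.
apply: le_trans (ler_wpM2l (g0 k) (low k)).
by rewrite gE -mulrA -expRD mulrBr addrA addNr add0r.
Qed.

End SubgroupSeries.

Section Separated.
Context {R : realType} {G : groupType} {X : metricType R} (act : G -> X -> X).
Local Notation d := (@mdist R X).
Context (act_isom : isometric_action act) (act_proper : proper_action act) (o p0 : X).
Local Notation b h := (d p0 (act h p0)).

(** Elements too close to 1 are left out as well, since the pieces of the letters
    have to be away from the incoming piece. *)
Definition separated (rr : R) (s : seq G) :=
  [/\ uniq s, forall x, x \in s -> rr < d o (act x o) &
      forall x y, x \in s -> y \in s -> x != y -> rr < d (act x o) (act y o)].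

Lemma separated_net (rr : R) (l : seq G) : 0 <= rr -> exists s : seq G,
  [/\ {subset s <= l}, separated rr s &
      forall h, h \in l -> exists2 x, x \in 1%g :: s & d (act x o) (act h o) <= rr].
Proof.
move=> rr0; elim: l => [|h l [s [sl [us s1 s2] net]]]; first by exists [::].
have [[x xs xh]|far] := pselect (exists2 x, x \in 1%g :: s & d (act x o) (act h o) <= rr).
  exists s; split=> // [y /sl ys|y]; rewrite inE; first by rewrite ys orbT.
  by move=> /orP[/eqP ->|/net //]; exists x.
have farx x : x \in 1%g :: s -> rr < d (act x o) (act h o).
  by move=> xs; rewrite ltNge; apply/negP => xh; apply: far; exists x.
exists (h :: s); split.
- by move=> y; rewrite !inE => /orP[->//|/sl ->]; rewrite orbT.
- split=> /=.
  + rewrite us andbT; apply/negP => hs.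
    by have := farx h; rewrite inE hs orbT mdistxx => /(_ isT); lra.
  + move=> y; rewrite inE => /orP[/eqP ->|/s1 //].
    by have := farx 1%g (mem_head _ _); rewrite (act1 act_isom).
  + move=> y z; rewrite !inE => /orP[/eqP ->|ys] /orP[/eqP ->|zs] yz.
    * by rewrite eqxx in yz.
    * by rewrite metric_sym; apply: farx; rewrite inE zs orbT.
    * by apply: farx; rewrite inE ys orbT.
    * exact: s2.
- move=> y; rewrite inE => /orP[/eqP ->|/net[x xs xy]].
    by exists h; rewrite ?inE ?eqxx ?orbT // mdistxx.
  by exists x => //; move: xs; rewrite !inE => /orP[->//|->]; rewrite !orbT.
Qed.

Context (H : groupClosed G).

(** A maximal sparse subset of a ball is a net, so its sum is smaller than that
    of the ball by a bounded factor only. *)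
Lemma separated_series (del a rr Z : R) : infinite_set [set` H] -> 0 <= del -> 0 <= rr ->
  (forall k : nat, expR (del * (k%:R - a)) <= (size (subgroup_ball act H p0 k%:R))%:R) ->
  exists s : seq G, [/\ {subset s <= H}, separated rr s &
    Z <= \sum_(h <- s) expR (- (del * b h))].
Proof.
move=> infH del0 rr0 low.
have /finite_seqP[U UP] := orbit_ball_finite act_proper o rr.
pose w h := expR (- (del * b h)); have w0 h : 0 <= w h by exact: expR_ge0.
pose C4 := (size U)%:R * expR (del * (rr + 2 * d o p0)).
have C40 : 0 <= C4 by rewrite mulr_ge0 ?expR_ge0.
have [n nV] := poincare_unbounded act_proper infH del0 low (C4 * (1 + Z) + 1).
have [s [sl sep net]] := separated_net (subgroup_ball act H p0 n%:R) rr0.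
exists s; split => //.
  by move=> h /sl /(mem_subgroup_ball act_proper)[].
have sub : {subset subgroup_ball act H p0 n%:R <= [seq (x * u)%g | x <- 1%g :: s, u <- U]}.
  move=> h /net[x xs xh]; apply/allpairsP; exists (x, x^-1 * h)%g; split=> //=; last by rewrite mulVKg.
  suff : [set` U] (x^-1 * h)%g by [].
  by rewrite -UP /= -(orbit_dist act_isom).
have := ler_sum_sub (subgroup_ball_uniq act H p0 n%:R) sub w0.
rewrite big_allpairs_dep => up.
have each x : \sum_(u <- U) w (x * u)%g <= C4 * w x.
  rewrite /C4 -mulrA -sum_seq_const big_seq [leRHS]big_seq; apply: ler_sum => u uU.
  have ur : d o (act u o) <= rr by have : [set` U] u by []; rewrite -UP.
  have up0 : d p0 (act u p0) <= rr + 2 * d o p0.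
    have := dist_triangle o p0 (act u p0); have := dist_triangle (act u o) o (act u p0).
    by rewrite (act_dist act_isom) (metric_sym p0 o); lra.
  have bx : b x <= b (x * u)%g + (rr + 2 * d o p0).
    have := dist_triangle (act (x * u)%g p0) p0 (act x p0).
    rewrite (metric_sym (act (x * u)%g p0) (act x p0)) (actM act_isom) (act_dist act_isom); lra.
  rewrite /w -expRD ler_expR; have := ler_wpM2l del0 bx; rewrite !mulrDr; lra.
have : \sum_(x <- 1%g :: s) \sum_(u <- U) w (x * u)%g <= C4 * (1 + \sum_(x <- s) w x).
  apply: le_trans (ler_sum _ (fun x _ => each x)) _.
  rewrite -mulr_sumr big_cons /w (act1 act_isom) mdistxx mulr0 oppr0 expR0 //.
move=> up2; rewrite leNgt; apply/negP => small.
have := ler_wpM2l C40 (_ : 1 + \sum_(x <- s) w x <= 1 + Z); rewrite /w lerD2l (ltW small) => /(_ isT).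
by move: up up2 nV; rewrite /w; lra.
Qed.

End Separated.

(** * The growth gap *)

Section Gap.
Context {R : realType} {G : groupType} {X : metricType R} (act : G -> X -> X).
Local Notation d := (@mdist R X).
Context (act_isom : isometric_action act) (act_proper : proper_action act) (o : X).

Lemma growth_rate_le_ln (A : set G) (s r0 : R) (N : R -> nat) : A 1%g ->
  (forall r, r0 < r -> 0 < r -> (ball_count act o A r <= N r)%N /\ ln (N r)%:R <= s * r) ->
  (growth_rate act o A <= s%:E)%E.
Proof.
move=> A1 h; apply: (growth_rate_le (r0 := Num.max r0 0)) => r.
rewrite gt_max => /andP[rr0 r_0]; have [cN lnN] := h r rr0 r_0.
have c0 : (0 < ball_count act o A r)%N.
  apply: (@ball_count_ge _ _ _ _ act_proper o A r [:: 1%g]) => // x.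
  by rewrite inE => /eqP ->; split => //; rewrite (act1 act_isom) mdistxx ltW.
rewrite mulrC ler_pdivrMr //; apply: le_trans lnN.
by rewrite ler_ln ?posrE ?ltr0n ?ler_nat // (leq_trans c0).
Qed.

Lemma expR_three_quarters (s x : R) : s * x <= 1 / 4 -> 3 / 4 <= expR (- (s * x)).
Proof. by move=> h; have := expR_ge1Dx (- (s * x)); lra. Qed.

Lemma finite_subgroup_gap (H : groupClosed G) (f : bool -> G) : finite_set [set` H] ->
  (forall s s' : seq bool, size s = size s' ->
     (\prod_(i <- s) f i = \prod_(i <- s') f i)%g -> s = s') ->
  (growth_rate act o [set` H] < growth_rate act o [set: G])%E.
Proof.
move=> /finite_seqP[hs hsE] free.
have {}hsE h : h \in H -> h \in hs by move=> hH; have : [set` hs] h by rewrite -hsE.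
pose M := d o (act (f true) o) + d o (act (f false) o).
have [t0 f0] : 0 <= d o (act (f true) o) /\ 0 <= d o (act (f false) o) by split; exact: mdist_ge0.
have M0 : 0 <= M by rewrite addr_ge0.
pose s := (4 * (M + 1))^-1; have s0 : 0 < s by rewrite invr_gt0 mulr_gt0 //; lra.
have sM : s * (M + 1) = 1 / 4 by rewrite /s invfM -mulrA mulVf ?mulr1 ?mul1r //; lra.
have small b : s * d o (act (f b) o) <= 1 / 4.
  rewrite -sM ler_wpM2l ?(ltW s0) //; rewrite /M; case: b; lra.
have lower : (s%:E <= growth_rate act o [set: G])%E.
  apply: (free_family_growth act_isom act_proper (f := f) (ltW s0) free).
  rewrite big_bool /=.
  have := expR_three_quarters (small true); have := expR_three_quarters (small false); lra.
apply: lt_le_trans lower; apply: (@le_lt_trans _ _ (s / 2)%:E); last first.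
  by rewrite lte_fin; lra.
pose N := size hs.
apply: (growth_rate_le_ln (N := fun=> N) (r0 := ln N%:R / (s / 2))).
  by rewrite /=; exact: gpred1.
move=> r rbig r0; split; last first.
  by rewrite ltr_pdivrMr in rbig; [rewrite mulrC ltW|lra].
by apply: ball_count_le => // h Hh _; exact: hsE.
Qed.

(** For a finite sparse set whose sum at the exponent [del] is large enough to
    absorb the constants [c1], [c2] and the change of base point, the sum still
    exceeds 1 at the slightly larger exponent [del + ep]. *)
Lemma infinite_subgroup_gap (injX : injective_space X) (H : groupClosed G) (c1 c2 : G) (rr : R) :
  infinite_set [set` H] -> quasi_convex act [set` H] ->
  (forall (T : eqType) (h : T -> G),
    (forall i, h i \in H) -> (forall i, rr < d o (act (h i) o)) ->
    (forall i j, i != j -> rr < d (act (h i) o) (act (h j) o)) ->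
    forall s s' : seq T, size s = size s' ->
    (\prod_(i <- s) (c1 * h i * c2) = \prod_(i <- s') (c1 * h i * c2))%g -> s = s') ->
  (growth_rate act o [set` H] < growth_rate act o [set: G])%E.
Proof.
move=> infH [Y [_ Yinv [p0 Yp0 [C CP]] [eta eta0 Yqc]]] free.
pose C' := Num.max C 0.
have C'0 : 0 <= C' by rewrite /C' le_max lexx orbT.
have C'P y : Y y -> exists2 h, h \in H & d y (act h p0) <= C'.
  by move=> /CP[h Hh yh]; exists h => //; rewrite /C' le_max yh.
have YH h : h \in H -> Y (act h p0) by move=> hH; exact: Yinv.
pose e := eta + C'; have e0 : 0 <= e by rewrite addr_ge0.
have dd0 : 0 <= d o p0 by exact: mdist_ge0.
pose F r := size (subgroup_ball act H p0 (r + 2 * e)).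
have [|||del del0 [low high]] := submultiplicative_rate (F := F).
- by move=> r r0; apply: subgroup_ball_gt0 => //; lra.
- by move=> r t rt; apply: subgroup_ball_mono => //; lra.
- exact: (subgroup_ball_submult act_isom act_proper injX eta0 C'0 YH C'P Yqc).
have upper s : del < s -> (growth_rate act o [set` H] <= s%:E)%E.
  move=> ds; have [|r0 r0P] := high s (2 * d o p0) ds; first lra.
  apply: (growth_rate_le_ln (N := fun r => F (r + 2 * d o p0)) (r0 := r0)).
    by rewrite /=; exact: gpred1.
  move=> r rr0 r_0; split; last exact: r0P.
  apply: ball_count_le => // h Hh hr; apply/(mem_subgroup_ball act_proper); split=> //.
  have := dist_triangle o p0 (act h p0); have := dist_triangle (act h o) o (act h p0).
  by rewrite (act_dist act_isom) (metric_sym p0 o); lra.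
have low' (k : nat) : expR (del * (k%:R - 2 * e)) <= (size (subgroup_ball act H p0 k%:R))%:R.
  have [ke|ke] := lerP (2 * e) k%:R.
    by have := low (k%:R - 2 * e); rewrite /F subrK; apply; lra.
  apply: (le_trans (y := 1)); last by rewrite ler1n subgroup_ball_gt0.
  by rewrite -[leRHS]expR0 ler_expR mulr_ge0_le0 //; lra.
pose C3 := d o (act c1 o) + d o (act c2 o) + 2 * d o p0.
pose rr' := Num.max rr 0.
have [rr'0 rrr'] : 0 <= rr' /\ rr <= rr' by rewrite /rr' !le_max !lexx orbT.
have [s [sH [us sfar spair] sbig]] := separated_series act_isom act_proper o
  (2 * expR (del * C3)) infH del0 rr'0 low'.
pose T := 'I_(size s); pose h (i : T) := nth 1%g s i.
have hs (i : T) : h i \in s by exact: mem_nth.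
have hfar i : rr < d o (act (h i) o) by apply: le_lt_trans rrr' (sfar _ (hs i)).
have hpair i j : i != j -> rr < d (act (h i) o) (act (h j) o).
  move=> ij; apply: le_lt_trans rrr' (spair _ _ (hs i) (hs j) _).
  by rewrite /h nth_uniq.
have freeT := free T h (fun i => sH _ (hs i)) hfar hpair.
have [M M0 MP] := finite_upper_bound (fun x => d p0 (act x p0) + C3) (finite_seq s).
pose ep := (4 * (M + 1))^-1; have ep0 : 0 < ep by rewrite invr_gt0 mulr_gt0 //; lra.
have epM : ep * (M + 1) = 1 / 4 by rewrite /ep invfM -mulrA mulVf ?mulr1 ?mul1r //; lra.
have lower : ((del + ep)%:E <= growth_rate act o [set: G])%E.
  apply: (free_family_growth act_isom act_proper (f := fun i : T => (c1 * h i * c2)%g) _ freeT).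
    by lra.
  have dl x : d o (act (c1 * x * c2)%g o) <= d p0 (act x p0) + C3.
    rewrite !(actM act_isom).
    have := dist_triangle (act c1 o) o (act c1 (act x (act c2 o))).
    have := dist_triangle (act x o) o (act x (act c2 o)).
    have := dist_triangle p0 o (act x o); have := dist_triangle (act x p0) p0 (act x o).
    by rewrite !(act_dist act_isom) (metric_sym p0 o) /C3; lra.
  pose w x := expR (- (del * d p0 (act x p0))).
  have each x : x \in s -> 3 / 4 * expR (- (del * C3)) * w x <=
      expR (- ((del + ep) * d o (act (c1 * x * c2)%g o))).
    move=> xs; apply: (le_trans (y := expR (- ((del + ep) * (d p0 (act x p0) + C3))))); last first.
      by rewrite ler_expR lerN2 ler_wpM2l //; lra.
    have epx : ep * (d p0 (act x p0) + C3) <= 1 / 4.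
      by rewrite -epM ler_wpM2l ?(ltW ep0) //; have := MP x xs; lra.
    have -> : - ((del + ep) * (d p0 (act x p0) + C3)) =
      - (ep * (d p0 (act x p0) + C3)) + (- (del * C3) + - (del * d p0 (act x p0))) by lra.
    rewrite expRD expRD mulrA -/(w x) ler_wpM2r ?expR_ge0 // ler_wpM2r ?expR_ge0 //.
    exact: expR_three_quarters.
  have -> : \sum_(i : T) expR (- ((del + ep) * d o (act (c1 * h i * c2)%g o))) =
      \sum_(x <- s) expR (- ((del + ep) * d o (act (c1 * x * c2)%g o))).
    by rewrite (big_nth 1%g) big_mkord.
  apply: (@lt_le_trans _ _ (\sum_(x <- s) 3 / 4 * expR (- (del * C3)) * w x)); last first.
    by rewrite big_seq [leRHS]big_seq; exact: ler_sum.
  rewrite -mulr_sumr; apply: (@lt_le_trans _ _ (3 / 4 * expR (- (del * C3)) * (2 * expR (del * C3)))).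
    by rewrite mulrACA -expRD addNr expR0; lra.
  by rewrite ler_wpM2l // mulr_ge0 ?expR_ge0 //; lra.
apply: lt_le_trans lower; apply: (le_lt_trans (upper (del + ep / 2) _)); first lra.
by rewrite lte_fin; lra.
Qed.

End Gap.

Theorem theorem10 (R : realType) (G : groupType) (X : metricType R)
    (act : G -> X -> X)
    (act_isom : isometric_action act)
    (act_proper : proper_action act)
    (act_cobounded : cobounded_action act)
    (X_injective : injective_space X)
    (G_not_vcyclic : ~ virtually_cyclic G)
    (G_morse : contains_morse_ray R G)
    (H : groupClosed G)
    (H_infinite_index : ~ finite_index [set` H])
    (H_quasi_convex : quasi_convex act [set` H])
    (o : X) :
  (growth_rate act o [set` H] < growth_rate act o [set: G])%E.
Proof.
have [g [Lam [D [Q /= [[Lam1 D0 Q0] pstep plow bt cs]]]]] :=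
  contracting_orbit_seq o act_isom act_proper act_cobounded X_injective G_morse.
have [finH|infH] := pselect (finite_set [set` H]).
  have [f free] := free_pair act_isom act_proper Lam1 D0 Q0 pstep plow bt cs G_not_vcyclic.
  exact: (finite_subgroup_gap act_isom act_proper o finH free).
have [c1 [c2 [rr free]]] := free_subgroup_family act_isom act_proper Lam1 D0 Q0 pstep plow bt cs
  G_not_vcyclic X_injective H_infinite_index H_quasi_convex.
exact: (infinite_subgroup_gap act_isom act_proper X_injective infH H_quasi_convex free).
Qed.
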